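(* Let $\mathbb{K}$ be $\mathbb{R}$ or $\mathbb{T}=\mathbb{R}/2\pi\mathbb{Z}$. Let $V$ assign to each $\nu\in\mathcal{P}(\mathbb{K})$ a function $V[\nu]:\mathbb{K}\to\mathbb{R}$, and assume that there are constants $C_1,C_2,C_3>0$ such that for all $\nu,\nu_1,\nu_2\in\mathcal{P}(\mathbb{K})$ and all $x,y\in\mathbb{K}$: $\|V[\nu]\|_{L^\infty(\mathbb{K})}\le C_1$; $|V[\nu](x)-V[\nu](y)|\le C_2|x-y|$; $\|V[\nu_1]-V[\nu_2]\|_{L^\infty(\mathbb{K})}\le C_3\,d_W(\nu_1,\nu_2)$. Let $\mu_0\in\mathcal{P}(\mathbb{K})$ have compact support. Assume that the CFL condition $\lambda_0\le\frac{\Delta t}{\Delta x}\le C_1^{-1}$ is satisfied for some $\lambda_0>0$ independent of $\Delta x$. Then the Lax--Friedrichs approximations $\mu^{\Delta x}$ converge weakly to the measure-valued solution $\mu$ of $$\partial_t\mu+\partial_x(V[\mu]\mu)=0\ \ (x\in\mathbb{K},\ t>0),\qquad \mu|_{t=0}=\mu_0 .$$ More precisely, for any $T>0$, $$\sup_{t\in[0,T]}d_W\big(\mu^{\Delta x}_t,\mu_t\big)\to0\qquad\text{as }\Delta x\to0.$$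
   Context: $\mathcal{M}(\mathbb{K})=(C_0(\mathbb{K}))^*$ is the space of bounded Radon measures on $\mathbb{K}$, $\mathcal{P}(\mathbb{K})$ the subset of probability measures, and $\langle\nu,\psi\rangle=\int_{\mathbb{K}}\psi\,d\nu$. On $\mathbb{T}$, $|x-y|$ is the quotient distance. Velocity fields $V[\nu]$ are defined pointwise and $\|\cdot\|_{L^\infty}$ is the supremum norm. The 1-Wasserstein metric is $$d_W(\nu_1,\nu_2)=\sup\Big\{\int_{\mathbb{K}}\psi\,d(\nu_2-\nu_1):\psi\in C_b(\mathbb{K}),\ \|\psi\|_{\mathrm{Lip}}\le1\Big\},$$ where $\|\psi\|_{\mathrm{Lip}}$ is the Lipschitz constant of $\psi$. Measure-valued solution: a map $t\mapsto\mu_t\in\mathcal{P}(\mathbb{K})$, $t\in[0,\infty)$, such that $t\mapsto\langle\mu_t,\psi\rangle$ is continuous for every $\psi\in C_0(\mathbb{K})$ and $$\int_0^\infty\int_{\mathbb{K}}\big(\partial_t\varphi(x,t)+V[\mu_t](x)\,\partial_x\varphi(x,t)\big)\,d\mu_t(x)\,dt+\int_{\mathbb{K}}\varphi(x,0)\,d\mu_0(x)=0$$ for every $\varphi\in C_c^\infty(\mathbb{K}\times[0,\infty))$. (Under the stated assumptions on $V$ and $\mu_0$, it is a known theorem of Neunzert and Dobrushin that a measure-valued solution exists and is unique.) Lax--Friedrichs method: take a uniform mesh on $\mathbb{K}$ with cells $[x_{i-1/2},x_{i+1/2})$ of length $\Delta x$ partitioning $\mathbb{K}$ (with $i\in\mathbb{Z}$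 if $\mathbb{K}=\mathbb{R}$; finitely many $i$, read periodically, if $\mathbb{K}=\mathbb{T}$), cell midpoints $x_i$, and times $t^n=n\Delta t$. Let $\psi_i$ be the hat function $\psi_i(x)=\max(0,1-|x-x_i|/\Delta x)$. Define $\mu_i^0=\langle\mu_0,\psi_i\rangle$ and $$\mu_i^{n+1}=\frac{\mu_{i-1}^n+\mu_{i+1}^n}{2}-\Delta t\,\frac{V[\mu^n]_{i+1}\mu_{i+1}^n-V[\mu^n]_{i-1}\mu_{i-1}^n}{2\Delta x},$$ where $\mu^n=\sum_i\mu_i^n\delta_{x_i}$ and $V[\mu^n]_i=V[\mu^n](x_i)$. The approximate solution is $$\mu_t^{\Delta x}=\frac{t^{n+1}-t}{\Delta t}\mu^n+\frac{t-t^n}{\Delta t}\mu^{n+1}\quad\text{for }t\in[t^n,t^{n+1}).$$ *)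

(* Defs.v *)
From HB Require Import structures.
From mathcomp Require Import all_boot all_order all_algebra.
From mathcomp Require Import generic_quotient.
From mathcomp Require Import all_classical all_reals all_analysis.

Set Implicit Arguments.
Unset Strict Implicit.
Unset Printing Implicit Defensive.

Import Order.TTheory GRing.Theory Num.Theory.
Import numFieldNormedType.Exports.

Local Open Scope classical_set_scope.
Local Open Scope ring_scope.
Local Open Scope quotient_scope.

Section torus.
Context (R : realType).

Definition mod2pi (a b : R) : bool :=
  `[< exists k : int, a - b = k%:~R * (2 * pi) >].

Lemma mod2pi_refl : reflexive mod2pi.
Proof. by move=> a; apply/asboolP; exists 0; rewrite subrr mul0r. Qed.

Lemma mod2pi_sym : symmetric mod2pi.
Proof.
have H a b : mod2pi a b -> mod2pi b a.
  move=> /asboolP[k hk]; apply/asboolP; exists (- k).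
  by rewrite -opprB hk intrN mulNr.
by move=> a b; apply/idP/idP; exact: H.
Qed.

Lemma mod2pi_trans : transitive mod2pi.
Proof.
move=> b a c /asboolP[k hk] /asboolP[l hl]; apply/asboolP; exists (k + l).
by rewrite intrD mulrDl -hk -hl addrA subrK.
Qed.

Canonical mod2pi_equiv :=
  EquivRel mod2pi mod2pi_refl mod2pi_sym mod2pi_trans.

Definition torus : Type := quotient_topology {eq_quot mod2pi_equiv}.

HB.instance Definition _ := Quotient.on torus.
HB.instance Definition _ := PointedTopological.on torus.

Definition torus_pi (a : R) : torus := \pi_torus a.

Definition torus_dist (x y : torus) : R :=
  inf [set d | exists a b, [/\ torus_pi a = x, torus_pi b = y & d = `|a - b|]].

End torus.

(* The data through which the real line and the torus enter the problem.
   `covering` is the covering map from R and `lift_of` a (non-canonical) section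
   of it.  `mesh_size dx` says that the space can be partitioned into cells of
   length dx; nodes are numbered by all integers (periodically on the torus),
   and `cells dx` selects one number for each cell. *)
Record spatial_domain (R : realType) := SpatialDomain {
  carrier :> ptopologicalType;
  covering : R -> carrier;
  lift_of : carrier -> R;
  dom_dist : carrier -> carrier -> R;
  mesh_size : set R;
  cells : R -> set int }.

Definition real_line (R : realType) : spatial_domain R :=
  @SpatialDomain R R id id (fun x y => `|x - y|) [set dx | 0 < dx] (fun=> setT).

Definition torus_domain (R : realType) : spatial_domain R :=
  @SpatialDomain R (torus R) (@torus_pi R) (fun x : torus R => repr x)
    (@torus_dist R)
    [set dx | 0 < dx /\ exists N : nat, N%:R * dx = 2 * pi]
    (fun dx => [set i : int | 0 <= i%:~R * dx < 2 * pi]).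

Section measures.
Context (R : realType) (K : spatial_domain R).

Definition borel := g_sigma_algebraType (@open K).

Definition prob := probability borel R.

Definition pairing (nu : prob) (psi : K -> R) : R :=
  (\int[nu]_(x in [set: borel]) psi x)%R.

Definition sup_norm (f : K -> R) : \bar R :=
  ereal_sup [set `|f x|%:E | x in [set: K]].

Definition bounded_continuous (psi : K -> R) : Prop :=
  continuous psi /\ exists M, forall x, `|psi x| <= M.

Definition vanishing_continuous (psi : K -> R) : Prop :=
  continuous psi /\
  forall eps, 0 < eps ->
    exists2 A : set K, compact A & forall x, ~ A x -> `|psi x| < eps.

(* Extended-real valued: infinite when first moments are missing. *)
Definition dW (nu1 nu2 : prob) : \bar R :=
  ereal_sup [set (pairing nu2 psi - pairing nu1 psi)%:E | psi in
    [set psi | bounded_continuous psi /\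
               forall x y, `|psi x - psi y| <= dom_dist x y]].

Definition msupport (nu : prob) : set K :=
  [set x | forall U : set K, open U -> U x -> (0 < nu U)%E].

End measures.

Section solutions.
Context (R : realType) (K : spatial_domain R).

(* Class C^n on the plane: the iterated partial derivatives of order at most n
   exist and are continuous. *)
Fixpoint Ck (n : nat) (f : R * R -> R) : Prop :=
  continuous f /\
  if n is m.+1 then
    [/\ forall z, derivable f z (1, 0), forall z, derivable f z (0, 1),
        Ck m ('D_(1, 0) f) & Ck m ('D_(0, 1) f)]
  else True.

Definition lifted (phi : K * R -> R) (z : R * R) : R :=
  phi (covering K z.1, z.2).

(* The derivatives do not depend on the chosen lift of x, since on the torus
   `lifted phi` is periodic in its first argument. *)
Definition d_x (phi : K * R -> R) (x : K) (t : R) : R :=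
  'D_(1, 0) (lifted phi) (lift_of x, t).

Definition d_t (phi : K * R -> R) (x : K) (t : R) : R :=
  'D_(0, 1) (lifted phi) (lift_of x, t).

(* Smooth functions on K x [0, +oo[ are the restrictions of smooth functions on
   K x R; only the values at times t >= 0 matter, so that the support is
   computed inside K x [0, +oo[ and phi need not vanish at t = 0. *)
Definition test_function (phi : K * R -> R) : Prop :=
  (forall n, Ck n (lifted phi)) /\
  compact (closure [set z : K * R | 0 <= z.2 /\ phi z != 0]).

Definition weak_integrand (V : prob K -> K -> R) (mu : R -> prob K)
    (phi : K * R -> R) (t : R) : R :=
  pairing (mu t) (fun x => d_t phi x t + V (mu t) x * d_x phi x t).

(* mu is only used at times t >= 0.  The library integral is a total function,
   hence the explicit requirement that the time integral exists. *)
Definition measure_valued_solution (V : prob K -> K -> R) (mu0 : prob K)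
    (mu : R -> prob K) : Prop :=
  [/\ forall A : set (borel K), measurable A -> mu 0 A = mu0 A,
      forall psi, vanishing_continuous psi ->
        {within `[0, +oo[, continuous (fun t => pairing (mu t) psi)} &
      forall phi, test_function phi ->
        (@lebesgue_measure R).-integrable `[0, +oo[
          (EFin \o weak_integrand V mu phi) /\
        (\int[@lebesgue_measure R]_(t in `[0, +oo[) weak_integrand V mu phi t)%R
          + pairing mu0 (fun x => phi (x, 0)) = 0].

End solutions.

Section lax_friedrichs.
Context (R : realType) (K : spatial_domain R).
Context (V : prob K -> K -> R) (mu0 : prob K).
(* x0 is the midpoint of the cell number 0. *)
Variables (dx dt x0 : R).

Definition node (i : int) : K := covering K (x0 + i%:~R * dx).

Definition hat (i : int) (x : K) : R :=
  Num.max 0 (1 - dom_dist x (node i) / dx).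

(* The probability measure that coincides with the set function m; an
   unspecified one if there is none.  V only accepts probability measures; under
   the CFL condition the masses of the scheme are nonnegative with sum 1. *)
Definition as_prob (m : set (borel K) -> \bar R) : prob K :=
  get [set P : prob K | forall A : set (borel K), measurable A -> P A = m A].

Definition atomic (c : int -> R) : prob K :=
  as_prob (fun A =>
    \esum_(i in cells K dx) ((c i)%:E * \d_(node i : borel K) A)%E).

Fixpoint lf_mass (n : nat) : int -> R :=
  if n is m.+1 then
    let c := lf_mass m in
    let v i := V (atomic c) (node i) in
    fun i => (c (i - 1) + c (i + 1)) / 2
             - dt * ((v (i + 1) * c (i + 1) - v (i - 1) * c (i - 1)) / (2 * dx))
  else fun i => pairing mu0 (hat i).

Definition lf_step (n : nat) : prob K := atomic (lf_mass n).

Definition lf (t : R) : prob K :=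
  let n := Num.truncn (t / dt) in
  as_prob (fun A =>
    (((n.+1%:R * dt - t) / dt)%:E * lf_step n A
     + ((t - n%:R * dt) / dt)%:E * lf_step n.+1 A)%E).

End lax_friedrichs.

(* Main.v *)
(** The scheme and the solution are compared through duality with Lipschitz
    functions, lifted to periodic functions on R.  Testing the weak formulation
    with psi(x + (t + h - s) w(x)), where psi and w are smooth approximations of
    a Lipschitz function and of V[mu_t], shows that on a time step the solution
    is, up to O(h^2), transported by the Euler map x + h V[mu_t](x).  Dually to
    a step of the scheme acts the transition operator of a random walk with
    jumps +dx and -dx and mean displacement dt V[mu^n].  If sigma_n denotes the
    mean square distance between this walk and the Euler trajectory y_n, and d_n
    the Wasserstein distance at time n dt, then
      sigma_(n+1) <= (1 + c dt) sigma_n + c dt d_n^2 + c dx^2  and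
      d_n <= sqrt sigma_n + c dx,
    so that d_n = O(sqrt dx), uniformly on bounded time intervals. *)

Require Import Defs.
From HB Require Import structures.
From mathcomp Require Import all_boot all_order all_algebra.
From mathcomp Require Import all_classical all_reals all_analysis.
From mathcomp Require Import measurable_realfun ring lra zify.

Set Implicit Arguments.
Unset Strict Implicit.
Unset Printing Implicit Defensive.

Import Order.TTheory GRing.Theory Num.Theory.
Import numFieldNormedType.Exports.

Local Open Scope classical_set_scope.
Local Open Scope ring_scope.

(** * Smooth functions *)

(** The mean square is forced by the regularity of the test functions. On a function that is merely
    Lipschitz, the walk operator and the Euler map differ by O(dx) in one step, and O(1/dx) such
    errors do not sum up to anything small. The mean jump is right up to the velocity error, so the
    first-order terms cancel in the mean square distance: a step adds a variance O(dx^2), and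
    O(1/dx) steps add O(dx). That there are only O(1/dx) steps is the lower CFL bound; the upper one
    makes the jump probabilities nonnegative. The resulting bound is uniform in the Lipschitz test
    function, hence a Wasserstein bound. The scheme evaluates [V] at its own measure, so the
    recursion contains the unknown distances d_n. Only distances at earlier times enter, and a
    strong induction closes the estimate. The solution is given by its weak formulation alone,
    without a flow. Freezing the velocity over one time step replaces the flow by an explicit map;
    the change of [V[mu_t]] during the step is controlled by the Lipschitz continuity of [mu] in
    time, which comes from the same test functions with zero velocity. *)

Section directional_smoothness.
Context (R : realType).

(** [F] is only known to be derivable along [v]. Restriction to the line through [z] in this
    direction reduces the claim to the chain rule on [R]. *)
Lemma is_derive_comp_dir (V : normedModType R) (f : R -> R) (F : V -> R)
    (z v : V) (a b : R) :
  is_derive (F z) 1 f a -> is_derive z v F b -> is_derive z v (f \o F) (a * b).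
Proof.
move=> df dF.
pose l (h : R) := h *: v + z.
have l0 : l 0 = z by rewrite /l scale0r add0r.
have dirE (G : V -> R) (c : R) : is_derive z v G c <-> is_derive (0 : R) (1 :
  R) (G \o l) c.
  have lim_eq : 'D_v G z = 'D_1 (G \o l) 0.
    rewrite /derive; set g1 := fun h => h^-1 *: _; set g2 := fun h => h^-1 *: _.
    suff -> : g1 = g2 by [].
    by apply/funext => h; rewrite /g1 /g2 /= addr0 l0 /l [_%:A]mulr1.
  split=> -[dG <-].
    apply: (@DeriveDef _ _ _ _ _ (G \o l)) => //.
    exact/(@derivable1P _ _ _ G z v).
  by apply: DeriveDef => //; exact/(@derivable1P _ _ _ G z v).
apply/dirE; have {}dF := (dirE F b).1 dF.
have -> : (f \o F) \o l = f \o (F \o l) by [].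
by apply: is_derive1_comp => /=; rewrite l0.
Qed.

(* [V] is [R] with direction 1 for functions of one variable and [R * R] with
   the two coordinate directions for functions of space and time. *)
Fixpoint Cdir (V : normedModType R) (D : set V) (n : nat) (F : V -> R) : Prop :=
  continuous F /\
  if n is m.+1 then
    forall v, D v ->
      exists2 G, (forall z, is_derive z v F (G z)) & Cdir D m G
  else True.

Definition smooth_dir (V : normedModType R) (D : set V) (F : V -> R) : Prop :=
  forall n, Cdir D n F.

Section closure.
Context (V : normedModType R) (D : set V).
Implicit Types F G : V -> R.

Lemma Cdir_continuous n F : Cdir D n F -> continuous F.
Proof. by case: n => [|n] []. Qed.

Lemma CdirW n F : Cdir D n.+1 F -> Cdir D n F.
Proof.
elim: n F => [|n ih] F /= [cF dF]; first by split.
split=> // v Dv; have [G dG [cG CG]] := dF v Dv.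
by exists G => //; apply: ih.
Qed.

Lemma Cdir_cst (c : R) n : Cdir D n (cst c).
Proof.
elim: n c => [|n ih] c /=; split=> //; [exact: cst_continuous| |].
  exact: cst_continuous.
by move=> v _; exists (cst 0) => // z; exact: is_derive_cst.
Qed.

Lemma CdirD n F G : Cdir D n F -> Cdir D n G -> Cdir D n (F \+ G).
Proof.
have cD (A B : V -> R) : continuous A -> continuous B -> continuous (A \+ B).
  by move=> cA cB x; apply: continuousD; [exact: cA|exact: cB].
elim: n F G => [|n ih] F G /= [cF dF] [cG dG];
  (split; first exact: cD) => //.
move=> v Dv; have [F' F1 F2] := dF v Dv; have [G' G1 G2] := dG v Dv.
by exists (F' \+ G'); [move=> z; exact: is_deriveD|exact: ih].
Qed.

Lemma CdirM n F G : Cdir D n F -> Cdir D n G -> Cdir D n (F \* G).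
Proof.
have cM (A B : V -> R) : continuous A -> continuous B -> continuous (A \* B).
  by move=> cA cB x; apply: continuousM; [exact: cA|exact: cB].
elim: n F G => [|n ih] F G CF CG; have [/= cF dF] := CF;
  have [/= cG dG] := CG; (split; first exact: cM) => //.
move=> v Dv; have [F' F1 F2] := dF v Dv; have [G' G1 G2] := dG v Dv.
exists ((F \* G') \+ (G \* F')); first by move=> z; exact: is_deriveM.
by apply: CdirD; apply: ih => //; exact: CdirW.
Qed.

Lemma CdirV n F : (forall z, F z != 0) -> Cdir D n F ->
  Cdir D n (fun z => (F z)^-1).
Proof.
move=> F0.
have cV : continuous F -> continuous (fun z => (F z)^-1).
  by move=> cF x; apply: continuousV; [exact: F0|exact: cF].
elim: n => [|n ih] CF; have [/= cF dF] := CF; (split; first exact: cV) => //.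
move=> v Dv; have [F' F1 F2] := dF v Dv.
exists ((cst (-1) \* F') \* ((fun z => (F z)^-1) \* (fun z => (F z)^-1))).
  move=> z; have [d e] := F1 z.
  apply: DeriveDef; first exact: derivableV.
  rewrite deriveV // e /= [_ *: _]mulrC mulN1r mulNr mulrN.
  by rewrite expr2 invfM.
have := ih (CdirW CF) => CV.
by apply: CdirM; apply: CdirM => //; exact: Cdir_cst.
Qed.

Lemma Cdir_comp n (f : R -> R) F :
  Cdir [set (1 : R)] n f -> Cdir D n F -> Cdir D n (f \o F).
Proof.
have cc (A : R -> R) (B : V -> R) :
    continuous A -> continuous B -> continuous (A \o B).
  by move=> cA cB x; apply: continuous_comp; [exact: cB|exact: cA].
elim: n f F => [|n ih] f F Cf CF; have [/= cf df] := Cf;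
  have [/= cF dF] := CF; (split; first exact: cc) => //.
move=> v Dv; have [f' f1 f2] := df 1 erefl; have [F' F1 F2] := dF v Dv.
exists ((f' \o F) \* F').
  by move=> z; exact: is_derive_comp_dir.
by apply: CdirM => //; apply: ih => //; exact: CdirW.
Qed.

Lemma Cdir_linear n F (a : V -> R) : continuous F ->
  (forall v z, is_derive z v F (a v)) -> Cdir D n F.
Proof.
case: n => [|n] cF dF; split=> // v _.
by exists (cst (a v)) => //; exact: Cdir_cst.
Qed.

(** This is what allows gluing: near each point an interpolant coincides with one smooth piece, but
    no single piece serves everywhere. *)
Lemma Cdir_local n F :
  (forall z : V, exists2 G, Cdir D n G & \forall y \near z, F y = G y) ->
  Cdir D n F.
Proof.
have loc_cont F' m :
    (forall z : V, exists2 G, Cdir D m G & \forall y \near z, F' y = G y) ->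
    continuous F'.
  move=> h z; have [G /Cdir_continuous cG FG] := h z.
  rewrite /continuous_at (nbhs_singleton FG).
  by apply: cvg_trans (cG z); apply: near_eq_cvg; exact: (filterS _ FG).
elim: n F => [|n ih] F h; first by split=> //; exact: loc_cont h.
split; first exact: loc_cont h.
(* The local derivatives come from functions that change with the point; ['D_v F] is one global
   function that agrees with each of them nearby. *)
move=> v Dv; exists ('D_v F).
  move=> z; have [G [_ /= dG] FG] := h z; have [G' G1 _] := dG v Dv.
  have GF : \forall y \near z, G y = F y by apply: (filterS _ FG) => y ->.
  have := near_eq_is_derive GF (G1 z) => -[d e].
  exact: DeriveDef.
apply: ih => z; have [G [_ /= dG] FG] := h z; have [G' G1 G2] := dG v Dv.
exists G' => //.
have := near_join FG; apply: filterS => y FGy.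
have [_ <-] := G1 y; exact: near_eq_derive.
Qed.

End closure.
End directional_smoothness.

(** * A smooth step from 0 to 1 *)

Section smooth_step.
Context (R : realType).
Implicit Types (P : {poly R}) (x y : R).

(* The functions [P(1/x) exp(-1/x)] are stable under derivation. *)
Let flat P x : R := if 0 < x then P.[x^-1] * expR (- x^-1) else 0.

(** Monomial by monomial: [y ^+ n] is at most [n!] times the exponential, by its series. *)
Let poly_le_expR P : exists2 C, 0 <= C & forall y, 0 <= y -> `|P.[y]| <= C *
  expR y.
Proof.
exists (\sum_(i < size P) `|P`_i| * i`!%:R) => [|y y0].
  by apply: sumr_ge0 => i _; rewrite mulr_ge0.
rewrite horner_coef mulr_suml (le_trans (ler_norm_sum _ _ _))//.
apply: ler_sum => i _; rewrite normrM -mulrA ler_wpM2l// ger0_norm ?exprn_ge0//.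
case: (val i) => [|n]; first by rewrite expr0 fact0 mul1r -expR0 ler_expR.
have := expR_ge1Dxn n y0.
have fn0 : 0 < n.+1`!%:R :> R by rewrite ltr0n fact_gt0.
move=> ylt; apply: le_trans (_ : n.+1`!%:R * (1 + y ^+ n.+1 / n.+1`!%:R) <= _);
  last by rewrite ler_pM2l.
rewrite mulrDr mulr1 mulrCA divff ?gt_eqF// mulr1.
by rewrite lerDr ltW.
Qed.

(** At the junction [x = 0] this bound yields continuity and derivative 0 at once. It is the
    exponential bound at [1/x] for [P * 'X^2], whose extra factor is the [x ^- 2] to be
    compensated. *)
Let flat_quadratic P : exists C, forall x, `|flat P x| <= C * x ^+ 2.
Proof.
have [C C0 hC] := poly_le_expR (P * 'X^2); exists C => x; rewrite /flat.
case: ifPn => [x0|_]; last by rewrite normr0 mulr_ge0 ?sqr_ge0.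
have y0 : 0 < x^-1 by rewrite invr_gt0.
have := hC _ (ltW y0); rewrite hornerM hornerXn exprVn => hP.
rewrite expRN normrM (gtr0_norm (_ : 0 < (expR x^-1)^-1)) ?invr_gt0 ?expR_gt0//.
rewrite ler_pdivrMr ?expR_gt0// mulrAC -ler_pdivrMr ?exprn_gt0//.
by move: hP; rewrite normrM (gtr0_norm (_ : 0 < (x ^+ 2)^-1)) ?invr_gt0
  ?exprn_gt0.
Qed.

Lemma is_derive_quadratic (f : R -> R) (C : R) :
  (forall x, `|f x| <= C * x ^+ 2) -> is_derive (0 : R) (1 : R) f 0.
Proof.
move=> hC.
have f0 : f 0 = 0 by apply/normr0_eq0/le_anti; rewrite normr_ge0 (le_trans (hC
  0)) // expr0n mulr0.
have lim0 : (fun h => h^-1 *: (f (h *: (1 : R) + 0) - f 0)) @ (0 : R)^' --> (0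
  : R).
  apply/cvgrPdist_le => e e0.
  have C0 : 0 <= C by have := le_trans (normr_ge0 _) (hC 1);
    rewrite expr1n mulr1.
  have C1 : 0 < C + 1 by rewrite ltr_wpDl.
  near=> h.
  rewrite sub0r normrN f0 subr0 addr0 [_ *: 1]mulr1 [_ *: _]mulrC normrM normfV.
  have h0 : 0 < `|h| by rewrite normr_gt0; near: h; exact: nbhs_dnbhs_neq.
  rewrite ler_pdivrMr//; apply: (le_trans (hC h)).
  rewrite -real_normK ?num_real// expr2 mulrA ler_pM2r//.
  apply: (@le_trans _ _ ((C + 1) * `|h|)); first by rewrite ler_pM2r// lerDl.
  rewrite mulrC -ler_pdivlMr//; near: h.
  apply: dnbhs0_le; exact: divr_gt0.
apply: DeriveDef; last exact: cvg_lim lim0.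
by apply/cvg_ex; exists 0; exact: lim0.
Unshelve. all: by end_near. Qed.

Let flat_deriv P x :
  is_derive x 1 (flat P) (flat ('X^2 * (P - P^`())) x).
Proof.
case: (ltgtP x 0) => [x0|x0|->].
- rewrite {2}/flat ltNge (ltW x0) /=.
  apply: (@near_eq_is_derive _ _ _ (cst 0)).
  by near=> y; rewrite /flat ltNge /= ltW//; near: y; exact: lt_nbhsl.
- rewrite {2}/flat x0.
  pose g : R -> R := (horner P \o (fun y : R => y^-1)) * (expR \o (fun y => -
    y^-1)).
  have dV : is_derive x 1 (fun y : R => y^-1) (- x ^- 2).
    have := @is_deriveV _ id x 1 1 _ (is_derive_id x 1).
    by rewrite [_ *: _]mulr1; apply; rewrite gt_eqF.
  have dN : is_derive x 1 (fun y : R => - y^-1) (x ^- 2).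
    by rewrite -[x ^- 2]opprK; exact: is_deriveN.
  apply: (@near_eq_is_derive _ _ _ g).
    near=> y; rewrite /flat; have -> : 0 < y by near: y; exact: lt_nbhsr.
    by [].
  have d1 : is_derive x 1 (horner P \o (fun y : R => y^-1)) ((P^`()).[x^-1] * -
    x ^- 2).
    exact: is_derive1_comp.
  have d2 : is_derive x 1 (expR \o (fun y : R => - y^-1)) (expR (- x^-1) * x ^-
    2).
    exact: is_derive1_comp.
  apply: (is_derive_eq (is_deriveM d1 d2)).
  rewrite /= !hornerE /GRing.scale /= exprVn; ring.
- rewrite {2}/flat ltxx; have [C hC] := flat_quadratic P.
  exact: is_derive_quadratic hC.
Unshelve. all: by end_near. Qed.

Let flat_smooth P n : Cdir [set (1 : R)] n (flat P).
Proof.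
have cf Q : continuous (flat Q).
  move=> x; apply/differentiable_continuous/derivable1_diffP.
  by have [] := flat_deriv Q x.
elim: n P => [|n ih] P; split => // v ->.
by exists (flat ('X^2 * (P - P^`()))).
Qed.

Let flat_gt0 x : 0 < x -> 0 < flat 1 x.
Proof. by move=> x0; rewrite /flat x0 hornerC mul1r expR_gt0. Qed.

Let flat_eq0 x : x <= 0 -> flat 1 x = 0.
Proof. by move=> x0; rewrite /flat ltNge x0. Qed.

Let flat_ge0 x : 0 <= flat 1 x.
Proof. by case: (leP x 0) => [/flat_eq0->//|/flat_gt0/ltW]. Qed.

Lemma Cdir_affine (V : normedModType R) (D : set V) n (F : V -> R) (a c : R) :
  Cdir D n F -> Cdir D n (fun z => a * F z + c).
Proof.
move=> CF; apply: (@CdirD _ _ _ _ (cst a \* F) (cst c)); last exact: Cdir_cst.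
by apply: CdirM => //; exact: Cdir_cst.
Qed.

Lemma Cdir_id n : Cdir [set (1 : R)] n (@id R).
Proof.
by apply: (@Cdir_linear _ _ _ _ _ id) => x; exact: cvg_id.
Qed.

Lemma smooth_step : exists (B B' : R -> R) (b : R),
  [/\ smooth_dir [set (1 : R)] B, forall x, is_derive x (1 : R) B (B' x),
      continuous B', 0 < b & forall x, `|B' x| <= b] /\
  [/\ forall x, 0 <= B x <= 1, forall x, x <= 3^-1 -> B x = 0 &
      forall x, 2 / 3 <= x -> B x = 1].
Proof.
pose D x := flat 1 x + flat 1 (-1 * x + 1).
have D0 x : 0 < D x.
  case: (ltP 0 x) => x0; first by rewrite ltr_pwDl// flat_gt0.
  by rewrite ltr_wpDl ?flat_ge0 ?flat_gt0//; lra.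
pose B0 x := flat 1 x * (D x)^-1.
have sB0 n : Cdir [set (1 : R)] n B0.
  apply: CdirM; first exact: flat_smooth.
  apply: CdirV => [x|]; first by rewrite gt_eqF.
  apply: CdirD; first exact: flat_smooth.
  apply: (@Cdir_comp _ _ _ n (flat 1)); first exact: flat_smooth.
  exact/Cdir_affine/Cdir_id.
(* The transition is squeezed into [[1/3, 2/3]], so that [B] is constant near 0 and near 1, as the
   gluing of interpolation pieces requires. *)
pose B x := B0 (3 * x + -1).
have sB n : Cdir [set (1 : R)] n B.
  apply: (@Cdir_comp _ _ _ n B0) => //; exact/Cdir_affine/Cdir_id.
have [_ /(_ 1 erefl)[B' B'1 [cB' _]]] := sB 1%N.
have B_0 x : x <= 3^-1 -> B x = 0.
  by move=> x3; rewrite /B /B0 flat_eq0 ?mul0r//; lra.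
have B_1 x : 2 / 3 <= x -> B x = 1.
  move=> x3; rewrite /B /B0 /D (@flat_eq0 (-1 * _ + 1)); last by lra.
  by rewrite addr0 divff// gt_eqF// flat_gt0//; lra.
have B'0 x : x \notin `[0, 1]%R -> B' x = 0.
  rewrite in_itv /= negb_and -!ltNge => /orP[] x0.
    suff d : is_derive x 1 B 0 by rewrite -(@derive_val _ _ _ _ _ _ _ (B'1 x))
      derive_val.
    apply: (@near_eq_is_derive _ _ _ (cst 0)).
    near=> y; rewrite B_0//; apply: (@le_trans _ _ 0); last by lra.
    by apply: ltW; near: y; exact: lt_nbhsl.
  suff d : is_derive x 1 B 0 by rewrite -(@derive_val _ _ _ _ _ _ _ (B'1 x))
    derive_val.
  apply: (@near_eq_is_derive _ _ _ (cst (1 : R))).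
  near=> y; rewrite B_1//; apply: (@le_trans _ _ 1); first by lra.
  by apply: ltW; near: y; exact: lt_nbhsr.
have cN : {within `[0, 1], continuous (fun x => `|B' x|)}.
  apply: continuous_subspaceT => x; apply: continuous_comp; first exact: cB'.
  exact: norm_continuous.
have [c _ hc] := EVT_max ler01 cN.
have b0 : 0 < `|B' c| + 1 by rewrite ltr_wpDl.
have bB x : `|B' x| <= `|B' c| + 1.
  have [x01|x01] := boolP (x \in `[0, 1]%R).
    by rewrite (le_trans (hc x x01))// lerDl.
  by rewrite B'0// normr0 addr_ge0.
have B01 x : 0 <= B x <= 1.
  rewrite /B /B0; set y := 3 * x + -1.
  by rewrite mulr_ge0 ?invr_ge0 ?flat_ge0 ?(ltW (D0 _))//= ler_pdivrMr// mul1r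
    lerDl flat_ge0.
by exists B, B', (`|B' c| + 1).
Unshelve. all: by end_near. Qed.

End smooth_step.

(** * Smooth interpolation and cutoff functions *)

Section smoothing.
Context (R : realType).
Variables (B B' : R -> R) (b : R).
Hypothesis B_smooth : smooth_dir [set (1 : R)] B.
Hypothesis B_derive : forall x, is_derive x (1 : R) B (B' x).
Hypothesis B'_le : forall x, `|B' x| <= b.
Hypothesis B_itv : forall x, 0 <= B x <= 1.
Hypothesis B_0 : forall x, x <= 3^-1 -> B x = 0.
Hypothesis B_1 : forall x, 2 / 3 <= x -> B x = 1.

Section interpolation.
Variables (e : R) (f : R -> R).
Hypothesis e_gt0 : 0 < e.

Definition smooth_piece (k : int) (x : R) : R :=
  f (k%:~R * e) + (f ((k + 1)%:~R * e) - f (k%:~R * e)) * B (x / e - k%:~R).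

(* Smooth at the grid points since [B] is constant near both ends of a cell. *)
Definition smooth_interp (x : R) : R := smooth_piece (Num.floor (x / e)) x.

Lemma smooth_interp_local (x : R) :
  {near x, smooth_piece (Num.floor (x / e)) =1 smooth_interp}.
Proof.
set k := Num.floor (x / e).
have /andP[k_le k_lt] := floor_itv (x / e).
rewrite -/k intrD in k_le k_lt.
near=> y; rewrite /smooth_interp.
have y_lo : k%:~R - 3^-1 < y / e.
  rewrite ltr_pdivlMr//; near: y; apply: lt_nbhsr.
  by rewrite -ltr_pdivlMr//; lra.
have y_hi : y / e < k%:~R + 1.
  by rewrite ltr_pdivrMr//; near: y; apply: lt_nbhsl; rewrite -ltr_pdivrMr.
have [ky|ky] := leP k%:~R (y / e).
  by congr (smooth_piece _ _); apply/esym/floor_def; rewrite ky intrD.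
(* [y] lies to the left of the grid point [k * e], by less than a third of a cell: the previous
   piece has already reached its final value there and the piece [k] still has its initial one, both
   [f (k * e)]. *)
have -> : Num.floor (y / e) = k - 1.
  by apply: floor_def; rewrite subrK ky intrB andbT; lra.
rewrite /smooth_piece subrK intrB B_0 ?B_1; first by ring.
- by lra.
- by lra.
Unshelve. all: by end_near. Qed.

Lemma smooth_interp_smooth : smooth_dir [set (1 : R)] smooth_interp.
Proof.
move=> n; apply: Cdir_local => x; exists (smooth_piece (Num.floor (x / e))).
  set k := Num.floor _; set c := f (k%:~R * e).
  pose d := f ((k + 1)%:~R * e) - c.
  have -> : smooth_piece k =
      (fun x => d * (B \o (fun x => e^-1 * id x + - k%:~R)) x + c).
    by apply/funext => y; rewrite /smooth_piece /= addrC (mulrC y).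
  apply: Cdir_affine; apply: Cdir_comp => //; exact/Cdir_affine/Cdir_id.
by apply: (filterS _ (smooth_interp_local x)) => y ->.
Qed.

Definition smooth_interp' (x : R) : R :=
  let k := Num.floor (x / e) in
  (f ((k + 1)%:~R * e) - f (k%:~R * e)) / e * B' (x / e - k%:~R).

Lemma smooth_interp_derive x :
  is_derive x (1 : R) smooth_interp (smooth_interp' x).
Proof.
apply: near_eq_is_derive (smooth_interp_local x) _.
rewrite /smooth_interp'; set k := Num.floor _; set c := f (k%:~R * e).
set d := f ((k + 1)%:~R * e) - c.
have dl : is_derive x (1 : R) (fun y => e^-1 * y - k%:~R) e^-1.
  have h1 : is_derive x (1 : R) (fun y => e^-1 *: y) (e^-1 *: 1).
    exact: (@is_deriveZ _ _ _ id).
  have h2 : is_derive x (1 : R) (cst (k%:~R : R)) 0 by exact: is_derive_cst.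
  by have := is_deriveB h1 h2; rewrite subr0 [_ *: _]mulr1.
have dB := is_derive1_comp (B_derive _) dl.
have dd := @is_deriveZ _ _ _ _ d _ _ _ dB.
have dc : is_derive x (1 : R) (cst c) 0 by exact: is_derive_cst.
have dp := is_deriveD dd dc.
rewrite (_ : smooth_piece k = (d \*: (B \o (fun y => e^-1 * y - k%:~R)) + cst
  c)).
  apply: (is_derive_eq dp).
  by rewrite addr0 /GRing.scale /= (mulrC e^-1 x) [B' _ * _]mulrC mulrA.
by apply/funext => y; rewrite /smooth_piece [RHS]addrC /= (mulrC y).
Qed.

Variables (L : R).
Hypothesis f_lip : forall x y, `|f x - f y| <= L * `|x - y|.

Let L_ge0 : 0 <= L.
Proof.
have := f_lip 1 0; rewrite subr0 normr1 mulr1; exact: le_trans.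
Qed.

Lemma smooth_interp'_le x : `|smooth_interp' x| <= b * L.
Proof.
rewrite /smooth_interp' normrM mulrC ler_pM//.
rewrite normrM normfV (gtr0_norm e_gt0) ler_pdivrMr//.
rewrite (le_trans (f_lip _ _))// ler_wpM2l// -mulrBl intrD addrAC subrr add0r.
by rewrite mul1r gtr0_norm.
Qed.

(** One [L * e] pays for moving from [x] to the left grid point, the other for the increment of [f]
    over the cell. *)
Lemma smooth_interp_close x : `|smooth_interp x - f x| <= 2 * L * e.
Proof.
rewrite /smooth_interp /smooth_piece; set k := Num.floor _.
have /andP[k_le k_lt] := floor_itv (x / e).
rewrite -/k intrD in k_le k_lt.
have /andP[B0 B1] := B_itv (x / e - k%:~R).
rewrite addrAC (le_trans (ler_normD _ _))//.
rewrite -mulrA mulr_natl mulr2n lerD//.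
  rewrite (le_trans (f_lip _ _))// ler_wpM2l// distrC.
  have xe : x = x / e * e by rewrite divfK// gt_eqF.
  rewrite [in leLHS]xe -mulrBl normrM (gtr0_norm e_gt0) ler_piMl ?(ltW e_gt0)//.
  by rewrite ler_norml; lra.
rewrite normrM -[leRHS]mulr1 ler_pM//; last by rewrite ger0_norm.
rewrite (le_trans (f_lip _ _))// ler_wpM2l// -mulrBl intrD addrAC subrr add0r.
by rewrite mul1r gtr0_norm.
Qed.

Lemma smooth_interp_bounded M : (forall x, `|f x| <= M) ->
  forall x, `|smooth_interp x| <= M.
Proof.
move=> fM x; rewrite /smooth_interp /smooth_piece; set k := Num.floor _.
have /andP[B0 B1] := B_itv (x / e - k%:~R); move: B0 B1.
have := fM (k%:~R * e); have := fM ((k + 1)%:~R * e).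
set u := f _; set v := f _; set t := B _.
rewrite !ler_norml => /andP[u0 u1] /andP[v0 v1] t0 t1.
by apply/andP; split; nra.
Qed.

Lemma smooth_interp_periodic (k : int) : (forall x, f (x + k%:~R * e) = f x) ->
  forall x, smooth_interp (x + k%:~R * e) = smooth_interp x.
Proof.
move=> fk x; rewrite /smooth_interp.
have -> : (x + k%:~R * e) / e = x / e + k%:~R.
  by rewrite mulrDl mulfK// gt_eqF.
have -> : Num.floor (x / e + k%:~R) = Num.floor (x / e) + k.
  by rewrite floorDrz ?intr_int// intrKfloor.
set j := Num.floor (x / e); rewrite /smooth_piece.
have -> : (x + k%:~R * e) / e - (j + k)%:~R = x / e - j%:~R.
  by rewrite mulrDl mulfK ?gt_eqF// intrD; ring.
have -> : (j + k + 1)%:~R * e = (j + 1)%:~R * e + k%:~R * e by rewrite !intrD;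
  ring.
have -> : (j + k)%:~R * e = j%:~R * e + k%:~R * e by rewrite !intrD; ring.
by rewrite !fk.
Qed.

End interpolation.

(** Cutoffs of arbitrarily small slope: they give test functions compact support while their
    derivative contributes only O(eta) to the weak formulation. Each is a product of two half-line
    cutoffs. *)
Lemma smooth_bump (eta : R) : 0 < eta ->
  exists (chi chi' : nat -> R -> R) (r : nat -> R),
  [/\ forall n, smooth_dir [set (1 : R)] (chi n),
      forall n x, is_derive x (1 : R) (chi n) (chi' n x),
      forall n x, `|chi' n x| <= eta & forall n x, 0 <= chi n x <= 1] /\
  (forall n x, r n < `|x| -> chi n x = 0) /\
  (forall x, \forall n \near \oo, chi n x = 1).
Proof.
move=> eta0.
have b0 : 0 <= b := le_trans (normr_ge0 _) (B'_le 0).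
(* The width [s n] is at least [2 * b / eta], so each factor has slope at most [eta / 2]; the
   summand [n%:R] makes the plateaus exhaust the line. *)
pose s (n : nat) : R := n%:R + 2 * b / eta + 1.
have s0 n : 0 < s n by rewrite ltr_pwDr// addr_ge0// divr_ge0 ?(ltW eta0)//
  mulr_ge0.
have s_le n : b <= eta / 2 * s n.
  have -> : eta / 2 * s n = b + (eta / 2 * n%:R + eta / 2).
    by rewrite /s; field; rewrite gt_eqF.
  by rewrite lerDl addr_ge0 ?mulr_ge0 ?divr_ge0// ltW.
have is_derive_lin (a : R) x : is_derive x (1 : R) ( *%R a) a.
  have := @is_deriveZ _ _ _ id a x 1 1 (is_derive_id x 1).
  by rewrite [_ *: 1]mulr1.
pose chi n x := (1 + (-1) * B ((s n)^-1 * x)) * (1 + (-1) * B (- (s n)^-1 * x)).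
pose c1 n : R -> R := cst 1 + (-1 \*: (B \o *%R (s n)^-1)).
pose c2 n : R -> R := cst 1 + (-1 \*: (B \o *%R (- (s n)^-1))).
have chiE n : chi n = c1 n * c2 n by [].
pose c1' n x := 0 + -1 *: (B' ((s n)^-1 * x) * (s n)^-1).
pose c2' n x := 0 + -1 *: (B' (- (s n)^-1 * x) * - (s n)^-1).
have d1 n x : is_derive x (1 : R) (c1 n) (c1' n x).
  apply: is_deriveD; apply: is_deriveZ.
have d2 n x : is_derive x (1 : R) (c2 n) (c2' n x).
  apply: is_deriveD; apply: is_deriveZ.
have c1'_le n x : `|c1' n x| <= eta / 2.
  rewrite /c1' add0r scaleN1r normrN normrM normfV (gtr0_norm (s0 n))
    ler_pdivrMr//.
  exact: le_trans (B'_le _) (s_le n).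
have c2'_le n x : `|c2' n x| <= eta / 2.
  rewrite /c2' add0r scaleN1r normrN normrM normrN normfV (gtr0_norm (s0 n))
    ler_pdivrMr//.
  exact: le_trans (B'_le _) (s_le n).
have c_itv t : 0 <= 1 + -1 * B t <= 1 by have := B_itv t; lra.
exists chi, (fun n x => c1 n x *: c2' n x + c2 n x *: c1' n x), s; split.
  split.
  - move=> n m; rewrite chiE; apply: CdirM; apply: CdirD;
      try exact: Cdir_cst; apply: (@CdirM _ _ _ _ (cst (-1)));
      try exact: Cdir_cst; apply: Cdir_comp => //.
      have -> : *%R (s n)^-1 = (fun x => (s n)^-1 * id x + 0) by apply/funext
        => x; rewrite addr0.
      exact/Cdir_affine/Cdir_id.
    have -> : *%R (- (s n)^-1) = (fun x => (- (s n)^-1) * id x + 0) by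
      apply/funext => x; rewrite addr0.
    exact/Cdir_affine/Cdir_id.
  - by move=> n x; rewrite chiE; exact: (is_deriveM (d1 n x) (d2 n x)).
  - move=> n x; rewrite (le_trans (ler_normD _ _))// [leRHS](splitr eta) lerD//.
      rewrite normrM -[leRHS]mul1r ler_pM//.
      by have := c_itv ((s n)^-1 * x); rewrite ler_norml /c1 => /andP[? ?];
        apply/andP; split=> //; apply: le_trans _ (_ : 0 <= _) => //; lra.
    rewrite normrM -[leRHS]mul1r ler_pM//.
    by have := c_itv (- (s n)^-1 * x); rewrite ler_norml /c2 => /andP[? ?];
      apply/andP; split=> //; apply: le_trans _ (_ : 0 <= _) => //; lra.
  - move=> n x; have := c_itv ((s n)^-1 * x); have := c_itv (- (s n)^-1 * x).
    rewrite /chi; set u := 1 + _; set v := 1 + _ => /andP[? ?] /andP[? ?].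
    by rewrite mulr_ge0//= mulr_ile1.
split=> [n x|x].
  have -> : `|x| = `|(s n)^-1 * x| * s n.
    by rewrite normrM normfV (gtr0_norm (s0 n)) mulrAC mulVf ?mul1r// gt_eqF.
  rewrite -[X in X < _]mul1r ltr_pM2r// /chi => y1.
  have [x0|x0] := leP 0 ((s n)^-1 * x).
    by rewrite B_1 ?mulr1 ?subrr ?mul0r//; move: y1; rewrite ger0_norm//; lra.
  rewrite [X in _ * X](_ : _ = 0) ?mulr0// mulNr B_1; first by lra.
  by move: y1; rewrite ltr0_norm//; lra.
near=> n.
have xn : `|x| <= 3^-1 * s n.
  rewrite -ler_pdivrMl ?invr_gt0// invrK /s -addrA ler_wpDr ?addr_ge0//.
    by rewrite divr_ge0 ?(ltW eta0)// mulr_ge0.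
  by near: n; exact: nbhs_infty_ger.
have h : `|(s n)^-1 * x| <= 3^-1.
  by rewrite normrM normfV (gtr0_norm (s0 n)) mulrC ler_pdivrMr.
move: h; rewrite ler_norml => /andP[h1 h2].
by rewrite /chi !B_0 ?mulr0 ?addr0 ?mulr1//; lra.
Unshelve. all: by end_near. Qed.

End smoothing.

(** * Measures and pairings *)

Section pairings.
Context (R : realType) (K : spatial_domain R).
Implicit Types (nu : prob K) (f g : K -> R).

Lemma continuous_measurable_borel f : continuous f ->
  measurable_fun setT (f : borel K -> R).
Proof.
move=> /continuousP cf; apply: (measurability _ (RGenOpens.measurableE R)).
move=> _ [_ [a [c ->] <-]]; rewrite setTI.
by apply: sub_sigma_algebra; apply: cf; exact: interval_open.
Qed.

Lemma bounded_continuous_cst (c : R) : bounded_continuous (cst c : K -> R).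
Proof. by split; [exact: cst_continuous|exists `|c|]. Qed.

Lemma bounded_continuousD f g : bounded_continuous f -> bounded_continuous g ->
  bounded_continuous (f \+ g).
Proof.
move=> [cf [M hM]] [cg [N hN]]; split.
  by move=> x; apply: continuousD; [exact: cf|exact: cg].
by exists (M + N) => x; rewrite (le_trans (ler_normD _ _))// lerD.
Qed.

Lemma bounded_continuousM f g : bounded_continuous f -> bounded_continuous g ->
  bounded_continuous (f \* g).
Proof.
move=> [cf [M hM]] [cg [N hN]]; split.
  by move=> x; apply: continuousM; [exact: cf|exact: cg].
by exists (M * N) => x; rewrite normrM ler_pM.
Qed.

Lemma bounded_continuousB f g : bounded_continuous f -> bounded_continuous g ->
  bounded_continuous (f \- g).
Proof.
move=> [cf [M hM]] [cg [N hN]]; split.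
  by move=> x; apply: continuousB; [exact: cf|exact: cg].
by exists (M + N) => x; rewrite (le_trans (ler_normB _ _))// lerD.
Qed.

Lemma bounded_continuous_integrable nu f : bounded_continuous f ->
  nu.-integrable [set: borel K] (EFin \o f).
Proof.
move=> [cf [M fM]]; apply: measurable_bounded_integrable => //.
- exact: (le_lt_trans (probability_le1 _ _) (ltry 1)).
- exact: continuous_measurable_borel.
- exists M; split; rewrite ?num_real // => y My x _ /=.
  by rewrite (le_trans (fM x))// ltW.
Qed.

Lemma pairing_cst nu (c : R) : pairing nu (fun=> c) = c.
Proof. by rewrite /pairing Rintegral_cst// [X in fine X](_ : _ = 1%E) ?mulr1//;
  exact: probability_setT. Qed.

Lemma pairingD nu f g : bounded_continuous f -> bounded_continuous g ->
  pairing nu (f \+ g) = pairing nu f + pairing nu g.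
Proof. by move=> *; rewrite /pairing RintegralD//;
  exact: bounded_continuous_integrable. Qed.

Lemma pairingB nu f g : bounded_continuous f -> bounded_continuous g ->
  pairing nu (f \- g) = pairing nu f - pairing nu g.
Proof. by move=> *; rewrite /pairing RintegralB//;
  exact: bounded_continuous_integrable. Qed.

Lemma pairingZ nu (c : R) f : bounded_continuous f ->
  pairing nu (fun x => c * f x) = c * pairing nu f.
Proof. by move=> *; rewrite /pairing RintegralZl//;
  exact: bounded_continuous_integrable. Qed.

Lemma le_pairing nu f g : bounded_continuous f -> bounded_continuous g ->
  (forall x, f x <= g x) -> pairing nu f <= pairing nu g.
Proof. by move=> *; apply: le_Rintegral => //;
    exact: bounded_continuous_integrable. Qed.

Lemma pairing_norm_le nu f (c : R) : bounded_continuous f ->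
  (forall x, `|f x| <= c) -> `|pairing nu f| <= c.
Proof.
move=> bf fc; have fB x : - c <= f x <= c by rewrite -ler_norml.
rewrite ler_norml; apply/andP; split.
  rewrite -(pairing_cst nu (- c)); apply: le_pairing => //.
    exact: bounded_continuous_cst.
  by move=> x; have /andP[] := fB x.
rewrite -[leRHS](pairing_cst nu c); apply: le_pairing => //.
  exact: bounded_continuous_cst.
by move=> x; have /andP[] := fB x.
Qed.

Lemma pairing_dist_le nu f g (c : R) :
  bounded_continuous f -> bounded_continuous g ->
  (forall x, `|f x - g x| <= c) -> `|pairing nu f - pairing nu g| <= c.
Proof.
move=> bf bg fg; rewrite -pairingB//; apply: pairing_norm_le => //.
exact: bounded_continuousB.
Qed.

Lemma cvg_pairing nu (f_ : nat -> K -> R) f (M : R) :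
  (forall n, bounded_continuous (f_ n)) -> bounded_continuous f ->
  (forall n x, `|f_ n x| <= M) ->
  (forall x, f_ n x @[n --> \oo] --> f x) ->
  pairing nu (f_ n) @[n --> \oo] --> pairing nu f.
Proof.
move=> bf_ bf fM f_f.
have [//|||//||_ _ h] := @dominated_convergence _ (borel K) R nu setT
  measurableT
  (fun n => EFin \o f_ n) (EFin \o f) (cst M%:E).
- move=> n; apply/measurable_EFinP;
    exact: (continuous_measurable_borel (bf_ n).1).
- apply/measurable_EFinP; exact: (continuous_measurable_borel bf.1).
- apply: aeW => x _; apply/cvg_EFin; first exact: nearW.
  exact: f_f.
- apply: (@bounded_continuous_integrable nu (cst M));
    exact: bounded_continuous_cst.
- by apply: aeW => x n _ /=; rewrite lee_fin.
have fin g : bounded_continuous g -> (\int[nu]_x (g x)%:E)%E \is a fin_num.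
  move=> /(bounded_continuous_integrable nu) ig.
  exact: integrable_fin_num.
apply: fine_cvg; rewrite /pairing /Rintegral fineK ?fin//.
Qed.

Lemma pairing_ext (nu1 nu2 : prob K) f :
  (forall A : set (borel K), measurable A -> nu1 A = nu2 A) ->
  pairing nu1 f = pairing nu2 f.
Proof.
move=> h; rewrite /pairing /Rintegral; congr fine.
by apply: eq_measure_integral => A mA _; exact: h.
Qed.

End pairings.

(** * The real line and the torus *)

Section regular_domain.
Context (R : realType).

(** Being constant on the fibres of the covering: void on the line, [2 * pi]-periodicity on the
    torus. *)
Definition periodic (K : spatial_domain R) (X : Type) (F : R -> X) : Prop :=
  forall a b, covering K a = covering K b -> F a = F b.

(** The interface through which both domains are treated at once. All estimates concern functions on
    [R] that descend to [K]; [covering_cofinal] brings continuity down to [K], and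
    [dom_dist_attained] replaces a distance in [K] by one between representatives. *)
Record regular_domain (K : spatial_domain R) : Prop := RegularDomain {
  covering_lift : forall x : K, covering K (lift_of x) = x;
  covering_cofinal : forall f : K -> R,
    continuous (f \o covering K) -> continuous f;
  covering_shift : forall a b c : R,
    covering K a = covering K b -> covering K (a + c) = covering K (b + c);
  dom_dist_ge0 : forall x y : K, 0 <= dom_dist x y;
  dom_dist_covering : forall a b : R,
    dom_dist (covering K a) (covering K b) <= `|a - b|;
  dom_dist_covering_lip : forall (a b : R) (y : K),
    dom_dist (covering K a) y <= dom_dist (covering K b) y + `|a - b|;
  dom_dist_attained : forall (a : R) (y : K) (r : R),
    dom_dist (covering K a) y < r ->
    exists2 b, covering K b = y & `|a - b| <= r;
  (* Interpolation on a grid whose mesh divides the period stays periodic. *)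
  grid_subperiod : forall eta : R, 0 < eta -> exists e : R,
    0 < e < eta /\ forall a b : R, covering K a = covering K b ->
    exists k : int, a = b + k%:~R * e;
  exists_cutoff : forall eta : R, 0 < eta ->
    exists (chi chi' : nat -> R -> R) (A : nat -> set K),
    [/\ forall n, smooth_dir [set (1 : R)] (chi n),
        forall n x, is_derive x (1 : R) (chi n) (chi' n x),
        forall n x, `|chi' n x| <= eta & forall n x, 0 <= chi n x <= 1] /\
    [/\ forall n, periodic K (chi n),
        forall n, compact (A n) /\ closed (A n),
        forall n x, ~ A n (covering K x) -> chi n x = 0 &
        forall x, \forall n \near \oo, chi n x = 1];
  mesh_size_gt0 : forall dx : R, mesh_size K dx -> 0 < dx;
  esum_cells_shift : forall (dx x0 : R) (g : int -> \bar R),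
    mesh_size K dx ->
    (forall i j, node K dx x0 i = node K dx x0 j -> g i = g j) ->
    (\esum_(i in cells K dx) g (i + 1)%R = \esum_(i in cells K dx) g i)%E;
  esum_hat : forall (dx x0 : R) (x : K), mesh_size K dx -> dx < 1 ->
    (\esum_(i in cells K dx) (hat dx x0 i x)%:E = 1)%E }.

Lemma esum_cells_two (A : set int) (g : int -> \bar R) : A 0 -> A 1 ->
  (forall i, (0 <= g i)%E) -> (forall i, A i -> i != 0 -> i != 1 -> g i = 0%E)
    ->
  (\esum_(i in A) g i = g 0%R + g 1%R)%E.
Proof.
move=> A0 A1 g0 g2.
rewrite (esumID [set 0])//.
rewrite setI1 mem_set// esum_set1//; congr (_ + _)%E.
rewrite (esumID [set 1])//.
rewrite setI1 mem_set ?esum_set1//.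
rewrite esum1 ?adde0// => i [[Ai /= /eqP i0] /eqP i1].
exact: g2.
Qed.

(** [P] stands for depending on the index through the node only, which is what makes a sum over the
    cells of the torus invariant under shifts. It must be stable under shifts for the induction on
    [j]. *)
Lemma esum_cells_shiftz (A : set int) (g : int -> \bar R) (P : (int -> \bar R)
  -> Prop) :
  (forall h, P h -> P (fun i => h (i + 1)) /\ P (fun i => h (i - 1))) ->
  (forall h, P h -> (\esum_(i in A) h (i + 1)%R = \esum_(i in A) h i)%E) ->
  P g -> forall j : int, (\esum_(i in A) g (i + j)%R = \esum_(i in A) g i)%E.
Proof.
move=> PS hA Pg j; elim: j g Pg => [|n ih|n ih] g Pg.
- by apply: eq_esum => i _; rewrite addr0.
- rewrite -(hA _ Pg) -(ih _ (PS _ Pg).1).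
  by apply: eq_esum => i _; congr (g _); rewrite intS; lia.
- have := hA _ (PS _ Pg).2.
  under eq_esum do rewrite addrK.
  move=> ->; rewrite -(ih _ (PS _ Pg).2).
  by apply: eq_esum => i _; congr (g _); lia.
Qed.

End regular_domain.

(** * Hat functions as a partition of unity, and the real line *)

Section instances.
Context (R : realType).

(** Shifting the index by [j] puts the point between the nodes numbered 0 and 1, with relative
    position [th]. Only these two hats are nonzero there, with values [1 - th] and [th]. *)
Lemma esum_hat_of (K : spatial_domain R) (dx x0 a : R) :
  0 < dx ->
  (forall g : int -> \bar R,
    (forall i j, node K dx x0 i = node K dx x0 j -> g i = g j) ->
    (\esum_(i in cells K dx) g (i + 1)%R = \esum_(i in cells K dx) g i)%E) ->
  (forall u v c : R, covering K u = covering K v ->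
    covering K (u + c) = covering K (v + c)) ->
  cells K dx 0 -> cells K dx 1 ->
  let t := (a - x0) / dx in let j := Num.floor t in let th := t - j%:~R in
  dom_dist (covering K a) (node K dx x0 j) = th * dx ->
  dom_dist (covering K a) (node K dx x0 (j + 1)) = (1 - th) * dx ->
  (forall i, cells K dx i -> i != 0 -> i != 1 ->
    dx <= dom_dist (covering K a) (node K dx x0 (i + j))) ->
  (\esum_(i in cells K dx) (hat dx x0 i (covering K a))%:E = 1)%E.
Proof.
move=> dx0 hshift htrans c0 c1 t j th hj hj1 hij.
have /andP[j_le j_lt] := floor_itv t; rewrite intrD -/j in j_le j_lt.
pose P (h : int -> \bar R) := forall i k, node K dx x0 i = node K dx x0 k -> h
  i = h k.
have node_shift i k (l : int) : node K dx x0 i = node K dx x0 k ->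
    node K dx x0 (i + l) = node K dx x0 (k + l).
  rewrite /node => e.
  have := htrans _ _ (l%:~R * dx) e.
  by rewrite -!addrA -!mulrDl -!intrD.
have PS h : P h -> P (fun i => h (i + 1)) /\ P (fun i => h (i - 1)).
  by move=> Ph; split=> i k e; apply: Ph; exact: node_shift.
pose g i := (hat dx x0 i (covering K a))%:E.
have Pg : P g by move=> i k e; rewrite /g /hat e.
rewrite -(esum_cells_shiftz PS hshift Pg j) (esum_cells_two c0 c1).
- rewrite /g add0r (addrC 1) /hat hj hj1 !mulfK ?gt_eqF//.
  by rewrite -EFinD !max_r; [congr EFin; ring|rewrite /th; lra|rewrite /th;
    lra].
- by move=> i; rewrite /g lee_fin /hat le_max lexx.
- move=> i Ai i0 i1; rewrite /g /hat max_l// subr_le0 ler_pdivlMr// mul1r.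
  exact: hij.
Qed.

Lemma real_line_shift (dx x0 : R) (g : int -> \bar R) :
  (\esum_(i in cells (real_line R) dx) g (i + 1)%R =
   \esum_(i in cells (real_line R) dx) g i)%E.
Proof.
apply/esym/(@reindex_esum R int int setT setT (fun i => i + 1)); split=> //.
- by move=> i j _ _ /addIr.
- by move=> i _; exists (i - 1) => //; rewrite subrK.
Qed.

Lemma regular_real_line : regular_domain (real_line R).
Proof.
split => //=.
- by move=> a b c ->.
- move=> a b y; have -> : a - y = (b - y) + (a - b) by ring.
  exact: ler_normD.
- by move=> a y r h; exists y => //; exact: ltW.
- move=> eta e0; exists (eta / 2); split; first by lra.
  by move=> a b ->; exists 0; rewrite mul0r addr0.
- move=> eta e0.
  have [B [B' [b [[B1 B2 _ _ B3] [B4 B5 B6]]]]] := smooth_step R.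
  have [chi [chi' [r [c1 [c2 c3]]]]] := smooth_bump B1 B2 B3 B4 B5 B6 e0.
  exists chi, chi', (fun n => `[- r n, r n]%classic); split=> //.
  split=> //.
  - by move=> n a b' /= ->.
  - by move=> n; split; [exact: segment_compact|exact: itv_closed].
  - move=> n x xA; apply: c2; rewrite ltNge; apply/negP => xr; apply: xA.
    by move: xr; rewrite ler_norml /= in_itv.
- by move=> dx x0 g _ _; exact: real_line_shift.
- move=> dx x0 x dx0 _.
  apply: (@esum_hat_of (real_line R) dx x0 x) => //=.
  - by move=> g _; exact: real_line_shift.
  - by move=> a b c /= ->.
  - set t := (x - x0) / dx; set j := Num.floor t.
    have /andP[j_le j_lt] := floor_itv t; rewrite intrD -/j in j_le j_lt.
    have -> : x - (x0 + j%:~R * dx) = (t - j%:~R) * dx.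
      by rewrite mulrBl divfK ?gt_eqF// opprD addrA.
    by rewrite ger0_norm// mulr_ge0 ?(ltW dx0)//; lra.
  - set t := (x - x0) / dx; set j := Num.floor t.
    have /andP[j_le j_lt] := floor_itv t; rewrite intrD -/j in j_le j_lt.
    have -> : x - (x0 + (j + 1)%:~R * dx) = - ((1 - (t - j%:~R)) * dx).
      by rewrite !mulrBl divfK ?gt_eqF// intrD; ring.
    by rewrite normrN ger0_norm// mulr_ge0 ?(ltW dx0)//; lra.
  - set t := (x - x0) / dx; set j := Num.floor t.
    have /andP[j_le j_lt] := floor_itv t; rewrite intrD -/j in j_le j_lt.
    move=> i _ i0 i1.
    have -> : x - (x0 + (i + j)%:~R * dx) = ((t - j%:~R) - i%:~R) * dx.
      by rewrite !mulrBl divfK ?gt_eqF// intrD; ring.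
    rewrite normrM (gtr0_norm dx0) ler_peMl ?(ltW dx0)// ler_normr.
    have [i2|i2] : (i <= -1 \/ 2 <= i)%R by lia.
    - have : i%:~R <= (-1)%:~R :> R by rewrite ler_int.
      by rewrite intrN => h; apply/orP; left; lra.
    - have : (2%:Z)%:~R <= i%:~R :> R by rewrite ler_int.
      by move=> h; apply/orP; right; lra.
Qed.

End instances.

(** * The torus *)

Section torus_instance.
Context (R : realType).
Local Notation tau := (2 * pi : R).
Local Open Scope quotient_scope.

Let tau_gt0 : 0 < tau. Proof. by rewrite mulr_gt0// pi_gt0. Qed.

Lemma torus_pi_eq (a b : R) :
  torus_pi a = torus_pi b <-> exists k : int, a - b = k%:~R * tau.
Proof.
split=> [/eqmodP/asboolP//|h].
by apply/eqmodP/asboolP.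
Qed.

Lemma torus_pi_surj (x : torus R) : torus_pi (repr x) = x.
Proof. exact: reprK. Qed.

Lemma torus_pi_period (a : R) (k : int) : torus_pi (a + k%:~R * tau) = torus_pi
  a.
Proof. by apply/torus_pi_eq; exists k; ring. Qed.

Lemma torus_pi_continuous : continuous (@torus_pi R).
Proof. exact: pi_continuous. Qed.

Let torus_dist_set (x y : torus R) : set R :=
  [set d | exists a b, [/\ torus_pi a = x, torus_pi b = y & d = `|a - b|]].

Let torus_dist_lb (x y : torus R) : has_inf (torus_dist_set x y).
Proof.
split; first by exists `|repr x - repr y|, (repr x), (repr y);
  rewrite !torus_pi_surj.
by exists 0 => _ [a [b [_ _ ->]]].
Qed.

Lemma torus_dist_le (a b : R) : torus_dist (torus_pi a) (torus_pi b) <= `|a -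
  b|.
Proof. by apply: ge_inf; [exact: (torus_dist_lb _ _).2|exists a, b]. Qed.

Lemma le_torus_dist (a b c : R) : (forall k : int, c <= `|a - b + k%:~R * tau|)
  ->
  c <= torus_dist (torus_pi a) (torus_pi b).
Proof.
move=> h; apply: lb_le_inf; first exact: (torus_dist_lb _ _).1.
move=> _ [a' [b' [/torus_pi_eq[k hk] /torus_pi_eq[l hl] ->]]].
have -> : a' - b' = a - b + (k - l)%:~R * tau.
  by rewrite intrB mulrBl -hk -hl; ring.
exact: h.
Qed.

Lemma torus_dist_lt (a : R) (y : torus R) (r : R) :
  torus_dist (torus_pi a) y < r -> exists2 b, torus_pi b = y & `|a - b| <= r.
Proof.
move=> /inf_lt[|_ [a' [b [/torus_pi_eq[k hk] hb ->]]] lt_r].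
  exact: (torus_dist_lb _ _).1.
exists (b - k%:~R * tau); first by rewrite -mulNr -intrN torus_pi_period.
have -> : a - (b - k%:~R * tau) = a' - b by rewrite -hk; ring.
exact: ltW.
Qed.

Lemma torus_compact : compact [set: torus R].
Proof.
have -> : [set: torus R] = @torus_pi R @` `[0, tau]%classic.
  apply/seteqP; split=> // x _; set a := repr x.
  pose k := Num.floor (a / tau).
  have /andP[k_le k_lt] := floor_itv (a / tau).
  exists (a - k%:~R * tau).
    move: k_le k_lt; rewrite -/k ler_pdivlMr// ltr_pdivrMr// intrD mulrDl.
    by rewrite /= in_itv /= => *; apply/andP; split; lra.
  by rewrite -mulNr -intrN torus_pi_period torus_pi_surj.
apply: continuous_compact; last exact: segment_compact.
by apply: continuous_subspaceT => x; exact: torus_pi_continuous.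
Qed.

Section mesh.
Variables (dx : R) (N : nat).
Hypothesis dx_gt0 : 0 < dx.
Hypothesis Ndx : N%:R * dx = tau.

Let cellsE (i : int) : cells (torus_domain R) dx i <-> (0 <= i < N%:Z)%R.
Proof.
rewrite /= -Ndx pmulr_lge0// ltr_pM2r// ler0z -[N%:R]/(N%:~R) ltr_int.
by split.
Qed.

Lemma torus_shift (x0 : R) (g : int -> \bar R) :
  (forall i j, node (torus_domain R) dx x0 i = node (torus_domain R) dx x0 j ->
     g i = g j) ->
  (\esum_(i in cells (torus_domain R) dx) g (i + 1)%R =
   \esum_(i in cells (torus_domain R) dx) g i)%E.
Proof.
(* [e] is the cyclic shift of the cell numbers: the last cell is followed by cell 0, which carries
   the same value as number [N]. *)
move=> hg; pose e (i : int) : int := if (i + 1 < N%:Z)%R then i + 1 else 0.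
have gN i : g (i + N%:Z) = g i.
  apply: hg; rewrite /node /=.
  have -> : x0 + (i + N%:Z)%:~R * dx = x0 + i%:~R * dx + 1%:~R * tau.
    by rewrite intrD -Ndx /=; ring.
  exact: torus_pi_period.
transitivity (\esum_(i in cells (torus_domain R) dx) g (e i))%E.
  apply: eq_esum => i /cellsE Ai; rewrite /e; case: ifPn => // Ni.
  have -> : i + 1 = 0 + N%:Z by lia.
  by rewrite gN.
symmetry; apply: (@reindex_esum R int int _ _ e); split.
- by move=> i /cellsE Ai; apply/cellsE; rewrite /e; case: ifP; lia.
- move=> i j; rewrite !inE => /cellsE Ai /cellsE Aj; rewrite /e.
  by case: ifP; case: ifP => ? ? ?; lia.
- move=> i /cellsE Ai; have [i0|i0] := eqVneq i 0.
    exists (N%:Z - 1); first by apply/cellsE; lia.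
    by rewrite /e i0; case: ifP => //; lia.
  exists (i - 1); first by apply/cellsE; lia.
  by rewrite /e; case: ifP; lia.
Qed.

(** With a single cell the two neighbours of a point would be one node. For [2 <= N] translating by
    a nonzero multiple of the period never shortens the distances [th * dx] and [(1 - th) * dx],
    because [th] lies in [[0, 1[]. *)
Lemma torus_hat (x0 : R) (x : torus_domain R) : (2 <= N)%N ->
  (\esum_(i in cells (torus_domain R) dx) (hat dx x0 i x)%:E = 1)%E.
Proof.
move=> N2; rewrite -[x]torus_pi_surj; set a := repr x.
apply: (@esum_hat_of _ (torus_domain R) dx x0 a) => //.
- by move=> g hg; exact: (torus_shift hg).
- move=> u v c /torus_pi_eq[k hk]; apply/torus_pi_eq; exists k.
  by rewrite -hk; ring.
- by apply/cellsE; lia.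
- by apply/cellsE; lia.
all: set t := (a - x0) / dx; set j := Num.floor t.
all: have /andP[j_le j_lt] := floor_itv t; rewrite intrD -/j in j_le j_lt.
all: set th := t - j%:~R.
all: have th0 : 0 <= th by rewrite subr_ge0.
all: have th1 : th < 1 by rewrite ltrBlDl.
all: have aE : a = x0 + t * dx by rewrite /t divfK ?gt_eqF// addrC subrK.
all: clearbody t.
all: have distE (i k : int) : a - (x0 + (i + j)%:~R * dx) + k%:~R * tau
  = (th - i%:~R + k%:~R * N%:R) * dx
  by rewrite -Ndx intrD [in LHS]aE /th; ring.
all: have N2R : 2 <= N%:R :> R by rewrite ler_nat.
- have -> : j = 0 + j by rewrite add0r.
  apply/eqP; rewrite eq_le; apply/andP; split.
    rewrite (le_trans (torus_dist_le _ _))//.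
    have := distE 0 0; rewrite !mul0r !addr0 => ->.
    by rewrite subr0 ger0_norm// mulr_ge0// ltW.
  apply: le_torus_dist => k; rewrite distE normrM (gtr0_norm dx_gt0).
  rewrite ler_pM2r// subr0 ler_normr.
  have [k0|k0] : (0 <= k \/ k <= -1)%R by lia.
    have : 0 <= k%:~R * N%:R :> R by rewrite mulr_ge0// ler0z.
    by move=> h; apply/orP; left; lra.
  have k1 : k%:~R <= -1 :> R by rewrite -[-1]/((-1)%:~R) ler_int.
  have : k%:~R * N%:R <= -1 * 2 :> R by nra.
  by move=> h; apply/orP; right; lra.
- rewrite (addrC j 1); apply/eqP; rewrite eq_le; apply/andP; split.
    rewrite (le_trans (torus_dist_le _ _))//.
    have := distE 1 0; rewrite !mul0r !addr0 => ->.
    rewrite -normrN -mulNr opprB ger0_norm// mulr_ge0// ?(ltW dx_gt0)//.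
    by rewrite subr_ge0 ltW.
  apply: le_torus_dist => k; rewrite distE normrM (gtr0_norm dx_gt0).
  rewrite ler_pM2r// ler_normr.
  have [k0|k0] : (k <= 0 \/ 1 <= k)%R by lia.
    have : k%:~R * N%:R <= 0 :> R by rewrite mulr_le0_ge0// lerz0.
    by move=> h; apply/orP; right; lra.
  have k1 : 1 <= k%:~R :> R by rewrite -[1]/(1%:~R) ler_int.
  have : 1 * 2 <= k%:~R * N%:R :> R by nra.
  by move=> h; apply/orP; left; lra.
- move=> i /cellsE Ai i0 i1; apply: le_torus_dist => k.
  rewrite distE normrM (gtr0_norm dx_gt0) ler_peMl ?(ltW dx_gt0)//.
  have iN : i%:~R <= N%:R - 1 :> R.
    by rewrite -[N%:R]/(N%:~R) -[1]/(1%:~R) -intrB ler_int; lia.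
  have i2 : 2 <= i%:~R :> R by rewrite -[2]/(2%:~R) ler_int; lia.
  rewrite ler_normr.
  have [k0|k0] : (k <= 0 \/ 1 <= k)%R by lia.
    have : k%:~R * N%:R <= 0 :> R by rewrite mulr_le0_ge0// lerz0.
    by move=> h; apply/orP; right; lra.
  have k1 : 1 <= k%:~R :> R by rewrite -[1]/(1%:~R) ler_int.
  have : N%:R <= k%:~R * N%:R :> R by rewrite ler_peMl.
  by move=> h; apply/orP; left; lra.
Qed.

End mesh.

Lemma regular_torus : regular_domain (torus_domain R).
Proof.
split.
- exact: torus_pi_surj.
- by move=> f cf; apply/quotient_continuous.
- move=> u v c /torus_pi_eq[k hk]; apply/torus_pi_eq; exists k.
  by rewrite -hk; ring.
- by move=> x y; rewrite -(torus_pi_surj x) -(torus_pi_surj y);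
    apply: le_torus_dist.
- exact: torus_dist_le.
- move=> a b y; rewrite -lerBlDr; apply: lb_le_inf;
    first exact: (torus_dist_lb _ _).1.
  move=> _ [b' [c [/torus_pi_eq[k hk] <- ->]]]; rewrite lerBlDr.
  rewrite /= -(torus_pi_period a k) (le_trans (torus_dist_le _ _))//.
  have -> : a + k%:~R * tau - c = (b' - c) + (a - b) by rewrite -hk; ring.
  exact: ler_normD.
- exact: torus_dist_lt.
- move=> eta e0.
  pose n := (Num.truncn (tau / eta)).+1.
  have n0 : 0 < n%:R :> R by rewrite ltr0n.
  exists (tau / n%:R); split.
    rewrite divr_gt0//= ltr_pdivrMr// [eta * _]mulrC -ltr_pdivrMr//.
    exact: truncnS_gt.
  move=> a b /torus_pi_eq[k hk]; exists (k * n%:Z).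
  rewrite intrM /= -mulrA [_ * (_ / _)]mulrC divfK ?gt_eqF// -hk; ring.
- move=> eta e0; exists (fun=> cst 1), (fun=> cst 0), (fun=> setT).
  split; split=> //.
  + by move=> n m; exact: Cdir_cst.
  + by move=> n x; exact: is_derive_cst.
  + by move=> n x /=; rewrite normr0 ltW.
  + by move=> n x /=; rewrite ler01 lexx.
  + by move=> n; split; [exact: torus_compact|exact: closedT].
  + by move=> n x /(_ I).
  + by move=> x; exact: nearW.
- by move=> dx [].
- by move=> dx x0 g [dx0 [N Ndx]]; exact: (torus_shift dx0 Ndx).
- move=> dx x0 x [dx0 [N Ndx]] dx1; apply: (torus_hat dx0 Ndx).
  (* At most one cell of length below 1 cannot fill the period [2 * pi]. *)
  rewrite ltnNge; apply/negP => N1.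
  have : N%:R <= 1 :> R by rewrite (ler_nat _ N 1).
  have := pi_ge2 R; nra.
Qed.

End torus_instance.

(** * Weak solutions *)

Section time_cutoff.
Context (R : realType).
Implicit Types (f g : R -> R) (t a c : R).
Local Notation leb := (@lebesgue_measure R).

Lemma le_norm_Rintegral_segment f a c (M : R) : a <= c ->
  leb.-integrable `[a, c] (EFin \o f) ->
  (forall x, a <= x <= c -> `|f x| <= M) ->
  `|(\int[leb]_(x in `[a, c]) f x)%R| <= M * (c - a).
Proof.
move=> ac intf fM; have mac : measurable (`[a, c]%classic : set R) by [].
have cst_int k : leb.-integrable `[a, c] (EFin \o (cst k : R -> R)).
  apply: continuous_compact_integrable; first exact: segment_compact.
  by apply: continuous_subspaceT; exact: cst_continuous.
have int_cst k : (\int[leb]_(x in `[a, c]) (cst k : R -> R) x)%R = k * (c - a).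
  have mE : leb `[a, c]%classic = (c - a)%:E.
    have := @lebesgue_measure_itv R `[a, c]; rewrite /= lte_fin => ->.
    by move: ac; rewrite le_eqVlt => /predU1P[->|->//]; rewrite ltxx subrr.
  rewrite Rintegral_cst//; congr (_ * _); exact: (congr1 fine mE).
rewrite ler_norml -mulNr -!int_cst; apply/andP; split;
  by apply: le_Rintegral => // x; rewrite /= in_itv /= => /fM;
    rewrite ler_norml => /andP[].
Qed.

Lemma Rintegral_support (A D : set R) f : measurable A -> A `<=` D ->
  (forall x, D x -> ~ A x -> f x = 0) ->
  (\int[leb]_(x in D) f x)%R = (\int[leb]_(x in A) f x)%R.
Proof.
move=> mA AD f0; rewrite -[in RHS](setIidr AD) Rintegral_mkcondr.
apply: eq_Rintegral => x; rewrite inE => Dx; rewrite patchE.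
case: ifPn => //; rewrite notin_setE => Ax; exact: f0.
Qed.

Lemma continuous_integrable_segment f a c : {within `[a, c], continuous f} ->
  leb.-integrable `[a, c] (EFin \o f).
Proof.
by move=> cf; apply: continuous_compact_integrable => //;
  exact: segment_compact.
Qed.

Variables (B B' : R -> R) (b : R).
Hypothesis B_smooth : smooth_dir [set (1 : R)] B.
Hypothesis B_derive : forall x, is_derive x (1 : R) B (B' x).
Hypothesis B'_continuous : continuous B'.
Hypothesis b_gt0 : 0 < b.
Hypothesis B'_le : forall x, `|B' x| <= b.
Hypothesis B_itv : forall x, 0 <= B x <= 1.
Hypothesis B_0 : forall x, x <= 3^-1 -> B x = 0.
Hypothesis B_1 : forall x, 2 / 3 <= x -> B x = 1.

Let B'_eq0_le (x : R) : x <= 0 -> B' x = 0.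
Proof.
move=> x0; suff d : is_derive x 1 B 0 by rewrite -(@derive_val _ _ _ _ _ _ _
  (B_derive x)) derive_val.
apply: (@near_eq_is_derive _ _ _ (cst (0 : R))).
near=> y; rewrite B_0//; apply: ltW; near: y; apply: lt_nbhsl.
by rewrite (le_lt_trans x0)// invr_gt0.
Unshelve. all: by end_near. Qed.

Let B'_eq0_ge (x : R) : 1 <= x -> B' x = 0.
Proof.
move=> x0; suff d : is_derive x 1 B 0 by rewrite -(@derive_val _ _ _ _ _ _ _
  (B_derive x)) derive_val.
apply: (@near_eq_is_derive _ _ _ (cst (1 : R))).
near=> y; rewrite B_1//; apply: ltW; near: y; apply: lt_nbhsr; lra.
Unshelve. all: by end_near. Qed.

Section ramp.
Variables (s0 d : R).
Hypothesis d_gt0 : 0 < d.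
Definition ramp s := B ((s - s0) / d).
Definition ramp' s := B' ((s - s0) / d) * d^-1.

Lemma ramp_smooth : smooth_dir [set (1 : R)] ramp.
Proof.
move=> n; have -> : ramp = B \o (fun s => d^-1 * id s + - (d^-1 * s0)).
  by apply/funext => s; rewrite /ramp /= mulrC mulrBr.
apply: Cdir_comp => //; exact/Cdir_affine/Cdir_id.
Qed.

Lemma ramp_derive s : is_derive s (1 : R) ramp (ramp' s).
Proof.
have -> : ramp = B \o (fun s => d^-1 *: (s - s0)).
  by apply/funext => r; rewrite /ramp /= mulrC.
rewrite /ramp' [X in B' X]mulrC.
have h : is_derive s (1 : R) (id \- cst s0) (1 - 0).
  by apply: is_deriveB.
have {}h := is_deriveZ d^-1 h; rewrite subr0 [_ *: 1]mulr1 in h.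
exact: (is_derive1_comp (B_derive _) h).
Qed.

Lemma ramp'_continuous : continuous ramp'.
Proof.
move=> s; apply: (@continuousM _ _ (fun s => B' ((s - s0) / d)) (cst d^-1)).
  apply: (@continuous_comp _ _ _ (fun s => (s - s0) / d) B');
    last exact: B'_continuous.
  apply: (@continuousM _ _ (id \- cst s0) (cst d^-1));
    last exact: cst_continuous.
  by apply: continuousB; [exact: cvg_id|exact: cst_continuous].
exact: cst_continuous.
Qed.

Lemma ramp_le0 s : s <= s0 -> ramp s = 0 /\ ramp' s = 0.
Proof.
move=> s1; have h : (s - s0) / d <= 0 by rewrite mulr_le0_ge0 ?subr_le0
  ?invr_ge0// ltW.
by rewrite /ramp /ramp' B_0 ?B'_eq0_le ?mul0r// (le_trans h).
Qed.

Lemma ramp_ge1 s : s0 + d <= s -> ramp s = 1 /\ ramp' s = 0.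
Proof.
move=> s1; have h : 1 <= (s - s0) / d by rewrite ler_pdivlMr// mul1r; lra.
by rewrite /ramp /ramp' B_1 ?B'_eq0_ge ?mul0r//; lra.
Qed.

Lemma ramp'_le s : `|ramp' s| <= b / d.
Proof.
by rewrite /ramp' normrM normfV (gtr0_norm d_gt0) ler_pM2r ?invr_gt0.
Qed.

(** [ramp'] has integral 1 over [[s0, s0 + d]], so it acts as an approximate evaluation at these
    times. From [|ramp'| <= b / d] its total variation is at most [b], whence the factor. *)
Lemma ramp'_approx g a c (k eta : R) : a <= s0 -> s0 + d <= c ->
  {within `[a, c], continuous g} ->
  (forall s, s0 <= s <= s0 + d -> `|g s - k| <= eta) ->
  `|(\int[leb]_(s in `[a, c]) (ramp' s * g s))%R - k| <= b * eta.
Proof.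
move=> as0 s0c cg gk.
have sd : s0 < s0 + d by rewrite ltrDl.
have sub : `[s0, s0 + d] `<=` `[a, c].
  by move=> s; rewrite /= !in_itv /= => /andP[? ?]; apply/andP; split; lra.
rewrite (@Rintegral_support `[s0, s0 + d])//; last first.
  move=> s _ /negP; rewrite /= in_itv /= negb_and -!ltNge => /orP[s1|s1].
    by rewrite (ramp_le0 (ltW s1)).2 mul0r.
  by rewrite (ramp_ge1 (ltW s1)).2 mul0r.
have {}cg := continuous_subspaceW sub cg.
have cr : {within `[s0, s0 + d], continuous ramp'}.
  by apply: continuous_subspaceT; exact: ramp'_continuous.
have ic f : continuous f -> leb.-integrable `[s0, s0 + d] (EFin \o f).
  by move=> cf; apply: continuous_integrable_segment;
    exact: continuous_subspaceT.
have i1 : leb.-integrable `[s0, s0 + d] (EFin \o (fun s => ramp' s * g s)).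
  by apply: continuous_integrable_segment => x; apply: continuousM;
    [exact: cr|exact: cg].
have i2 : leb.-integrable `[s0, s0 + d] (EFin \o (fun s => ramp' s * k)).
  apply: ic => s; apply: continuousM; [exact: ramp'_continuous|
    exact: cst_continuous].
have int1 : (\int[leb]_(s in `[s0, s0 + d]) ramp' s)%R = 1.
  rewrite /Rintegral (@continuous_FTC2 _ ramp' ramp)//.
  - by rewrite -EFinB /= (ramp_le0 (lexx _)).1 (ramp_ge1 (lexx _)).1 subr0.
  - have dr s : derivable ramp s 1 by have [] := ramp_derive s.
    have cR : continuous ramp by exact: Cdir_continuous (ramp_smooth 0).
    split => //.
      by apply: cvg_at_right_filter; exact: cR.
    by apply: cvg_at_left_filter; exact: cR.
  - by move=> s _; rewrite derive1E; have [] := ramp_derive s.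
have -> : k = (\int[leb]_(s in `[s0, s0 + d]) (ramp' s * k))%R.
  by rewrite RintegralZr// ?int1 ?mul1r//; exact: ic ramp'_continuous.
rewrite -RintegralB//.
apply: le_trans (le_norm_Rintegral_segment (M := b / d * eta) (ltW sd) _ _) _.
- exact: (integrableB _ i1 i2).
- move=> s /gk h; rewrite -mulrBr normrM ler_pM//.
  exact: ramp'_le.
- by rewrite addrC addKr mulrAC divfK ?gt_eqF.
Qed.

End ramp.

(** Passes from a bound on the distributional derivative to a bound on the increment: [theta]
    approximates the indicator of [[t1, t2]], so that [theta'] is nearly a Dirac mass at [t1] minus
    one at [t2]. *)
Lemma test_in_time g t1 t2 (M : R) : t1 < t2 ->
  {within `[t1, t2], continuous g} ->
  (forall theta theta' : R -> R,
    smooth_dir [set (1 : R)] theta ->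
    (forall s, is_derive s (1 : R) theta (theta' s)) -> continuous theta' ->
    (forall s, `|theta s| <= 1) ->
    (forall s, s <= t1 \/ t2 <= s -> theta s = 0 /\ theta' s = 0) ->
    `|(\int[leb]_(s in `[t1, t2]) (theta' s * g s))%R| <= M) ->
  `|g t2 - g t1| <= M.
Proof.
move=> t12 cg h; apply/ler_addgt0Pr => e e0.
(* Each of the two ramps then costs [b * eta = e / 2]. *)
pose eta := e / (2 * b).
have eta0 : 0 < eta by rewrite divr_gt0// mulr_gt0.
have [/cvgrPdist_le cl1 /cvgrPdist_le cl2] : g x @[x --> t1^'+] --> g t1 /\ g x
  @[x --> t2^'-] --> g t2.
  by have [_ ? ?] := (continuous_within_itvP g t12).1 cg.
have /(_ eta eta0) := cl1; rewrite near_withinE near_simpl => -[d1 /= d10 n1].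
have /(_ eta eta0) := cl2; rewrite near_withinE near_simpl => -[d2 /= d20 n2].
(* Halving [d1] and [d2] gives strict inequalities; the last bound makes the rising ramp end before
   the falling one starts. *)
pose d := Num.min (Num.min (d1 / 2) (d2 / 2)) ((t2 - t1) / 2).
have d0 : 0 < d by rewrite !lt_min !divr_gt0//= subr_gt0.
have [dd1 dd2 dd3] : [/\ d < d1, d < d2 & d <= (t2 - t1) / 2].
  have : d <= d1 / 2 /\ d <= d2 / 2 /\ d <= (t2 - t1) / 2.
    by rewrite /d !ge_min !lexx !orbT.
  by move=> [? [? ?]]; split=> //; lra.
pose r1 := ramp t1 d; pose r2 := ramp (t2 - d) d.
pose r1' := ramp' t1 d; pose r2' := ramp' (t2 - d) d.
have ramp01 s0 s : 0 <= ramp s0 d s <= 1 by exact: B_itv.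
have cr1 := @ramp'_continuous t1 d; have cr2 := @ramp'_continuous (t2 - d) d.
have p1 : smooth_dir [set (1 : R)] (r1 \- r2).
  move=> n; have -> : r1 \- r2 = r1 \+ (fun s => -1 * r2 s + 0).
    by apply/funext => s /=; ring.
  by apply: CdirD; [exact: ramp_smooth|apply: Cdir_affine; exact: ramp_smooth].
have p2 s : is_derive s (1 : R) (r1 \- r2) ((r1' \- r2') s).
  by apply: is_deriveB; exact: ramp_derive.
have p3 : continuous (r1' \- r2').
  by move=> s; apply: continuousB; [exact: cr1|exact: cr2].
have p4 s : `|(r1 \- r2) s| <= 1.
  by have := ramp01 t1 s; have := ramp01 (t2 - d) s;
    rewrite /r1 /r2 /= ler_norml; lra.
have p5 s : s <= t1 \/ t2 <= s -> (r1 \- r2) s = 0 /\ (r1' \- r2') s = 0.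
  case=> [s1|s2].
    have [e1 e2] := ramp_le0 d0 s1.
    have [|e3 e4] := @ramp_le0 (t2 - d) _ d0 s; first by lra.
    by rewrite /= /r1 /r2 /r1' /r2' e1 e2 e3 e4 !subr0.
  have [|e1 e2] := @ramp_ge1 t1 _ d0 s; first by lra.
  have [|e3 e4] := @ramp_ge1 (t2 - d) _ d0 s; first by lra.
  by rewrite /= /r1 /r2 /r1' /r2' e1 e2 e3 e4 !subrr.
have := h _ _ p1 p2 p3 p4 p5.
have i_ s0 : leb.-integrable `[t1, t2] (EFin \o (fun s => ramp' s0 d s * g s)).
  apply: continuous_integrable_segment => x; apply: continuousM; last exact: cg.
  by apply: continuous_subspaceT; exact: ramp'_continuous.
under eq_Rintegral do rewrite mulrBl.
rewrite RintegralB//; last 2 first.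
  exact: i_.
  exact: i_.
have a1 : `|(\int[leb]_(s in `[t1, t2]) (r1' s * g s))%R - g t1| <= b * eta.
  apply: ramp'_approx => //; first by lra.
  move=> s /andP[s1 s2]; move: s1; rewrite le_eqVlt => /predU1P[<-|s1].
    by rewrite subrr normr0 ltW.
  by rewrite distrC; apply: n1 => //=; rewrite ltr_norml; lra.
have a2 : `|(\int[leb]_(s in `[t1, t2]) (r2' s * g s))%R - g t2| <= b * eta.
  apply: ramp'_approx => //; [by lra|by lra|].
  move=> s /andP[s1]; rewrite subrK le_eqVlt => /predU1P[->|s2].
    by rewrite subrr normr0 ltW.
  by rewrite distrC; apply: n2 => //=; rewrite ltr_norml; lra.
have be : b * eta = e / 2 by rewrite /eta; field; rewrite gt_eqF.
move: a1 a2; rewrite be; move: (Rintegral _ _ _) => I1;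
  move: (Rintegral _ _ _) => I2.
by rewrite !ler_norml => *; apply/andP; split; lra.
Qed.

End time_cutoff.

(** * Smooth functions of space and time *)

Section space_time.
Context (R : realType).

Definition space_time_dirs : set (R * R) := [set (1, 0); (0, 1)].
Local Notation DD := space_time_dirs.

Lemma Cdir_Ck n (f : R * R -> R) : Cdir DD n f -> Ck n f.
Proof.
elim: n f => [|n ih] f [cf df]; split => //.
have [G1 d1 C1] := df (1, 0) (or_introl erefl).
have [G2 d2 C2] := df (0, 1) (or_intror erefl).
have D1 : 'D_(1, 0) f = G1 by apply/funext => z; exact: derive_val.
have D2 : 'D_(0, 1) f = G2 by apply/funext => z; exact: derive_val.
split.
- by move=> z; have [] := d1 z.
- by move=> z; have [] := d2 z.
- by rewrite D1; exact: ih.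
- by rewrite D2; exact: ih.
Qed.

Lemma is_derive_linear_form (f : R * R -> R) (z v : R * R) (a : R) :
  (forall h : R, f (h *: v + z) = f z + h * a) -> is_derive z v f a.
Proof.
move=> fE.
have lim : h^-1 *: (f (h *: v + z) - f z) @[h --> (0 : R)^'] --> a.
  apply: cvg_near_cst; near=> h.
  have h0 : h != 0 by near: h; exact: nbhs_dnbhs_neq.
  by rewrite fE addrC addKr [_ *: _]mulrA mulVf// mul1r.
apply: DeriveDef; last exact: cvg_lim lim.
by apply/cvg_ex; exists a; exact: lim.
Unshelve. all: by end_near. Qed.

Lemma is_derive_fst (z v : R * R) : is_derive z v fst v.1.
Proof. by apply: is_derive_linear_form => h /=; rewrite addrC. Qed.

Lemma is_derive_snd (z v : R * R) : is_derive z v snd v.2.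
Proof. by apply: is_derive_linear_form => h /=; rewrite addrC. Qed.

Lemma Cdir_fst n : Cdir DD n (fst : R * R -> R).
Proof.
apply: (@Cdir_linear _ _ _ _ _ fst); last by move=> *; exact: is_derive_fst.
by move=> x; exact: cvg_fst.
Qed.

Lemma Cdir_snd n : Cdir DD n (snd : R * R -> R).
Proof.
apply: (@Cdir_linear _ _ _ _ _ snd); last by move=> *; exact: is_derive_snd.
by move=> x; exact: cvg_snd.
Qed.

Lemma smooth_dir_continuous_derive (V : normedModType R) (D : set V)
    (f g : V -> R) (v : V) : D v -> smooth_dir D f ->
  (forall z, is_derive z v f (g z)) -> continuous g.
Proof.
move=> Dv sf dg; have [_ /(_ v Dv)[g' d' [cg _]]] := sf 1%N.
suff -> : g = g' by [].
by apply/funext => z; rewrite -(@derive_val _ _ _ _ _ _ _ (dg z)) derive_val.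
Qed.

End space_time.

(** * The weak formulation on a time interval *)

Section weak_evolution.
Context (R : realType) (K : spatial_domain R) (hK : regular_domain K).
Local Notation p := (covering K).
Local Notation DD := (@space_time_dirs R).

(* Functions on [K] are handled through the periodic functions on [R] they lift
   to. *)
Definition pr (nu : prob K) (F : R -> R) : R := pairing nu (F \o @lift_of R K).

Lemma periodic_lift (X : Type) (F : R -> X) a : periodic K F ->
  F (lift_of (p a)) = F a.
Proof. by apply; rewrite covering_lift. Qed.

(** On the torus the section [lift_of] is not continuous. Continuity is checked after composition
    with the covering, where periodicity makes the section disappear. *)
Lemma lift_bounded_continuous (F : R -> R) : periodic K F -> continuous F ->
  (exists M, forall x, `|F x| <= M) -> bounded_continuous (F \o @lift_of R K).
Proof.
move=> pF cF [M hM]; split; last by exists M => x /=.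
apply: covering_cofinal => //; suff -> : (F \o @lift_of R K) \o p = F by [].
by apply/funext => a /=; exact: periodic_lift.
Qed.

Lemma section_continuous (F : R * R -> R) (s : R) : continuous F ->
  continuous (fun x => F (x, s)).
Proof.
move=> cF x; apply: (@continuous_comp _ _ _ (fun x => (x, s)) F);
  last exact: cF.
by apply: (@cvg_pair _ _ _ _ (nbhs x) (nbhs s)); [exact: cvg_id|exact: cvg_cst].
Qed.

Variables (V : prob K -> K -> R) (C1 C2 : R).
Hypothesis V_le : forall nu x, `|V nu x| <= C1.
Hypothesis V_lip : forall nu x y, `|V nu x - V nu y| <= C2 * dom_dist x y.

Lemma velocity_lip nu a c : 0 <= C2 -> `|V nu (p a) - V nu (p c)| <= C2 * `|a -
  c|.
Proof.
move=> C20; rewrite (le_trans (V_lip _ _ _))// ler_wpM2l//.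
exact: dom_dist_covering.
Qed.

Lemma lipschitz_continuous_real (f : R -> R) (L : R) :
  (forall x y, `|f x - f y| <= L * `|x - y|) -> continuous f.
Proof.
move=> fL x; apply/cvgrPdist_le => e e0.
have L0 : 0 <= L by have := fL 1 0; rewrite subr0 normr1 mulr1; exact: le_trans.
have L1 : 0 < L + 1 by lra.
near=> y; rewrite (le_trans (fL _ _))//.
apply: (@le_trans _ _ ((L + 1) * `|x - y|)); first by rewrite ler_wpM2r// lerDl.
rewrite mulrC -ler_pdivlMr//; near: y.
by apply: cvgr_dist_le; [exact: cvg_id|exact: divr_gt0].
Unshelve. all: by end_near. Qed.

Hypothesis C2_ge0 : 0 <= C2.

Lemma velocity_bounded_continuous nu : bounded_continuous (V nu).
Proof.
split; last by exists C1.
apply: covering_cofinal => //; apply: (@lipschitz_continuous_real _ C2) => a c.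
exact: velocity_lip.
Qed.

Variables (mu0 : prob K) (mu : R -> prob K).
Hypothesis mu_solution : measure_valued_solution V mu0 mu.

Section test.
Variables (phi phi_x phi_t : R * R -> R) (A : set K) (N D : R).
Hypothesis phi_smooth : smooth_dir DD phi.
Hypothesis phi_xE : forall z : R * R, is_derive z ((1, 0) : R * R) phi (phi_x
  z).
Hypothesis phi_tE : forall z : R * R, is_derive z ((0, 1) : R * R) phi (phi_t
  z).
Hypothesis phi_periodic : forall s, periodic K (fun x => phi (x, s)).
Hypotheses (A_compact : compact A) (A_closed : closed A).
Hypothesis phi_support : forall x s, ~ A (p x) -> phi (x, s) = 0.
Hypothesis phi_bounded : forall z, `|phi z| <= N.
Hypothesis phi_lip : forall x s s', `|phi (x, s) - phi (x, s')| <= D * `|s -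
  s'|.

Let g (s : R) : R := pr (mu s) (fun x => phi (x, s)).

Let phi_bc s : bounded_continuous ((fun x => phi (x, s)) \o @lift_of R K).
Proof.
apply: lift_bounded_continuous => //; last by exists N.
by apply: section_continuous; exact: Cdir_continuous (phi_smooth 0).
Qed.

(** The solution is continuous in time only against a fixed function. The moving function
    [phi (x, s)] is first frozen at [s0], at a cost that is small uniformly in [x] by [phi_lip]. *)
Let g_continuous : {within `[0, +oo[, continuous g}.
Proof.
have [_ mu_cont _] := mu_solution.
have h s0 : {within `[0, +oo[, continuous (fun t => pr (mu t) (fun x => phi (x,
  s0)))}.
  apply: mu_cont; split; first exact: (phi_bc s0).1.
  move=> e e0; exists A => // x Ax /=.
  by rewrite phi_support ?normr0// covering_lift.
have D0 : 0 <= D by have := phi_lip 0 1 0; rewrite subr0 normr1 mulr1;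
  exact: le_trans.
have D1 : 0 < D + 1 by lra.
move=> s0; apply/cvgrPdist_le => e e0.
have e2 : 0 < e / 2 by rewrite divr_gt0.
have /cvgrPdist_le/(_ _ e2) := h s0 s0.
have near_s0 : \forall s \near (s0 : subspace `[0, +oo[), `|s0 - s| <= e / 2 /
  (D + 1).
  have : {within `[0, +oo[, continuous (@id R)} by apply: continuous_subspaceT
    => x; exact: cvg_id.
  by move=> /(_ s0)/cvgrPdist_le; apply; rewrite divr_gt0.
apply: filterS2 near_s0 => s s1 s2.
rewrite (splitr e) -(subrKA (pr (mu s) (fun x => phi (x, s0)))) (le_trans
  (ler_normD _ _))// lerD//.
apply: pairing_dist_le; [exact: phi_bc|exact: phi_bc|move=> x /=].
rewrite (le_trans (phi_lip _ _ _))//.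
apply: (@le_trans _ _ ((D + 1) * `|s0 - s|)); first by rewrite ler_wpM2r//
  lerDl.
by rewrite mulrC -ler_pdivlMr.
Qed.

(** The weak formulation is tested with [phi] times a time cutoff [th]. It says that the integral of
    [th' * g] is minus that of [th] times the pairing of [phi_t + V * phi_x], and the latter is at
    most [M * (t2 - t1)]. *)
Lemma weak_evolution (t1 t2 M : R) : 0 <= t1 -> t1 < t2 ->
  (forall s x, t1 <= s <= t2 ->
    `|phi_t (x, s) + V (mu s) (p x) * phi_x (x, s)| <= M) ->
  `|pr (mu t2) (fun x => phi (x, t2)) - pr (mu t1) (fun x => phi (x, t1))|
    <= M * (t2 - t1).
Proof.
move=> t10 t12 hM.
have sub : `[t1, t2] `<=` `[0, +oo[.
  by move=> s; rewrite /= !in_itv /= andbT => /andP[s1 _]; exact: le_trans s1.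
have cg : {within `[t1, t2], continuous g} := continuous_subspaceW sub
  g_continuous.
have [B [B' [b [[B1 B2 B3 b0 B4] [B5 B6 B7]]]]] := smooth_step R.
apply: (test_in_time B1 B2 B3 b0 B4 B5 B6 B7 t12 cg) => th th' sth dth cth' th1
  th0.
pose Phi z := phi z * th z.2.
pose Psi (z : K * R) : R := Phi (lift_of z.1, z.2).
have lifted_Psi : lifted Psi = Phi.
  apply/funext => -[x s]; rewrite /lifted /Psi /Phi /=; congr (_ * _).
  exact: (periodic_lift x (@phi_periodic s)).
have sPhi : smooth_dir DD Phi.
  move=> n; apply: CdirM; first exact: phi_smooth.
  by apply: (Cdir_comp (sth n)); exact: Cdir_snd.
have dPhi z v q : is_derive z v phi q -> is_derive z v Phi (phi z * (th' z.2 *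
  v.2) + th z.2 * q).
  move=> dq; have dc := is_derive_comp_dir (dth z.2) (is_derive_snd z v).
  exact: (is_deriveM dq dc).
have dxE x s : d_x Psi x s = th s * phi_x (lift_of x, s).
  have [_] := dPhi _ _ _ (phi_xE (lift_of x, s)).
  by rewrite /d_x lifted_Psi => -> /=; rewrite !mulr0 add0r.
have dtE x s : d_t Psi x s = phi (lift_of x, s) * th' s + th s * phi_t (lift_of
  x, s).
  have [_] := dPhi _ _ _ (phi_tE (lift_of x, s)).
  by rewrite /d_t lifted_Psi => -> /=; rewrite mulr1.
have testPsi : test_function Psi.
  split; first by rewrite lifted_Psi => n; apply: Cdir_Ck; exact: sPhi.
  have cA : closed (A `*` `[t1, t2]).
    have -> : A `*` `[t1, t2] = fst @^-1` A `&` snd @^-1` `[t1, t2] by [].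
    apply: closedI; first by apply: closed_comp => // z _; exact: cvg_fst.
    by apply: closed_comp => [z _|]; [exact: cvg_snd|exact: itv_closed].
  apply: (@subclosed_compact _ _ (A `*` `[t1, t2])).
  - exact: closed_closure.
  - by apply: compact_setX => //; exact: segment_compact.
  - rewrite [X in _ `<=` X](closure_id _).1//; apply: closure_subset => -[x s]
      /= [_].
    rewrite /Psi /Phi /= => nz; split => /=.
      apply: contrapT => Ax; move/eqP: nz; apply.
      by rewrite phi_support ?mul0r// covering_lift.
    rewrite in_itv /=; apply: contrapT => /negP;
      rewrite negb_and -!ltNge => s12.
    have h : s <= t1 \/ t2 <= s by case/orP: s12 => /ltW; [left|right].
    by move/eqP: nz; apply; rewrite (th0 s h).1 mulr0.
have [_ _ /(_ _ testPsi)[intW]] := mu_solution.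
(* The initial term drops out since [th] vanishes up to time [t1 >= 0]. *)
have -> : pairing mu0 (fun x => Psi (x, 0)) = 0.
  rewrite -[RHS](pairing_cst mu0 0); congr pairing; apply/funext => x.
  by rewrite /Psi /Phi /= (th0 0 (or_introl t10)).1 mulr0.
rewrite addr0; set W := weak_integrand V mu Psi => W0.
have cphix s : continuous (fun x => phi_x (x, s)).
  apply: section_continuous; apply: (smooth_dir_continuous_derive _ phi_smooth
    phi_xE).
  by left.
have cphit s : continuous (fun x => phi_t (x, s)).
  apply: section_continuous; apply: (smooth_dir_continuous_derive _ phi_smooth
    phi_tE).
  by right.
pose rest s x := phi_t (lift_of x, s) + V (mu s) x * phi_x (lift_of x, s).
have per_x s : periodic K (fun x => phi_x (x, s)).
  move=> a c ac.
  rewrite -(@derive_val _ _ _ _ _ _ _ (phi_xE (a, s))) -(@derive_val _ _ _ _ _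
    _ _ (phi_xE (c, s))).
  rewrite /derive; set g1 := fun h => h^-1 *: _; set g2 := fun h => h^-1 *: _.
  suff -> : g1 = g2 by [].
  apply/funext => h; rewrite /g1 /g2 /=; congr (_ *: (_ - _)).
    apply: (@phi_periodic (h *: 0 + s) (h *: 1 + a) (h *: 1 + c)).
    by rewrite ![h *: 1 + _]addrC; exact: covering_shift.
  exact: (@phi_periodic s).
have per_t s : periodic K (fun x => phi_t (x, s)).
  move=> a c ac.
  rewrite -(@derive_val _ _ _ _ _ _ _ (phi_tE (a, s))) -(@derive_val _ _ _ _ _
    _ _ (phi_tE (c, s))).
  rewrite /derive; set g1 := fun h => h^-1 *: _; set g2 := fun h => h^-1 *: _.
  suff -> : g1 = g2 by [].
  apply/funext => h; rewrite /g1 /g2 /=; congr (_ *: (_ - _)).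
    apply: (@phi_periodic (h *: 1 + s) (h *: 0 + a) (h *: 0 + c)).
    by rewrite ![h *: 0 + _]addrC; exact: covering_shift.
  exact: (@phi_periodic s).
have rest_bc s : t1 <= s <= t2 -> bounded_continuous (rest s).
  move=> s12; split; last first.
    exists M => x; have := hM s (lift_of x) s12; rewrite covering_lift//.
  have cl (F : R -> R) : periodic K F -> continuous F -> continuous (F \o
    @lift_of R K).
    move=> pF cF; apply: covering_cofinal => //.
    suff -> : (F \o @lift_of R K) \o p = F by [].
    by apply/funext => a /=; exact: periodic_lift.
  pose f1 := (fun x => phi_t (x, s)) \o @lift_of R K.
  pose f2 := (fun x => phi_x (x, s)) \o @lift_of R K.
  have c1 : continuous f1 by exact: cl.
  have c2 : continuous f2 by exact: cl.
  rewrite (_ : rest s = f1 + (V (mu s) * f2))// => x.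
  apply: continuousD; first exact: c1.
  by apply: continuousM; [exact: (velocity_bounded_continuous _).1|exact: c2].
have WE s : t1 <= s <= t2 -> W s = th' s * g s + th s * pairing (mu s) (rest s).
  move=> s12; rewrite /W /weak_integrand.
  have -> : (fun x => d_t Psi x s + V (mu s) x * d_x Psi x s) =
      (fun x => th' s * phi (lift_of x, s)) \+ (fun x => th s * rest s x).
    by apply/funext => x; rewrite dtE dxE /rest /=; ring.
  have bcZ c (f : K -> R) : bounded_continuous f -> bounded_continuous (fun x
    => c * f x).
    by move=> bf; apply: bounded_continuousM bf; exact: bounded_continuous_cst.
  rewrite pairingD; [|exact: (bcZ _ _ (phi_bc s))|exact: (bcZ _ _ (rest_bc s
    s12))].
  by rewrite !pairingZ//; [exact: rest_bc|exact: phi_bc].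
have W_out s : ~ `[t1, t2]%classic s -> W s = 0.
  rewrite /= in_itv /= => s12.
  have h : s <= t1 \/ t2 <= s.
    by move/negP : s12; rewrite negb_and -!ltNge => /orP[/ltW|/ltW];
      [left|right].
  have [h0 h1] := th0 s h.
  rewrite -[RHS](pairing_cst (mu s) 0) /W /weak_integrand; congr pairing.
  by apply/funext => x; rewrite dtE dxE h0 h1 !mul0r !mulr0 !addr0.
move: W0; rewrite (@Rintegral_support _ `[t1, t2])//; last by move=> s _;
  exact: W_out.
move=> W0.
have i1 : (@lebesgue_measure R).-integrable `[t1, t2] (EFin \o W).
  by apply: integrableS intW.
have i2 : (@lebesgue_measure R).-integrable `[t1, t2] (EFin \o (fun s => th' s
  * g s)).
  apply: continuous_integrable_segment => x; apply: continuousM; last exact: cg.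
  by apply: continuous_subspaceT.
(* The integral of [W] is zero, so it may be inserted in front of minus the integral of [th' * g];
   the difference of the integrands is [th] times the pairing with [rest s]. *)
rewrite -normrN -[X in `|X|]add0r -W0 -RintegralB//.
apply: le_norm_Rintegral_segment; first exact: ltW.
  exact: (integrableB _ i1 i2).
move=> s s12; rewrite WE// addrC addKr normrM -[leRHS]mul1r ler_pM//.
apply: pairing_norm_le; first exact: rest_bc.
by move=> x; have := hM s (lift_of x) s12; rewrite covering_lift.
Qed.

End test.
End weak_evolution.

Lemma derive_le_lipschitz (R : realType) (f f' : R -> R) (L : R) :
  (forall x, is_derive x (1 : R) f (f' x)) -> (forall x, `|f' x| <= L) ->
  forall x y, `|f x - f y| <= L * `|x - y|.
Proof.
move=> df f'L.
have cf : continuous f.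
  by move=> x; apply/differentiable_continuous/derivable1_diffP;
    have [] := df x.
have main x y : x <= y -> `|f x - f y| <= L * `|x - y|.
  move=> xy; rewrite distrC (distrC x).
  have [|c _ ->] := @MVT_segment _ f f' x y xy (fun z _ => df z).
    exact: continuous_subspaceT.
  by rewrite normrM ler_wpM2r.
move=> x y; have [xy|/ltW yx] := leP x y; first exact: main.
by rewrite distrC (distrC x); exact: main.
Qed.

(** * Transport along a frozen smooth velocity *)

Section transport.
Context (R : realType) (K : spatial_domain R) (hK : regular_domain K).
Local Notation p := (covering K).
Local Notation DD := (@space_time_dirs R).
Lemma periodic_interp (B : R -> R) (e : R) (F : R -> R) : 0 < e ->
  (forall a c : R, p a = p c -> exists k : int, a = c + k%:~R * e) ->
  periodic K F -> periodic K (smooth_interp B e F).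
Proof.
move=> e0 grid pF a c ac; have [k ak] := grid a c ac.
rewrite ak; apply: smooth_interp_periodic => // x; apply: pF.
rewrite addrC [in RHS](_ : x = c + (x - c)); last by ring.
by rewrite -(covering_shift hK (x - c) ac) ak; congr p; ring.
Qed.

Variables (V : prob K -> K -> R) (C1 C2 : R).
Hypothesis V_le : forall nu x, `|V nu x| <= C1.
Hypothesis V_lip : forall nu x y, `|V nu x - V nu y| <= C2 * dom_dist x y.
Hypothesis C2_ge0 : 0 <= C2.
Variables (mu0 : prob K) (mu : R -> prob K).
Hypothesis mu_solution : measure_valued_solution V mu0 mu.

(** At time [t + h] the test function is [Psi], at time [t] it is [Psi] after the shift by [h * w].
    Spatial cutoffs give it compact support; their slope costs [C1 * N * eta], and letting [n] tend
    to infinity removes them from the two pairings by dominated convergence. *)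
Lemma transport_step_smooth (Psi Psi' w w' : R -> R) (N bL Cw C4 beta t h eta :
  R) :
  smooth_dir [set (1 : R)] Psi -> (forall x, is_derive x (1 : R) Psi (Psi' x))
    ->
  periodic K Psi -> (forall x, `|Psi x| <= N) -> (forall x, `|Psi' x| <= bL) ->
  smooth_dir [set (1 : R)] w -> (forall x, is_derive x (1 : R) w (w' x)) ->
  periodic K w -> (forall x, `|w x| <= Cw) -> (forall x, `|w' x| <= C4) ->
  0 <= t -> 0 < h -> 0 < eta ->
  (forall s x, t <= s <= t + h -> `|V (mu s) (p x) - w x| <= beta) ->
  `|pr (mu (t + h)) Psi - pr (mu t) (fun x => Psi (x + h * w x))| <=
    (bL * (beta + h * C4 * C1) + C1 * N * eta) * h.
Proof.
move=> sPsi dPsi pPsi PsiN Psi'L sw dw pw wC w'C t0 h0 eta0 wbeta.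
(* [Psi] is transported backwards along the frozen velocity [w]. *)
have [chi [chi' [A [[schi dchi chi'_le chi01] [pchi A_cc chiA chi1]]]]] :=
  exists_cutoff hK eta0.
pose c := t + h.
pose q (z : R * R) : R := z.1 + (-1 * z.2 + c) * w z.1.
pose phi n (z : R * R) : R := Psi (q z) * chi n z.1.
pose q_x (z : R * R) : R := 1 + (-1 * z.2 + c) * w' z.1.
pose phi_x n z := Psi (q z) * chi' n z.1 + chi n z.1 * (Psi' (q z) * q_x z).
pose phi_t n z := chi n z.1 * (Psi' (q z) * - w z.1).
have chi_norm n x : `|chi n x| <= 1 by have := chi01 n x; rewrite ler_norml;
  lra.
have N0 : 0 <= N := le_trans (normr_ge0 _) (PsiN 0).
have bL0 : 0 <= bL := le_trans (normr_ge0 _) (Psi'L 0).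
have C40 : 0 <= C4 := le_trans (normr_ge0 _) (w'C 0).
have sphi n : smooth_dir DD (phi n).
  move=> m; apply: CdirM; last by apply: (Cdir_comp (schi n m));
    exact: Cdir_fst.
  apply: (Cdir_comp (sPsi m)); apply: CdirD; first exact: Cdir_fst.
  apply: CdirM; first exact/Cdir_affine/Cdir_snd.
  by apply: (Cdir_comp (sw m)); exact: Cdir_fst.
have dq (z v : R * R) : is_derive z v q
    (v.1 + ((-1 * z.2 + c) * (w' z.1 * v.1) + w z.1 * (-1 * v.2))).
  have dw1 := is_derive_comp_dir (dw z.1) (is_derive_fst z v).
  have ds : is_derive z v (fun y : R * R => -1 * y.2 + c) (-1 * v.2).
    by apply: is_derive_linear_form => k /=; rewrite /GRing.scale /=; ring.
  exact: (is_deriveD (is_derive_fst z v) (is_deriveM ds dw1)).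
have dphi n (z v : R * R) : is_derive z v (phi n)
    (Psi (q z) * (chi' n z.1 * v.1) +
     chi n z.1 * (Psi' (q z) * (v.1 + ((-1 * z.2 + c) * (w' z.1 * v.1) + w z.1
       * (-1 * v.2))))).
  have d1 := is_derive_comp_dir (dPsi (q z)) (dq z v).
  have d2 := is_derive_comp_dir (dchi n z.1) (is_derive_fst z v).
  exact: (is_deriveM d1 d2).
have phi_xE n (z : R * R) : is_derive z ((1, 0) : R * R) (phi n) (phi_x n z).
  apply: (is_derive_eq (dphi n z (1, 0))); rewrite /phi_x /q_x /=; ring.
have phi_tE n (z : R * R) : is_derive z ((0, 1) : R * R) (phi n) (phi_t n z).
  apply: (is_derive_eq (dphi n z (0, 1))); rewrite /phi_t /=; ring.
have per_phi n s : periodic K (fun x => phi n (x, s)).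
  move=> x y xy; rewrite /phi /q /= (pchi n _ _ xy) (pw _ _ xy); congr (_ * _).
  by apply: pPsi; exact: covering_shift.
have phi_le n z : `|phi n z| <= N.
  by rewrite normrM -[leRHS]mulr1 ler_pM.
have Psi_lip := derive_le_lipschitz dPsi Psi'L.
have phi_lip n x s s' : `|phi n (x, s) - phi n (x, s')| <= (bL * Cw) * `|s -
  s'|.
  rewrite /phi /= -mulrBl normrM -[leRHS]mulr1 ler_pM//.
  rewrite (le_trans (Psi_lip _ _))// -mulrA ler_wpM2l// /q /=.
  have -> : x + (-1 * s + c) * w x - (x + (-1 * s' + c) * w x) = w x * - (s -
    s') by ring.
  by rewrite normrM normrN ler_wpM2r.
have step n : `|pr (mu c) (fun x => phi n (x, c)) - pr (mu t) (fun x => phi n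
  (x, t))| <=
    (bL * (beta + h * C4 * C1) + C1 * N * eta) * h.
  have [Ac Acl] := A_cc n.
  have -> : h = c - t by rewrite /c addrC addKr.
  apply: (weak_evolution hK V_le V_lip C2_ge0 mu_solution (sphi n) (phi_xE n)
    (phi_tE n)
    (per_phi n) Ac Acl _ (phi_le n) (phi_lip n)) => //.
  - by move=> x s /chiA chi0; rewrite /phi /= chi0 mulr0.
  - by rewrite /c ltrDl.
  - move=> s x sth; have /andP[s1 s2] := sth.
    have e1 : c - t = h by rewrite /c addrC addKr.
    rewrite e1 /phi_t /phi_x /=; set v := V _ _; set u := q _.
    (* The time derivative contributes [- w], which cancels the transport term up to [v - w]. What
       remains is the derivative of [w] along the flow, damped by [c - s <= h], and the slope of the
       cutoff. *)
    have -> : chi n x * (Psi' u * - w x) + v * (Psi u * chi' n x + chi n x *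
      (Psi' u * q_x (x, s))) =
      chi n x * (Psi' u * ((v - w x) + (c - s) * w' x * v)) + v * Psi u * chi'
        n x.
      by rewrite /q_x /=; ring.
    rewrite (le_trans (ler_normD _ _))// lerD//.
      rewrite normrM -[leRHS]mul1r ler_pM// normrM ler_pM//.
      rewrite (le_trans (ler_normD _ _))// lerD//; first exact: wbeta.
      rewrite !normrM ler_pM// ?mulr_ge0//; last exact: V_le.
      rewrite ler_pM// ger0_norm; [rewrite /c; lra|rewrite /c; lra].
    rewrite !normrM ler_pM ?mulr_ge0// ler_pM//; exact: V_le.
have bcl (F : R -> R) M : periodic K F -> continuous F -> (forall x, `|F x| <=
  M) ->
    bounded_continuous (F \o @lift_of R K).
  by move=> pF cF FM; apply: lift_bounded_continuous => //; exists M.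
have cPsi : continuous Psi by exact: Cdir_continuous (sPsi 0).
have cw : continuous w by exact: Cdir_continuous (sw 0).
have cPsiw : continuous (fun x => Psi (x + h * w x)).
  move=> x; apply: (@continuous_comp _ _ _ (fun x => x + h * w x) Psi);
    last exact: cPsi.
  apply: (@continuousD _ _ _ id (cst h \* w)); first exact: cvg_id.
  by apply: continuousM; [exact: cst_continuous|exact: cw].
have pPsiw : periodic K (fun x => Psi (x + h * w x)).
  by move=> x y xy; rewrite (pw _ _ xy); apply: pPsi; exact: covering_shift.
have lim (nu : prob K) s (F : R -> R) : periodic K F -> continuous F -> (forall
  x, `|F x| <= N) ->
    (forall n x, phi n (x, s) = F x * chi n x) ->
    pr nu (fun x => phi n (x, s)) @[n --> \oo] --> pr nu F.
  move=> pF cF FN phiE; apply: (@cvg_pairing _ _ nu (fun n => (fun x => phi n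
    (x, s)) \o @lift_of R K)
    (F \o @lift_of R K) N).
  - move=> n; apply: (bcl (fun x => phi n (x, s)) N) => //.
    by apply: section_continuous; exact: Cdir_continuous (sphi n 0).
  - exact: bcl FN.
  - by move=> n x; exact: phi_le.
  - move=> x; apply: cvg_near_cst; have := chi1 (lift_of x).
    by apply: filterS => n chi_n; rewrite /= phiE chi_n mulr1.
have l1 : pr (mu c) (fun x => phi n (x, c)) @[n --> \oo] --> pr (mu c) Psi.
  apply: lim => // n x; rewrite /phi /q /=; congr (Psi _ * _); ring.
have l2 : pr (mu t) (fun x => phi n (x, t)) @[n --> \oo] --> pr (mu t) (fun x
  => Psi (x + h * w x)).
  apply: lim => // n x; rewrite /phi /q /=; congr (Psi _ * _); rewrite /c; ring.
have l3 : `|pr (mu c) (fun x => phi n (x, c)) - pr (mu t) (fun x => phi n (x,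
  t))|
    @[n --> \oo] --> `|pr (mu c) Psi - pr (mu t) (fun x => Psi (x + h * w x))|.
  by apply: cvg_norm; exact: cvgB.
rewrite -(cvg_lim (@norm_hausdorff _ _) l3); apply: limr_le;
  last by apply: nearW => n; exact: step.
by apply/cvg_ex; exists `|pr (mu c) Psi - pr (mu t) (fun x => Psi (x + h * w
  x))|; exact: l3.
Qed.

End transport.

(** * The Wasserstein distance through lifted functions *)

Section wasserstein.
Context (R : realType) (K : spatial_domain R) (hK : regular_domain K).
Local Notation p := (covering K).

Lemma dW_le (nu1 nu2 : prob K) (d : R) :
  (forall F : R -> R, periodic K F -> (exists M, forall x, `|F x| <= M) ->
    (forall x y, `|F x - F y| <= `|x - y|) -> pr nu2 F - pr nu1 F <= d) ->
  (dW nu1 nu2 <= d%:E)%E.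
Proof.
move=> h; apply: ge_ereal_sup => _ [psi [[cpsi [M psiM]] psi_lip] <-].
rewrite lee_fin.
have prE nu : pairing nu psi = pr nu (psi \o p).
  by rewrite /pr; congr pairing; apply/funext => x /=; rewrite covering_lift.
rewrite !prE; apply: h.
- by move=> a c /= ->.
- by exists M => x /=.
- by move=> x y; rewrite (le_trans (psi_lip _ _))// dom_dist_covering.
Qed.

Lemma lipschitz_bounded_continuous (F : R -> R) (L M : R) : periodic K F ->
  (forall x y, `|F x - F y| <= L * `|x - y|) -> (forall x, `|F x| <= M) ->
  bounded_continuous (F \o @lift_of R K).
Proof.
move=> pF FL FM; apply: lift_bounded_continuous => //; last by exists M.
exact: lipschitz_continuous_real FL.
Qed.

Lemma pr_dist_le (nu : prob K) (F G : R -> R) (c : R) :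
  bounded_continuous (F \o @lift_of R K) ->
  bounded_continuous (G \o @lift_of R K) ->
  (forall x, `|F x - G x| <= c) -> `|pr nu F - pr nu G| <= c.
Proof. by move=> bF bG FG; apply: pairing_dist_le => // x /=. Qed.

End wasserstein.

(** * One Euler step of the solution *)

Section euler.
Context (R : realType) (K : spatial_domain R) (hK : regular_domain K).
Local Notation p := (covering K).
Variables (V : prob K -> K -> R) (C1 C2 C3 : R).
Hypothesis V_le : forall nu x, `|V nu x| <= C1.
Hypothesis V_lip : forall nu x y, `|V nu x - V nu y| <= C2 * dom_dist x y.
Hypothesis V_dW : forall nu1 nu2 x d, (dW nu1 nu2 <= d%:E)%E ->
  `|V nu1 x - V nu2 x| <= C3 * d.
Hypothesis C1_ge0 : 0 <= C1.
Hypothesis C2_ge0 : 0 <= C2.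
Hypothesis C3_ge0 : 0 <= C3.
Variables (mu0 : prob K) (mu : R -> prob K).
Hypothesis mu_solution : measure_valued_solution V mu0 mu.

Variables (B B' : R -> R) (b : R).
Hypothesis B_smooth : smooth_dir [set (1 : R)] B.
Hypothesis B_derive : forall x, is_derive x (1 : R) B (B' x).
Hypothesis b_gt0 : 0 < b.
Hypothesis B'_le : forall x, `|B' x| <= b.
Hypothesis B_itv : forall x, 0 <= B x <= 1.
Hypothesis B_0 : forall x, x <= 3^-1 -> B x = 0.
Hypothesis B_1 : forall x, 2 / 3 <= x -> B x = 1.

Lemma lip_comp_shift (F w : R -> R) (L N h : R) :
  periodic K F -> (forall x, `|F x| <= N) ->
  (forall x y, `|F x - F y| <= L * `|x - y|) ->
  periodic K w -> continuous w ->
  bounded_continuous ((fun x => F (x + h * w x)) \o @lift_of R K).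
Proof.
move=> pF FN FL pw cw; have cF := lipschitz_continuous_real FL.
apply: lift_bounded_continuous => //; last by exists N.
  by move=> x y xy; rewrite (pw _ _ xy); apply: pF; exact: covering_shift.
move=> x; apply: (@continuous_comp _ _ _ (fun x => x + h * w x) F);
  last exact: cF.
apply: (@continuousD _ _ _ id (cst h \* w)); first exact: cvg_id.
by apply: continuousM; [exact: cst_continuous|exact: cw].
Qed.

Lemma transport_step (F w w' : R -> R) (N L Cw C4 beta t h : R) :
  periodic K F -> (forall x, `|F x| <= N) ->
  (forall x y, `|F x - F y| <= L * `|x - y|) ->
  smooth_dir [set (1 : R)] w -> (forall x, is_derive x (1 : R) w (w' x)) ->
  periodic K w -> (forall x, `|w x| <= Cw) -> (forall x, `|w' x| <= C4) ->
  0 <= t -> 0 < h ->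
  (forall s x, t <= s <= t + h -> `|V (mu s) (p x) - w x| <= beta) ->
  `|pr (mu (t + h)) F - pr (mu t) (fun x => F (x + h * w x))| <=
    b * L * (beta + h * C4 * C1) * h.
Proof.
move=> pF FN FL sw dw pw wC w'C t0 h0 wbeta; apply/ler_addgt0Pr => eps eps0.
have N0 : 0 <= N := le_trans (normr_ge0 _) (FN 0).
have L0 : 0 <= L by have := FL 1 0; rewrite subr0 normr1 mulr1; exact: le_trans.
(* [Q] collects the coefficients of [eta]: the cutoff error, and the smoothing error [2 * L] of [F]
   at both ends of the time step. The summand 1 makes it positive. *)
pose Q := C1 * N * h + 4 * L + 1.
have Q0 : 0 < Q by rewrite ltr_wpDl// addr_ge0// !mulr_ge0// ltW.
pose eta := eps / Q; have eta0 : 0 < eta by rewrite divr_gt0.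
have [e [/andP[e0 e_eta] grid]] := grid_subperiod hK eta0.
pose Psi := smooth_interp B e F; pose Psi' := smooth_interp' B' e F.
have sPsi : smooth_dir [set (1 : R)] Psi by exact: smooth_interp_smooth.
have dPsi x : is_derive x (1 : R) Psi (Psi' x) by exact: smooth_interp_derive.
have pPsi : periodic K Psi by exact: periodic_interp.
have PsiN x : `|Psi x| <= N by exact: smooth_interp_bounded.
have Psi'L x : `|Psi' x| <= b * L by exact: smooth_interp'_le.
have PsiF x : `|F x - Psi x| <= 2 * L * eta.
  rewrite distrC (le_trans (smooth_interp_close B_itv e0 FL _))//.
  by rewrite ler_wpM2l ?mulr_ge0// ltW.
have step := transport_step_smooth hK V_le V_lip C2_ge0 mu_solution sPsi dPsi
  pPsi PsiN Psi'L sw dw pw wC w'C t0 h0 eta0 wbeta.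
have cw : continuous w by exact: Cdir_continuous (sw 0).
have Psi_lip := derive_le_lipschitz dPsi Psi'L.
have bF := lipschitz_bounded_continuous hK pF FL FN.
have bPsi := lipschitz_bounded_continuous hK pPsi Psi_lip PsiN.
have bFw := lip_comp_shift h pF FN FL pw cw.
have bPsiw := lip_comp_shift h pPsi PsiN Psi_lip pw cw.
have e1 := pr_dist_le (mu (t + h)) bF bPsi PsiF.
have e2 := pr_dist_le (mu t) bFw bPsiw (fun x => PsiF _).
have Qeta : Q * eta = eps by rewrite /eta mulrC divfK// gt_eqF.
have QE : (C1 * N * h + 4 * L + 1) * eta = eps := Qeta.
move: step e1 e2; set a1 := pr _ Psi; set a2 := pr _ _; set a3 := pr _ F;
  set a4 := pr _ _.
rewrite !ler_norml => /andP[? ?] /andP[? ?] /andP[? ?].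
by apply/andP; split; lra.
Qed.

(** The case of frozen velocity 0, in which the whole of [V], bounded by [C1], counts as velocity
    error. *)
Lemma pr_time_lip (F : R -> R) (N L t h : R) :
  periodic K F -> (forall x, `|F x| <= N) ->
  (forall x y, `|F x - F y| <= L * `|x - y|) -> 0 <= t -> 0 <= h ->
  `|pr (mu (t + h)) F - pr (mu t) F| <= b * L * C1 * h.
Proof.
move=> pF FN FL t0; rewrite le_eqVlt => /predU1P[<-|h0].
  by rewrite addr0 mulr0 subrr normr0.
have s0 : smooth_dir [set (1 : R)] (cst (0 : R)) by move=> n; exact: Cdir_cst.
have d0 x : is_derive x (1 : R) (cst (0 : R)) (cst (0 : R) x) by
    exact: is_derive_cst.
have p0 : periodic K (cst (0 : R)) by [].
have n0 x : `|cst (0 : R) (x : R)| <= 0 :> R by rewrite normr0.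
have beta s x : t <= s <= t + h -> `|V (mu s) (p x) - cst 0 (x : R)| <= C1.
  by move=> _; rewrite subr0.
have := transport_step pF FN FL s0 d0 p0 n0 n0 t0 h0 beta.
have -> : (fun x => F (x + h * cst 0 x)) = F.
  by apply/funext => x; rewrite /= mulr0 addr0.
by rewrite mulr0 mul0r addr0.
Qed.

Lemma dW_time_lip (t h : R) : 0 <= t -> 0 <= h ->
  (dW (mu (t + h)) (mu t) <= (b * C1 * h)%:E)%E.
Proof.
move=> t0 h0; apply: dW_le => // F pF [N FN] FL.
have FL1 x y : `|F x - F y| <= 1 * `|x - y| by rewrite mul1r.
have := pr_time_lip pF FN FL1 t0 h0; rewrite mulr1 distrC.
exact: le_trans (ler_norm _).
Qed.

(** The bound of [transport_step], divided by [L * h ^+ 2], for [w] a smoothing of the velocity at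
    time [t]: [C3 * b * C1] is the change of the velocity in time, [b * C2] the slope of [w]. *)
Definition euler_rate : R := b * (C3 * b * C1 + b * C2 * C1).

Lemma euler_step (F : R -> R) (N L t h : R) :
  periodic K F -> (forall x, `|F x| <= N) ->
  (forall x y, `|F x - F y| <= L * `|x - y|) -> 0 <= t -> 0 < h ->
  `|pr (mu (t + h)) F - pr (mu t) (fun x => F (x + h * V (mu t) (p x)))| <=
    euler_rate * L * h ^+ 2.
Proof.
move=> pF FN FL t0 h0; apply/ler_addgt0Pr => eps eps0.
have L0 : 0 <= L by have := FL 1 0; rewrite subr0 normr1 mulr1; exact: le_trans.
pose v x := V (mu t) (p x).
have pv : periodic K v by move=> x y; rewrite /v => ->.
have vL x y : `|v x - v y| <= C2 * `|x - y| by exact: velocity_lip.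
have cv := lipschitz_continuous_real vL.
(* Replacing [v] by [w] costs [2 * C2 * eta] twice: as a velocity error in [transport_step], with
   factor [b * L * h], and in the argument of [F], with factor [L * h]. *)
pose Q := (b * L + L) * (2 * C2) * h + 1.
have Q0 : 0 < Q by rewrite ltr_wpDl// !mulr_ge0// ?addr_ge0// ?mulr_ge0// ltW.
pose eta := eps / Q; have eta0 : 0 < eta by rewrite divr_gt0.
have [e [/andP[e0 e_eta] grid]] := grid_subperiod hK eta0.
pose w := smooth_interp B e v; pose w' := smooth_interp' B' e v.
have sw : smooth_dir [set (1 : R)] w by exact: smooth_interp_smooth.
have dw x : is_derive x (1 : R) w (w' x) by exact: smooth_interp_derive.
have pw : periodic K w by exact: periodic_interp.
have wC x : `|w x| <= C1 by apply: smooth_interp_bounded => // y; exact: V_le.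
have w'C x : `|w' x| <= b * C2 by exact: smooth_interp'_le.
have vw x : `|v x - w x| <= 2 * C2 * eta.
  rewrite distrC (le_trans (smooth_interp_close B_itv e0 vL _))//.
  by rewrite ler_wpM2l ?mulr_ge0// ltW.
have beta s x : t <= s <= t + h -> `|V (mu s) (p x) - w x| <= C3 * (b * C1 * h)
  + 2 * C2 * eta.
  move=> /andP[ts sth]; rewrite -(subrKA (v x)) (le_trans (ler_normD _ _))//
    lerD//.
  have st0 : 0 <= s - t by rewrite subr_ge0.
  have d1 : (dW (mu s) (mu t) <= (b * C1 * (s - t))%:E)%E.
    by have := dW_time_lip t0 st0; rewrite addrC subrK.
  rewrite (le_trans (V_dW _ d1))// ler_wpM2l// ler_wpM2l ?mulr_ge0//.
    by rewrite ltW.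
  by lra.
have step := transport_step pF FN FL sw dw pw wC w'C t0 h0 beta.
have cw : continuous w by exact: Cdir_continuous (sw 0).
have bFw := lip_comp_shift h pF FN FL pw cw.
have bFv := lip_comp_shift h pF FN FL pv cv.
have e2 : `|pr (mu t) (fun x => F (x + h * w x)) - pr (mu t) (fun x => F (x + h
  * v x))|
    <= L * (h * (2 * C2 * eta)).
  apply: pr_dist_le => // x; rewrite (le_trans (FL _ _))// ler_wpM2l//.
  have -> : x + h * w x - (x + h * v x) = - (h * (v x - w x)) by ring.
  by rewrite normrN normrM (gtr0_norm h0) ler_pM2l.
have Qeta : Q * eta = eps by rewrite /eta mulrC divfK// gt_eqF.
have QE : ((b * L + L) * (2 * C2) * h + 1) * eta = eps := Qeta.
move: step e2; rewrite -/v; set a1 := pr _ F; set a2 := pr _ _;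
  set a3 := pr _ _.
rewrite /euler_rate !ler_norml => /andP[? ?] /andP[? ?].
by apply/andP; split; nra.
Qed.

End euler.

(** * The scheme *)

Section integer_series.
Context (R : realType).

Definition int_of_index (n : nat) : int := if odd n then Negz n./2 else Posz
  n./2.

Lemma int_of_index_bij : set_bij [set: nat] [set: int] int_of_index.
Proof.
split=> //.
  by move=> m n _ _; rewrite /int_of_index; case: ifP; case: ifP; lia.
move=> i _; case: i => n.
  by exists n.*2 => //; rewrite /int_of_index odd_double doubleK.
by exists n.*2.+1 => //; rewrite /int_of_index /= odd_double /= uphalf_double.
Qed.

(** Turns sums over cells into series over [nat], for which summation and integration can be
    exchanged. *)
Lemma esum_int_series (A : set int) (a : int -> \bar R) :
  (forall i, (0 <= a i)%E) ->
  (\esum_(i in A) a i =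
   \sum_(n <oo) (if int_of_index n \in A then a (int_of_index n) else 0))%E.
Proof.
move=> a0; rewrite esum_mkcond (@reindex_esum _ _ _ _ _ int_of_index _
  int_of_index_bij).
by rewrite nneseries_esumT// => n; case: ifP.
Qed.

End integer_series.

(** * Atomic probability measures *)

Section atomic_measures.
Context (R : realType) (K : spatial_domain R) (hK : regular_domain K).
Local Notation p := (covering K).

Lemma measure_prob (m : {measure set (borel K) -> \bar R}) :
  m setT = 1%E -> exists P : prob K, forall A, P A = m A.
Proof.
move=> m1; exists (mnormalize m (point : prob K)) => A.
transitivity (mnormalize m (point : prob K) A) => //.
by rewrite /mnormalize m1 onee_eq0 /= invr1 mule1.
Qed.

(** Discharges the choice made in [as_prob]: once the set function agrees with a measure of total
    mass 1, the default value is excluded. *)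
Lemma as_probE (m : {measure set (borel K) -> \bar R})
    (mf : set (borel K) -> \bar R) :
  (forall A, measurable A -> mf A = m A) -> m setT = 1%E ->
  forall A, measurable A -> as_prob mf A = m A.
Proof.
move=> mfE m1 A mA; have [P PE] := measure_prob m1.
rewrite -mfE//; rewrite /as_prob; move: A mA.
apply: (@getPex _ [set Q : prob K | forall A : set (borel K), measurable A -> Q
  A = mf A]).
by exists P => A mA /=; rewrite PE mfE.
Qed.

Lemma pairing_EFin (nu : prob K) (f : K -> R) : bounded_continuous f ->
  (\int[nu]_(x in [set: borel K]) (f x)%:E = (pairing nu f)%:E)%E.
Proof.
move=> bf; rewrite /pairing /Rintegral fineK//.
by apply: integrable_fin_num => //; exact: bounded_continuous_integrable.
Qed.

Lemma esum_pairing (A : set int) (h : int -> K -> R) (nu : prob K) :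
  (forall i, bounded_continuous (h i)) -> (forall i x, 0 <= h i x) ->
  measurable_fun [set: borel K] (fun x => \esum_(i in A) (h i x)%:E)%E /\
  (\esum_(i in A) (pairing nu (h i))%:E =
   \int[nu]_(x in [set: borel K]) \esum_(i in A) (h i x)%:E)%E.
Proof.
move=> bh h0.
pose g n x : \bar R := (if int_of_index n \in A then (h (int_of_index n) x)%:E
  else 0)%E.
have g0 n x : (0 <= g n x)%E by rewrite /g; case: ifP => // _; rewrite lee_fin.
have mg n : measurable_fun [set: borel K] (g n).
  rewrite /g; case: (_ \in A); last exact: measurable_cst.
  by apply/measurable_EFinP; exact: (continuous_measurable_borel (bh _).1).
have hE : (fun x => \esum_(i in A) (h i x)%:E)%E = (fun x => \sum_(n <oo) g n
  x)%E.
  by apply/funext => x; rewrite esum_int_series// => i; rewrite lee_fin.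
rewrite hE; split.
  have := @ge0_emeasurable_sum _ (borel K) R setT g xpredT.
  by apply=> [n x _ _|n _]; [exact: g0|exact: mg].
rewrite integral_nneseries// esum_int_series; last first.
  by move=> i; rewrite lee_fin; apply: Rintegral_ge0 => x _.
apply: eq_eseriesr => n _; rewrite /g; case: (_ \in A).
  by rewrite pairing_EFin.
by rewrite integral0.
Qed.

Section atomic.
Variables (dx x0 : R) (c : int -> R).
Hypothesis c_ge0 : forall i, 0 <= c i.
Hypothesis c_mass : (\esum_(i in cells K dx) (c i)%:E = 1)%E.
Local Notation node := (node K dx x0).

Let weight (n : nat) : R :=
  if int_of_index n \in cells K dx then c (int_of_index n) else 0.

Let weight_ge0 n : 0 <= weight n. Proof. by rewrite /weight; case: ifP. Qed.

Let term (n : nat) : {measure set (borel K) -> \bar R} :=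
  mscale (NngNum (weight_ge0 n)) (dirac (node (int_of_index n) : borel K)).

Let atoms : {measure set (borel K) -> \bar R} := mseries term 0.

Let atomsE A : atoms A =
  (\esum_(i in cells K dx) ((c i)%:E * \d_(node i : borel K) A))%E.
Proof.
rewrite esum_int_series; last first.
  by move=> i; rewrite mule_ge0 ?lee_fin.
apply: eq_eseriesr => n _; rewrite /term /= /mscale /= /weight.
by case: ifP => // _; rewrite mul0e.
Qed.

Let atomsT : atoms setT = 1%E.
Proof.
rewrite atomsE -c_mass; apply: eq_esum => i _.
by rewrite diracT mule1.
Qed.

Lemma atomic_pairing (f : K -> R) : bounded_continuous f -> (forall x, 0 <= f
  x) ->
  ((pairing (@atomic R K dx x0 c) f)%:E = \esum_(i in cells K dx) (c i * f
    (node i))%:E)%E.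
Proof.
move=> bf f0; rewrite -pairing_EFin//.
rewrite (@eq_measure_integral _ _ _ _ atoms); last first.
  by move=> A mA _; apply: as_probE => //.
have mf : measurable_fun [set: borel K] (EFin \o f).
  by apply/measurable_EFinP; exact: (continuous_measurable_borel bf.1).
rewrite ge0_integral_measure_series//; last by move=> x _; rewrite lee_fin.
rewrite esum_int_series; last by move=> i; rewrite lee_fin mulr_ge0.
apply: eq_eseriesr => n _; rewrite /term ge0_integral_mscale//; last first.
  by move=> x _; rewrite lee_fin.
rewrite integral_dirac// diracT mul1e /= /weight.
by case: ifP => // _; rewrite mul0e.
Qed.

End atomic.

End atomic_measures.

(** * Mass conservation and duality for the scheme *)

Section scheme.
Context (R : realType) (K : spatial_domain R) (hK : regular_domain K).
Local Notation p := (covering K).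
Variables (V : prob K -> K -> R) (C1 C2 : R).
Hypothesis V_le : forall nu x, `|V nu x| <= C1.
Hypothesis V_lip : forall nu x y, `|V nu x - V nu y| <= C2 * dom_dist x y.
Hypothesis C2_ge0 : 0 <= C2.
Variables (mu0 : prob K) (dx dt x0 : R).
Hypothesis dx_mesh : mesh_size K dx.
Hypothesis dx_lt1 : dx < 1.
Hypothesis dt_gt0 : 0 < dt.
Hypothesis CFL : C1 * dt <= dx.
Local Notation node := (node K dx x0).
Local Notation mass := (lf_mass V mu0 dx dt x0).
Local Notation step := (lf_step V mu0 dx dt x0).

Let dx_gt0 : 0 < dx := mesh_size_gt0 hK dx_mesh.

Definition step_velocity n (a : R) : R := V (step n) (p a).

(* Transition operator of the walk that jumps by [dx] or [- dx] with mean
   [dt * step_velocity n]; under the CFL condition it is dual to one step of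
   the scheme. *)
Definition lf_dual n (F : R -> R) (a : R) : R :=
  (1 + dt / dx * step_velocity n a) / 2 * F (a + dx) +
  (1 - dt / dx * step_velocity n a) / 2 * F (a - dx).

Lemma cfl_le nu x : -1 <= dt / dx * V nu x <= 1.
Proof.
rewrite -ler_norml normrM (gtr0_norm (divr_gt0 _ _))// mulrAC ler_pdivrMr//
  mul1r.
apply: le_trans CFL; rewrite mulrC ler_wpM2r ?(ltW dt_gt0)//.
Qed.

Lemma hat_bounded_continuous i : bounded_continuous (@hat R K dx x0 i).
Proof.
split.
  apply: covering_cofinal => //.
  apply: (@lipschitz_continuous_real _ _ dx^-1) => a c /=.
  rewrite /hat; set d1 := dom_dist _ _; set d2 := dom_dist _ _.
  have d12 : `|d1 / dx - d2 / dx| <= dx^-1 * `|a - c|.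
    rewrite -mulrBl normrM mulrC (gtr0_norm (_ : 0 < dx^-1)) ?invr_gt0//.
    rewrite ler_pM2l ?invr_gt0// ler_norml.
    have := dom_dist_covering_lip hK a c (node i).
    have := dom_dist_covering_lip hK c a (node i).
    by rewrite (distrC c) -/d1 -/d2; lra.
  apply: le_trans d12; move: (d1 / dx) (d2 / dx) => y z.
  by rewrite !maxEle; case: ifP; case: ifP; rewrite ?subrr ?normr0 ?normr_ge0//;
    rewrite ?sub0r ?subr0 => *; rewrite ler_norml; have := ler_norm (y - z);
      have := ler_norm (- (y - z)); rewrite normrN; lra.
exists 1 => x; rewrite ger0_norm /hat ?le_max ?lexx// ge_max ler01/= gerBl.
by rewrite divr_ge0 ?(ltW dx_gt0)// dom_dist_ge0.
Qed.

Let hat_ge0 i x : 0 <= @hat R K dx x0 i x.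
Proof. by rewrite /hat le_max lexx. Qed.

Let esum_hat1 x : (\esum_(i in cells K dx) (@hat R K dx x0 i x)%:E = 1)%E.
Proof. exact: esum_hat. Qed.

(** The invariant of the scheme. Nonnegativity and total mass 1 make [atomic] a genuine probability
    measure; [mass_node] is periodicity in the index, which permits shifting sums over the cells of
    the torus. *)
Record mass_spec (c : int -> R) : Prop := MassSpec {
  mass_ge0 : forall i, 0 <= c i;
  mass_node : forall i j, node i = node j -> c i = c j;
  mass_total : (\esum_(i in cells K dx) (c i)%:E = 1)%E }.

(** The total mass is 1 because the hats form a partition of unity and sum and integral can be
    exchanged. *)
Lemma initial_mass : mass_spec (mass 0).
Proof.
split => /=.
- by move=> i; apply: Rintegral_ge0.
- by move=> i j ij; rewrite /hat ij.
- have [_ ->] := esum_pairing (cells K dx) mu0 hat_bounded_continuous hat_ge0.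
  under eq_integral do rewrite esum_hat1.
  by rewrite integral_cst// mul1e; exact: probability_setT.
Qed.

Lemma node_shift i j l : node i = node j -> node (i + l) = node (j + l).
Proof.
move=> ij; have := covering_shift hK (l%:~R * dx) ij.
by rewrite -!addrA -!mulrDl -!intrD.
Qed.

Lemma esum_cells_pred (h : int -> \bar R) :
  (forall i j, node i = node j -> h i = h j) ->
  (\esum_(i in cells K dx) h (i - 1)%R = \esum_(i in cells K dx) h i)%E.
Proof.
move=> hh; rewrite -(@esum_cells_shift _ _ hK dx x0 (fun i => h (i - 1)))//.
  by apply: eq_esum => i _; rewrite addrK.
by move=> i j ij; apply: hh; exact: node_shift.
Qed.

Lemma mass_step_duality n (f : int -> R) : mass_spec (mass n) ->
  (forall i, 0 <= f i) -> (forall i j, node i = node j -> f i = f j) ->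
  (\esum_(i in cells K dx) (mass n.+1 i * f i)%:E =
   \esum_(i in cells K dx) (mass n i *
     ((1 + dt / dx * V (step n) (node i)) / 2 * f (i + 1) +
      (1 - dt / dx * V (step n) (node i)) / 2 * f (i - 1)))%:E)%E.
Proof.
move=> [c0 cn _] f0 fn; set c := mass n in c0 cn *.
pose v i := dt / dx * V (step n) (node i).
have v1 i : -1 <= v i <= 1 by exact: cfl_le.
have vn i j : node i = node j -> v i = v j by rewrite /v => ->.
(* The masses that node [i] sends to the right and to the left. The CFL condition makes them
   nonnegative, so the sums may be split and shifted separately. *)
pose r i := (1 + v i) / 2 * c i; pose l i := (1 - v i) / 2 * c i.
have r0 i : 0 <= r i by rewrite /r mulr_ge0// divr_ge0//; have := v1 i; lra.
have l0 i : 0 <= l i by rewrite /l mulr_ge0// divr_ge0//; have := v1 i; lra.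
have rn i j : node i = node j -> r i = r j by move=> ij;
  rewrite /r (vn _ _ ij) (cn _ _ ij).
have ln i j : node i = node j -> l i = l j by move=> ij;
  rewrite /l (vn _ _ ij) (cn _ _ ij).
have massE i : mass n.+1 i = r (i - 1) + l (i + 1).
  rewrite /= -/c /r /l /v -[atomic _ _ _ _]/(step n).
  by field; rewrite gt_eqF.
transitivity (\esum_(i in cells K dx) ((r (i - 1) * f i)%:E + (l (i + 1) * f
  i)%:E))%E.
  by apply: eq_esum => i _; rewrite massE mulrDl EFinD.
rewrite esumD; [|by move=> *; rewrite lee_fin mulr_ge0..].
have -> : (\esum_(i in cells K dx) (r (i - 1) * f i)%:E =
    \esum_(i in cells K dx) (r i * f (i + 1))%:E)%E.
  rewrite -(esum_cells_pred (h := fun i => (r i * f (i + 1))%:E)).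
    by apply: eq_esum => i _; rewrite subrK.
  by move=> i j ij; rewrite (rn _ _ ij) (fn _ _ (node_shift 1 ij)).
have -> : (\esum_(i in cells K dx) (l (i + 1) * f i)%:E =
    \esum_(i in cells K dx) (l i * f (i - 1))%:E)%E.
  rewrite -(@esum_cells_shift _ _ hK dx x0 (fun i => (l i * f (i - 1))%:E))//.
    by apply: eq_esum => i _; rewrite addrK.
  by move=> i j ij; rewrite (ln _ _ ij) (fn _ _ (node_shift (-1) ij)).
rewrite -esumD; [|by move=> *; rewrite lee_fin mulr_ge0..].
apply: eq_esum => i _; rewrite -EFinD; congr EFin; rewrite /r /l /v.
ring.
Qed.

Lemma mass_specP n : mass_spec (mass n).
Proof.
elim: n => [|n ih]; first exact: initial_mass.
have [c0 cn c1] := ih.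
split.
- move=> i; rewrite /=; set c := mass n in c0 cn c1 *.
  rewrite -[atomic _ _ _ _]/(step n).
  have := cfl_le (step n) (node (i - 1)); have := cfl_le (step n) (node (i +
    1)).
  have := c0 (i - 1); have := c0 (i + 1).
  set v := V _ _; set w := V _ _; move: (c _) (c _) => e a a0 e0.
  have -> : (e + a) / 2 - dt * ((v * a - w * e) / (2 * dx)) =
    ((1 + dt / dx * w) * e + (1 - dt / dx * v) * a) / 2 by field;
      rewrite gt_eqF.
  by move=> *; rewrite divr_ge0// addr_ge0// mulr_ge0//; lra.
- move=> i j ij /=; rewrite (cn _ _ (node_shift (-1) ij)) (cn _ _ (node_shift 1
    ij)).
  by rewrite (node_shift (-1) ij) (node_shift 1 ij).
- transitivity (\esum_(i in cells K dx) (mass n.+1 i * 1)%:E)%E.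
    by apply: eq_esum => i _; rewrite mulr1.
  rewrite (mass_step_duality (f := fun=> 1) ih)//.
  by rewrite -c1; apply: eq_esum => i _; congr EFin; field; rewrite gt_eqF.
Qed.

Lemma step_pairing n (f : K -> R) : bounded_continuous f -> (forall x, 0 <= f
  x) ->
  ((pairing (step n) f)%:E = \esum_(i in cells K dx) (mass n i * f (node
    i))%:E)%E.
Proof.
move=> bf f0; have [c0 _ c1] := mass_specP n.
exact: atomic_pairing.
Qed.

Lemma step_velocity_continuous n : continuous (step_velocity n).
Proof.
by apply: (@lipschitz_continuous_real _ _ C2) => a c;
  exact: (velocity_lip hK V_lip).
Qed.

Lemma lf_dual_periodic n F : periodic K F -> periodic K (lf_dual n F).
Proof.
move=> pF a c ac; rewrite /lf_dual /step_velocity ac.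
by congr (_ * _ + _ * _); apply: pF; exact: covering_shift.
Qed.

Lemma lf_dual_continuous n (F : R -> R) : continuous F -> continuous (lf_dual n
  F).
Proof.
move=> cF.
have cv : continuous (step_velocity n) := @step_velocity_continuous n.
have cs (d : R) : continuous (fun a => F (a + d)).
  move=> a; apply: (@continuous_comp _ _ _ (fun a => a + d) F); last exact: cF.
  by apply: continuousD; [exact: cvg_id|exact: cst_continuous].
pose u (k : R) := cst 2^-1 \+ (cst k \* step_velocity n).
have cu k : continuous (u k).
  move=> a; apply: continuousD; first exact: cst_continuous.
  by apply: continuousM; [exact: cst_continuous|exact: cv].
have -> : lf_dual n F = (u (dt / dx / 2) \* (fun a => F (a + dx))) \+
    (u (- (dt / dx / 2)) \* (fun a => F (a - dx))).
  by apply/funext => a; rewrite /lf_dual /u /=; field; rewrite gt_eqF.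
move=> a; apply: continuousD; apply: continuousM;
  [exact: cu|exact: cs|exact: cu|exact: cs].
Qed.

Lemma lf_dual_le n F G : (forall x, F x <= G x) ->
  forall x, lf_dual n F x <= lf_dual n G x.
Proof.
move=> FG x; rewrite /lf_dual /step_velocity.
have := cfl_le (step n) (p x) => /andP[h1 h2].
by rewrite lerD// ler_wpM2l// divr_ge0//; lra.
Qed.

Lemma lf_dual_affine n F (k c : R) x :
  lf_dual n (fun y => k * F y + c) x = k * lf_dual n F x + c.
Proof. by rewrite /lf_dual; field; rewrite gt_eqF. Qed.

Lemma lf_dual_bounded n F M : (forall x, `|F x| <= M) ->
  forall x, `|lf_dual n F x| <= M.
Proof.
move=> FM x; rewrite /lf_dual /step_velocity.
have := cfl_le (step n) (p x); have := FM (x + dx); have := FM (x - dx).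
move: (F _) (F _) (dt / dx * _) => u v w.
rewrite !ler_norml => /andP[? ?] /andP[? ?] /andP[? ?].
by apply/andP; split; nra.
Qed.

Lemma bounded_periodic_bc F M : periodic K F -> continuous F ->
  (forall x, `|F x| <= M) -> bounded_continuous (F \o @lift_of R K).
Proof. by move=> pF cF FM; apply: lift_bounded_continuous => //; exists M. Qed.

Lemma pr_shift (nu : prob K) F M (c : R) : periodic K F -> continuous F ->
  (forall x, `|F x| <= M) -> pr nu (fun x => F x + c) = pr nu F + c.
Proof.
move=> pF cF FM; rewrite -[in RHS](pairing_cst nu c) /pr -pairingD//.
  exact: bounded_periodic_bc FM.
exact: bounded_continuous_cst.
Qed.

Lemma step_duality n F M : periodic K F -> continuous F ->
  (forall x, `|F x| <= M) -> pr (step n.+1) F = pr (step n) (lf_dual n F).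
Proof.
move=> pF cF FM.
(* Sums over cells are handled for nonnegative terms. A bounded [F] is reduced to [F + M], which
   explains the bound [M + M]; both sides change by [M] because the weights of [lf_dual] add up to
   1. *)
have nonneg (G : R -> R) : periodic K G -> continuous G -> (forall x, `|G x| <=
  M + M) ->
    (forall x, 0 <= G x) -> pr (step n.+1) G = pr (step n) (lf_dual n G).
  move=> pG cG GM G0.
  have pL := lf_dual_periodic n pG; have cL := @lf_dual_continuous n _ cG.
  have L0 x : 0 <= lf_dual n G x.
    have := lf_dual_affine n G 0 0 x; rewrite mul0r addr0 => <-.
    by apply: lf_dual_le => y; rewrite mul0r addr0.
  apply: EFin_inj; rewrite /pr !step_pairing//.
  - rewrite (mass_step_duality (f := fun i => (G \o @lift_of R K) (node i))
      (mass_specP n))//=.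
      apply: eq_esum => i _; congr (_ * _)%:E.
      rewrite !(periodic_lift hK _ pG) (periodic_lift hK _ pL) /lf_dual
        /step_velocity.
      have -> : x0 + (i + 1)%:~R * dx = x0 + i%:~R * dx + dx by rewrite intrD;
        ring.
      by have -> : x0 + (i - 1)%:~R * dx = x0 + i%:~R * dx - dx by rewrite
        intrB; ring.
    by move=> i j ->.
  - by apply: (bounded_periodic_bc pL cL) => x; exact: (lf_dual_bounded n GM).
  - by move=> x /=.
  - exact: (bounded_periodic_bc pG cG GM).
  - by move=> x /=.
have M0 : 0 <= M := le_trans (normr_ge0 _) (FM 0).
have := nonneg (fun x => F x + M).
have -> : lf_dual n (fun x => F x + M) = (fun x => lf_dual n F x + M).
  apply/funext => x; have := lf_dual_affine n F 1 M x; rewrite mul1r => <-.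
  by congr lf_dual; apply/funext => y; rewrite mul1r.
rewrite (pr_shift _ M pF cF FM).
rewrite (pr_shift _ M (lf_dual_periodic n pF) (@lf_dual_continuous n _ cF)
  (lf_dual_bounded n FM)).
move=> h; apply: (@addIr _ M); apply: h.
- by move=> x y xy; rewrite (pF _ _ xy).
- by move=> x; apply: continuousD; [exact: cF|exact: cst_continuous].
- by move=> x; rewrite (le_trans (ler_normD _ _))// lerD// ger0_norm.
- by move=> x; have := FM x; rewrite ler_norml; lra.
Qed.

(** A hat lives within [dx] of its node, so the interpolant [H] with the nodal values of the
    function stays within [L * dx] of it, and [pr (step 0)] is the integral of [H]. *)
Lemma initial_error F L M : periodic K F -> (forall x, `|F x| <= M) ->
  (forall x y, `|F x - F y| <= L * `|x - y|) ->
  `|pr (step 0) F - pr mu0 F| <= L * dx.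
Proof.
move=> pF FM FL; have cF := lipschitz_continuous_real FL.
have L0 : 0 <= L by have := FL 1 0; rewrite subr0 normr1 mulr1; exact: le_trans.
have nonneg (G : R -> R) : periodic K G -> (forall x, `|G x| <= M + M) ->
    (forall x y, `|G x - G y| <= L * `|x - y|) -> (forall x, 0 <= G x) ->
    `|pr (step 0) G - pr mu0 G| <= L * dx.
  move=> pG GM GL G0; have cG := lipschitz_continuous_real GL.
  pose g : K -> R := G \o @lift_of R K.
  have bg : bounded_continuous g by exact: bounded_periodic_bc GM.
  have g0 x : 0 <= g x by exact: G0.
  have hat_near i x : `|@hat R K dx x0 i x * (g x - g (node i))| <= @hat R K dx
    x0 i x * (L * dx).
    rewrite normrM ger0_norm ?hat_ge0//.
    have [hx|hx] := leP dx (dom_dist x (node i)).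
      rewrite /hat max_l ?mul0r// subr_le0 ler_pdivlMr// mul1r//.
    (* The node is replaced by a representative within [dx] of the lift of [x], which gives access
       to the Lipschitz bound on [R]. *)
    rewrite ler_wpM2l//; move: hx; rewrite -{1}(covering_lift hK x).
    move=> /(dom_dist_attained hK)[a' ea' le_a'].
    rewrite /g /= -ea' (periodic_lift hK _ pG).
    by rewrite (le_trans (GL _ _))// ler_wpM2l.
  have bh i : bounded_continuous (fun x => @hat R K dx x0 i x * g (node i)).
    apply: (bounded_continuousM (hat_bounded_continuous i)).
    exact: bounded_continuous_cst.
  have h0 i x : 0 <= @hat R K dx x0 i x * g (node i) by rewrite mulr_ge0.
  have [mH eH] := esum_pairing (cells K dx) mu0 bh h0.
  set H := (fun x : K => _) in mH eH.
  have H0 x : (0 <= H x)%E by apply: esum_ge0 => i _; rewrite lee_fin.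
  have prE : (pr (step 0) G)%:E = (\int[mu0]_(x in [set: borel K]) H x)%E.
    rewrite -eH /pr step_pairing//; apply: eq_esum => i _.
    congr EFin; rewrite mulrC -pairingZ ?hat_bounded_continuous//.
      by congr pairing; apply/funext => x; rewrite mulrC.
    exact: hat_bounded_continuous.
  have sum_hat x (k : R) : 0 <= k ->
      (\esum_(i in cells K dx) (@hat R K dx x0 i x * k)%:E = k%:E)%E.
    move=> k0; rewrite -[RHS]mule1 -(esum_hat1 x).
    rewrite !esum_int_series; [|by move=> i; rewrite lee_fin ?mulr_ge0..].
    rewrite -nneseriesZl; last by move=> j _; case: ifP; rewrite // lee_fin.
    by apply: eq_eseriesr => j _; case: ifP; rewrite ?mule0// -EFinM mulrC.
  have H_le x : (H x <= (g x + L * dx)%:E)%E.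
    rewrite -(sum_hat x) ?addr_ge0 ?mulr_ge0 ?(ltW dx_gt0)//.
    apply: le_esum => i _; rewrite lee_fin mulrDr.
    have := hat_near i x; rewrite ler_norml mulrBr; lra.
  have H_ge x : ((g x)%:E <= H x + (L * dx)%:E)%E.
    rewrite -(sum_hat x (g x))// -(sum_hat x (L * dx)) ?mulr_ge0 ?(ltW
      dx_gt0)//.
    rewrite -esumD; last 2 first.
      by move=> i _; rewrite lee_fin.
      by move=> i _; rewrite lee_fin !mulr_ge0// ltW.
    apply: le_esum => i _; rewrite -EFinD lee_fin.
    have := hat_near i x; rewrite ler_norml mulrBr; lra.
  have Ldx0 : 0 <= L * dx by rewrite mulr_ge0// ltW.
  have mg : measurable_fun [set: borel K] (EFin \o g).
    by apply/measurable_EFinP; exact: (continuous_measurable_borel bg.1).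
  have bgL : bounded_continuous (fun x => g x + L * dx).
    exact: (bounded_continuousD bg (@bounded_continuous_cst _ K (L * dx))).
  have prgL : pairing mu0 (fun x => g x + L * dx) = pairing mu0 g + L * dx.
    by rewrite -[in RHS](pairing_cst mu0 (L * dx)) -pairingD//;
      exact: bounded_continuous_cst.
  rewrite ler_norml; apply/andP; split.
    suff : ((pairing mu0 g)%:E <= (pr (step 0) G + L * dx)%:E)%E by rewrite
      lee_fin /g /pr; lra.
    rewrite EFinD prE -pairing_EFin//.
    have -> : ((L * dx)%:E = \int[mu0]_(x in [set: borel K]) (L * dx)%:E)%E.
      by rewrite pairing_EFin ?pairing_cst//; exact: bounded_continuous_cst.
    rewrite -ge0_integralD//.
    apply: ge0_le_integral => //.
    - by move=> x _; rewrite lee_fin.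
    - exact: emeasurable_funD.
  suff : ((pr (step 0) G)%:E <= (pairing mu0 g + L * dx)%:E)%E by rewrite
    lee_fin /g /pr; lra.
  rewrite prE -prgL -pairing_EFin//; apply: ge0_le_integral => //.
  by apply/measurable_EFinP; exact: (continuous_measurable_borel bgL.1).
have M0 : 0 <= M := le_trans (normr_ge0 _) (FM 0).
have := nonneg (fun x => F x + M).
rewrite !(pr_shift _ M pF cF FM) opprD addrACA subrr addr0; apply.
- by move=> x y xy; rewrite (pF _ _ xy).
- by move=> x; rewrite (le_trans (ler_normD _ _))// lerD// ger0_norm.
- by move=> x y; rewrite opprD addrACA subrr addr0.
- by move=> x; have := FM x; rewrite ler_norml; lra.
Qed.

End scheme.

(** * Error estimate *)

Section mixture.
Context (R : realType) (K : spatial_domain R).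

Lemma mixture_pairing (P Q : prob K) (a c : R) (f : K -> R) :
  0 <= a -> 0 <= c -> a + c = 1 -> bounded_continuous f ->
  pairing (as_prob (fun A => (a%:E * P A + c%:E * Q A)%E)) f =
  a * pairing P f + c * pairing Q f.
Proof.
move=> a0 c0 ac1 bf.
pose m : {measure set (borel K) -> \bar R} :=
  measure_add (mscale (NngNum a0) P) (mscale (NngNum c0) Q).
have mE A : (a%:E * P A + c%:E * Q A)%E = m A.
  exact: (esym (measure_addE (mscale (NngNum a0) P) (mscale (NngNum c0) Q) A)).
have mT : m setT = 1%E.
  rewrite -mE -(_ : (1 : R)%:E = 1%E)// -ac1 EFinD.
  by congr (_ + _)%E; rewrite -[RHS]mule1; congr (_ * _)%E;
    exact: probability_setT.
have nonneg (g : K -> R) : bounded_continuous g -> (forall x, 0 <= g x) ->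
    pairing (as_prob (fun A => (a%:E * P A + c%:E * Q A)%E)) g =
    a * pairing P g + c * pairing Q g.
  move=> bg g0; apply: EFin_inj; rewrite -pairing_EFin//.
  rewrite (@eq_measure_integral _ _ _ _ m); last first.
    by move=> A mA _; apply: (as_probE _ mT mA) => B _; exact: mE.
  have mg : measurable_fun [set: borel K] (EFin \o g).
    by apply/measurable_EFinP; exact: (continuous_measurable_borel bg.1).
  have g0' (x : borel K) : setT x -> (0 <= (g x)%:E)%E by rewrite lee_fin.
  rewrite ge0_integral_measure_add// !ge0_integral_mscale//=.
  by rewrite !pairing_EFin// EFinD !EFinM.
have [_ [M fM]] := bf.
have bM : bounded_continuous (cst M : K -> R) by exact: bounded_continuous_cst.
have := nonneg (f \+ cst M) (bounded_continuousD bf bM) _.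
rewrite !pairingD// !pairing_cst => h.
apply: (@addIr _ M); rewrite h => [|x]; last first.
  by rewrite /=; have := fM x; rewrite ler_norml; lra.
by rewrite !mulrDr addrACA -mulrDl ac1 mul1r.
Qed.

End mixture.

(** * The walk compared with the Euler trajectory *)

Section error_estimate.
Context (R : realType) (K : spatial_domain R) (hK : regular_domain K).
Local Notation p := (covering K).
Variables (V : prob K -> K -> R) (C1 C2 C3 : R).
Hypothesis V_le : forall nu x, `|V nu x| <= C1.
Hypothesis V_lip : forall nu x y, `|V nu x - V nu y| <= C2 * dom_dist x y.
Hypothesis V_dW : forall nu1 nu2 x d, (dW nu1 nu2 <= d%:E)%E ->
  `|V nu1 x - V nu2 x| <= C3 * d.
Hypothesis C1_gt0 : 0 < C1.
Hypothesis C2_ge0 : 0 <= C2.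
Variables (mu0 : prob K) (mu : R -> prob K).
Hypothesis mu_start : forall F, pr (mu 0) F = pr mu0 F.

Variable rate : R.
Hypothesis rate_ge0 : 0 <= rate.
Hypothesis mu_step : forall (F : R -> R) (N L t h : R),
  periodic K F -> (forall x, `|F x| <= N) ->
  (forall x y, `|F x - F y| <= L * `|x - y|) -> 0 <= t -> 0 < h ->
  `|pr (mu (t + h)) F - pr (mu t) (fun x => F (x + h * V (mu t) (p x)))| <=
    rate * L * h ^+ 2.

Variables (dx dt x0 : R).
Hypothesis dx_mesh : mesh_size K dx.
Hypothesis dx_lt1 : dx < 1.
Hypothesis dt_gt0 : 0 < dt.
Hypothesis CFL : C1 * dt <= dx.
Local Notation step := (lf_step V mu0 dx dt x0).
Local Notation dual := (lf_dual V mu0 dx dt x0).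

Let dx_gt0 : 0 < dx := mesh_size_gt0 hK dx_mesh.

Definition exact_velocity n (a : R) : R := V (mu (n%:R * dt)) (p a).

Definition euler_dual n (F : R -> R) (a : R) : R :=
  F (a + dt * exact_velocity n a).

Fixpoint euler (x : R) (n : nat) : R :=
  if n is m.+1 then euler x m + dt * exact_velocity m (euler x m) else x.

(** The composition [op 0 (op 1 (... (op n.-1 F)))]. For the walk operators its value at [x] is the
    expectation of [F] after [n] steps of the walk started at [x]. *)
Fixpoint backward (op : nat -> (R -> R) -> R -> R) (n : nat) (F : R -> R) :=
  if n is m.+1 then backward op m (op m F) else F.

Lemma exact_velocity_lip n a c :
  `|exact_velocity n a - exact_velocity n c| <= C2 * `|a - c|.
Proof. exact: (velocity_lip hK V_lip). Qed.

Lemma backward_dual_spec n F M : periodic K F -> continuous F ->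
  (forall x, `|F x| <= M) ->
  [/\ periodic K (backward dual n F), continuous (backward dual n F),
      forall x, `|backward dual n F x| <= M &
      pr (step n) F = pr (step 0) (backward dual n F)].
Proof.
elim: n F => [|n ih] F pF cF FM //=.
have [||| p1 c1 b1 e1] := ih (dual n F).
- exact: lf_dual_periodic.
- exact: (lf_dual_continuous hK V_lip).
- exact: (lf_dual_bounded hK V_le).
by split => //; rewrite -e1; exact: (step_duality hK V_le V_lip C2_ge0 mu0 x0
  dx_mesh dx_lt1 dt_gt0 CFL n pF cF FM).
Qed.

Lemma backward_dual_le n F G : (forall x, F x <= G x) ->
  forall x, backward dual n F x <= backward dual n G x.
Proof.
elim: n F G => [|n ih] F G FG //= x.
by apply: ih => y; exact: (lf_dual_le hK V_le).
Qed.

Lemma backward_dual_affine n F (k c : R) x :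
  backward dual n (fun y => k * F y + c) x = k * backward dual n F x + c.
Proof.
elim: n F => [|n ih] F //=; rewrite -ih; congr (backward _ _ _ _).
by apply/funext => y; rewrite (lf_dual_affine hK).
Qed.

Lemma backward_eulerE n F x : backward euler_dual n F x = F (euler x n).
Proof. by elim: n F => [|n ih] F //=; rewrite ih. Qed.

Lemma euler_dual_spec n F L N : periodic K F -> (forall x, `|F x| <= N) ->
  (forall x y, `|F x - F y| <= L * `|x - y|) ->
  [/\ periodic K (euler_dual n F), forall x, `|euler_dual n F x| <= N &
      forall x y, `|euler_dual n F x - euler_dual n F y| <=
        L * (1 + C2 * dt) * `|x - y|].
Proof.
move=> pF FN FL; split => //.
- move=> x y xy; rewrite /euler_dual /exact_velocity xy; apply: pF.
  exact: covering_shift.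
- by move=> x; exact: FN.
- move=> x y; rewrite /euler_dual (le_trans (FL _ _))// -mulrA.
  have L0 : 0 <= L by have := FL 1 0; rewrite subr0 normr1 mulr1;
    exact: le_trans.
  rewrite ler_wpM2l// opprD addrACA -mulrBr (le_trans (ler_normD _ _))//.
  rewrite mulrDl mul1r lerD2l normrM (gtr0_norm dt_gt0).
  by rewrite (mulrC C2) -mulrA ler_pM2l// exact_velocity_lip.
Qed.

(** Telescoping: each of the [n] steps costs [rate * dt ^+ 2] times the Lipschitz constant of the
    function carried back so far, which grows by [1 + C2 * dt] per step and is bounded by its final
    value. *)
Lemma backward_euler_spec n F L N : periodic K F -> (forall x, `|F x| <= N) ->
  (forall x y, `|F x - F y| <= L * `|x - y|) ->
  [/\ periodic K (backward euler_dual n F),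
      forall x, `|backward euler_dual n F x| <= N,
      forall x y, `|backward euler_dual n F x - backward euler_dual n F y| <=
        L * (1 + C2 * dt) ^+ n * `|x - y| &
      `|pr (mu (n%:R * dt)) F - pr mu0 (backward euler_dual n F)| <=
        rate * L * n%:R * (1 + C2 * dt) ^+ n * dt ^+ 2].
Proof.
elim: n F L => [|n ih] F L pF FN FL.
  split=> //; first by move=> x y; rewrite expr0 mulr1.
  by rewrite mul0r mu_start subrr normr0 mulr0 !mul0r.
have [p1 b1 l1] := euler_dual_spec n pF FN FL.
have [p2 b2 l2 e2] := ih _ _ p1 b1 l1.
have L0 : 0 <= L by have := FL 1 0; rewrite subr0 normr1 mulr1; exact: le_trans.
split=> //=; first by move=> x y; rewrite exprS mulrA.
have ndt : 0 <= n%:R * dt by rewrite mulr_ge0// ltW.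
have := mu_step pF FN FL ndt dt_gt0; rewrite -[fun x => F _]/(euler_dual n F).
have -> : n%:R * dt + dt = n.+1%:R * dt by rewrite -natr1 mulrDl mul1r.
move=> e1; rewrite -(subrKA (pr (mu (n%:R * dt)) (euler_dual n F))).
rewrite (le_trans (ler_normD _ _))// (le_trans (lerD e1 e2))//.
set q := 1 + C2 * dt.
have q1 : 1 <= q by rewrite lerDl mulr_ge0// ltW.
have qn : 1 <= q ^+ n.+1 by exact: exprn_ege1.
rewrite (_ : rate * (L * q) * n%:R * q ^+ n = rate * L * n%:R * q ^+ n.+1);
  last by rewrite exprS; ring.
rewrite -natr1 -mulrDl ler_wpM2r ?sqr_ge0//.
rewrite (_ : rate * L * (n%:R + 1) * q ^+ n.+1 = rate * L * n%:R * q ^+ n.+1 +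
  rate * L * q ^+ n.+1); last by ring.
by rewrite addrC lerD2l ler_peMr// mulr_ge0.
Qed.

(** Since the mean jump is [dt * w], expanding the square leaves [2 * dt * (z - y) * (w - v)] as the
    only term of first order. There [|w - v| <= C3 * d + C2 * |z - y|], and Young's inequality on
    the product with [C3 * d] produces [2 * C2 + 1]. The jump variance [dx ^+ 2] and the terms
    quadratic in [dt] make up [4 * dx ^+ 2]. *)
Lemma dual_square n (d y z : R) :
  (forall a, `|step_velocity V mu0 dx dt x0 n a - exact_velocity n a| <= C3 *
    d) ->
  dual n (fun z' => (z' - (y + dt * exact_velocity n y)) ^+ 2) z <=
  (1 + (2 * C2 + 1) * dt) * (z - y) ^+ 2 + (dt * (C3 * d) ^+ 2 + 4 * dx ^+ 2).
Proof.
move=> wv; rewrite /lf_dual; set w := step_velocity _ _ _ _ _ _ _;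
  set v := exact_velocity _ _.
have -> : (1 + dt / dx * w) / 2 * (z + dx - (y + dt * v)) ^+ 2 +
    (1 - dt / dx * w) / 2 * (z - dx - (y + dt * v)) ^+ 2 =
    (z - y) ^+ 2 + dt * (2 * (z - y) * (w - v)) + dx ^+ 2
     + ((dt * v) ^+ 2 - 2 * (dt * v) * (dt * w)).
  by field; rewrite gt_eqF.
have dtv nu x : `|dt * V nu x| <= dx.
  by rewrite normrM (gtr0_norm dt_gt0) (le_trans _ CFL)// mulrC ler_wpM2r// ltW.
have h1 : (dt * v) ^+ 2 - 2 * (dt * v) * (dt * w) <= 3 * dx ^+ 2.
  have := dtv (mu (n%:R * dt)) (p y); have := dtv (step n) (p z).
  rewrite -/(step_velocity V mu0 dx dt x0 n z) -/w -/(exact_velocity n y) -/v.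
  move: (dt * v) (dt * w) => q1 q2; rewrite !ler_norml => /andP[? ?] /andP[? ?].
  by nra.
have h2 : 2 * (z - y) * (w - v) <= (2 * C2 + 1) * (z - y) ^+ 2 + (C3 * d) ^+ 2.
  have wz := wv z; have vy := exact_velocity_lip n z y.
  have wv' : `|w - v| <= C3 * d + C2 * `|z - y|.
    rewrite -(subrKA (exact_velocity n z)) (le_trans (ler_normD _ _))// lerD//.
  have C3d : 0 <= C3 * d := le_trans (normr_ge0 _) wz.
  apply: (@le_trans _ _ (2 * `|z - y| * (C3 * d + C2 * `|z - y|))).
    rewrite (le_trans (ler_norm _))// !normrM (ger0_norm (_ : 0 <= 2))//.
    by rewrite ler_wpM2l ?mulr_ge0.
  rewrite -[in leRHS](real_normK (num_real (z - y))).
  by have := sqr_ge0 (`|z - y| - C3 * d); nra.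
have := ler_wpM2l (ltW dt_gt0) h2; lra.
Qed.

Section moments.
Variables (x : R) (sigma d : nat -> R) (N : nat).
Hypothesis sigma0 : 0 <= sigma 0.
Hypothesis sigmaS : forall n, (n < N)%N ->
  (1 + (2 * C2 + 1) * dt) * sigma n + (dt * (C3 * d n) ^+ 2 + 4 * dx ^+ 2)
    <= sigma n.+1.
Hypothesis velocity_close : forall n a, (n < N)%N ->
  `|step_velocity V mu0 dx dt x0 n a - exact_velocity n a| <= C3 * d n.

(** The innermost operator acts first and turns the square at time [n + 1] into an affine function
    of the square at time [n]. Monotonicity and affinity of the remaining operators then give the
    recursion for [sigma]. *)
Lemma backward_square n : (n <= N)%N ->
  backward dual n (fun z => (z - euler x n) ^+ 2) x <= sigma n.
Proof.
elim: n => [|n ih] nN /=; first by rewrite subrr expr0n.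
apply: le_trans (sigmaS nN).
have sqz z := @dual_square n (d n) (euler x n) z (fun a => velocity_close a nN).
apply: (le_trans (@backward_dual_le n _ _ sqz x)).
rewrite backward_dual_affine lerD2r ler_wpM2l//; last by rewrite ih// ltnW.
by rewrite addr_ge0// mulr_ge0 ?(ltW dt_gt0)// addr_ge0// mulr_ge0.
Qed.

Lemma backward_dual_euler (rho : R) F : 0 < rho -> sigma N = rho ^+ 2 ->
  (forall a c, `|F a - F c| <= `|a - c|) ->
  `|backward dual N F x - F (euler x N)| <= rho.
Proof.
move=> rho0 sigmaN FL; have sq := backward_square (leqnn N).
(* Young's inequality turns the mean square bound into a Lipschitz bound. *)
have young z : `|F z - F (euler x N)| <= (2 * rho)^-1 * (z - euler x N) ^+ 2 +
  rho / 2.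
  rewrite (le_trans (FL _ _))// -real_normK ?num_real//.
  move: (normr_ge0 (z - euler x N)); set u := `|_| => u0.
  rewrite -subr_ge0.
  have -> : (2 * rho)^-1 * u ^+ 2 + rho / 2 - u = (2 * rho)^-1 * (u - rho) ^+ 2.
    by field; rewrite gt_eqF.
  by rewrite mulr_ge0 ?sqr_ge0// invr_ge0 mulr_ge0// ltW.
(* The weights are balanced so that the quadratic part, too, is at most [rho / 2] when the mean
   square is at most [rho ^+ 2]. *)
have half : (2 * rho)^-1 * backward dual N (fun z => (z - euler x N) ^+ 2) x <=
  rho / 2.
  apply: (@le_trans _ _ ((2 * rho)^-1 * rho ^+ 2)).
    by rewrite ler_wpM2l -?sigmaN// invr_ge0 mulr_ge0// ltW.
  by rewrite le_eqVlt; apply/orP; left; apply/eqP; field; rewrite gt_eqF.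
have up : backward dual N F x <= F (euler x N) + rho.
  have := @backward_dual_le N F
    (fun z => (2 * rho)^-1 * (z - euler x N) ^+ 2 + (rho / 2 + F (euler x N))).
  move=> /(_ _ x) h; apply: le_trans (h _) _.
    by move=> z; have := young z; rewrite ler_norml; lra.
  by rewrite backward_dual_affine; lra.
have lo : F (euler x N) - rho <= backward dual N F x.
  have h1 := @backward_dual_le N
    (fun z => - (2 * rho)^-1 * (z - euler x N) ^+ 2 + (F (euler x N) - rho /
      2)) F.
  have {}h1 := h1 _ x; apply: le_trans (h1 _).
    by rewrite backward_dual_affine mulNr; lra.
  by move=> z; have := young z; rewrite ler_norml mulNr; lra.
by rewrite ler_norml; apply/andP; split; lra.
Qed.

End moments.

Variables (lambda0 T : R).
Hypothesis lambda0_gt0 : 0 < lambda0.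
Hypothesis lambda0_le : lambda0 * dx <= dt.
Hypothesis T_ge0 : 0 <= T.

(** The exponential bounds the growth of Lipschitz constants. The 1 stands for the initial
    projection and [rate * T / C1] for the Euler errors, in which one factor [dt] is bounded by
    [dx / C1]. *)
Definition consistency : R := expR (C2 * T) * (1 + rate * T / C1).
(** The terms are those of the recursion in [dual_square] for [d_n = (1 + consistency) * rho n];
    [4 / lambda0] absorbs the variance through [dx <= dt / lambda0]. *)
Definition growth : R :=
  2 * C2 + 1 + (C3 * (1 + consistency)) ^+ 2 + 4 / lambda0.

(** The walk and the trajectory start at the same point, yet [sigma] starts at [dx]: this makes
    [rho] positive, lets [4 * dx ^+ 2] be a multiple of [dt * sigma n], and gives [dx <= rho n]. *)
Let sigma n : R := dx * (1 + growth * dt) ^+ n.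
Let rho n : R := Num.sqrt (sigma n).

Lemma consistency_ge0 : 0 <= consistency.
Proof.
rewrite mulr_ge0 ?expR_ge0// addr_ge0// divr_ge0 ?(ltW C1_gt0)//.
exact: mulr_ge0.
Qed.

Lemma growth_ge0 : 0 <= growth.
Proof.
rewrite /growth addr_ge0 ?divr_ge0 ?(ltW lambda0_gt0)// addr_ge0 ?sqr_ge0//.
by rewrite addr_ge0// mulr_ge0.
Qed.

Let sigma_ge n : dx <= sigma n.
Proof.
by rewrite /sigma ler_peMr ?(ltW dx_gt0)// exprn_ege1// lerDl mulr_ge0
  ?growth_ge0// ltW.
Qed.

Let sigma_gt0 n : 0 < sigma n. Proof. exact: lt_le_trans (sigma_ge n). Qed.

Let rho_gt0 n : 0 < rho n. Proof. by rewrite sqrtr_gt0. Qed.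

Let rho_sqr n : rho n ^+ 2 = sigma n. Proof. by rewrite sqr_sqrtr// ltW. Qed.

Let dx_le_rho n : dx <= rho n.
Proof.
rewrite -(ler_sqr (ltW dx_gt0) (ltW (rho_gt0 n))) rho_sqr (le_trans _ (sigma_ge
  n))//.
by rewrite expr2 ler_piMl// ltW.
Qed.

Let sigma_step n :
  (1 + (2 * C2 + 1) * dt) * sigma n +
    (dt * (C3 * ((1 + consistency) * rho n)) ^+ 2 + 4 * dx ^+ 2) <= sigma n.+1.
Proof.
have e : sigma n.+1 = sigma n + growth * dt * sigma n.
  by rewrite /sigma exprS; ring.
have h : 4 * dx ^+ 2 <= 4 / lambda0 * dt * sigma n.
  have h1 : dx <= dt / lambda0 by rewrite ler_pdivlMr// mulrC.
  have h2 : dx ^+ 2 <= dt / lambda0 * sigma n.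
    by rewrite expr2 ler_pM// ltW.
  have -> : 4 / lambda0 * dt * sigma n = 4 * (dt / lambda0 * sigma n) by ring.
  by rewrite ler_pM2l.
rewrite e /growth mulrA exprMn rho_sqr.
have -> : (2 * C2 + 1 + (C3 * (1 + consistency)) ^+ 2 + 4 / lambda0) * dt *
  sigma n =
  (2 * C2 + 1) * dt * sigma n + dt * ((C3 * (1 + consistency)) ^+ 2 * sigma n)
  + 4 / lambda0 * dt * sigma n by ring.
rewrite mulrDl mul1r; lra.
Qed.

Lemma compound_le (k : R) n : 0 <= k -> n%:R * dt <= T ->
  (1 + k * dt) ^+ n <= expR (k * T).
Proof.
move=> k0 ndt; apply: (@le_trans _ _ (expR (k * dt) ^+ n)).
  rewrite lerXn2r// ?nnegrE ?expR_ge0 ?expR_ge1Dx//.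
  by rewrite addr_ge0// mulr_ge0// ltW.
by rewrite -expRM_natr ler_expR -mulrA ler_wpM2l// mulrC.
Qed.

(** The velocities up to step [n] involve the distances at earlier times only, so the strong
    induction provides [close]. Three errors add up: walk against Euler trajectory, projection of
    the initial datum, and Euler steps against the solution. *)
Lemma lf_step_error n : n%:R * dt <= T ->
  (dW (step n) (mu (n%:R * dt)) <= ((1 + consistency) * rho n)%:E)%E.
Proof.
elim/ltn_ind: n => n ih ndt.
apply: dW_le => // F pF [M FM] FL.
have FL1 a c : `|F a - F c| <= 1 * `|a - c| by rewrite mul1r.
have cF := lipschitz_continuous_real FL1.
have [pP cP PM eP] := backward_dual_spec n pF cF FM.
have [pE EM El eE] := backward_euler_spec n pF FM FL1.
have close m a : (m < n)%N ->
    `|step_velocity V mu0 dx dt x0 m a - exact_velocity m a| <= C3 * ((1 +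
      consistency) * rho m).
  move=> mn; apply: V_dW; apply: ih => //; apply: le_trans ndt.
  by rewrite ler_pM2r// ler_nat ltnW.
have PE x : `|backward dual n F x - backward euler_dual n F x| <= rho n.
  rewrite backward_eulerE; apply: (@backward_dual_euler x sigma (fun m => (1 +
    consistency) * rho m)) => //.
  exact: ltW.
have e1 : `|pr (step 0) (backward dual n F) - pr (step 0) (backward euler_dual
  n F)| <= rho n.
  apply: pr_dist_le => //; first by apply: (bounded_periodic_bc hK pP cP PM).
  exact: (lipschitz_bounded_continuous hK pE El EM).
have e2 := initial_error hK V_le mu0 x0 dx_mesh dx_lt1 dt_gt0 CFL pE EM El.
have G1 := compound_le C2_ge0 ndt.
(* The last two errors together; they are of order [dx] and are dominated by
   [consistency * rho n]. *)
have bound : 1 * (1 + C2 * dt) ^+ n * dx +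
    rate * 1 * n%:R * (1 + C2 * dt) ^+ n * dt ^+ 2 <= consistency * dx.
  have q0 : 0 <= (1 + C2 * dt) ^+ n by rewrite exprn_ge0// addr_ge0//
    mulr_ge0// ltW.
  have -> : 1 * (1 + C2 * dt) ^+ n * dx + rate * 1 * n%:R * (1 + C2 * dt) ^+ n
    * dt ^+ 2 =
    (1 + C2 * dt) ^+ n * (dx + rate * (n%:R * dt) * dt) by ring.
  have ndt0 : 0 <= n%:R * dt by rewrite mulr_ge0// ltW.
  have rn0 : 0 <= rate * (n%:R * dt) by exact: mulr_ge0.
  rewrite /consistency -[leRHS]mulrA; apply: ler_pM => //.
    by rewrite addr_ge0 ?(ltW dx_gt0)// mulr_ge0// ltW.
  rewrite mulrDl mul1r lerD2l.
  have -> : rate * T / C1 * dx = rate * T * (dx / C1) by ring.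
  apply: ler_pM => //; first exact: ltW.
  - by rewrite ler_wpM2l.
  - by rewrite ler_pdivlMr// mulrC.
have dxr := dx_le_rho n.
have Bdx : consistency * dx <= consistency * rho n by rewrite ler_wpM2l
  ?consistency_ge0.
move: e1 e2 eE bound; rewrite -eP.
set s1 := pr _ F; set s2 := pr _ _; set s3 := pr _ _; set s4 := pr _ F.
set r1 := _ * dx; set r2 := _ * dt ^+ 2.
rewrite !ler_norml => /andP[? ?] /andP[? ?] /andP[? ?] bound.
by lra.
Qed.

Lemma lf_step_error_sqrt n : n%:R * dt <= T ->
  (dW (step n) (mu (n%:R * dt)) <=
    ((1 + consistency) * Num.sqrt (dx * expR (growth * T)))%:E)%E.
Proof.
move=> nT; apply: le_trans (lf_step_error nT) _; rewrite lee_fin.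
rewrite ler_wpM2l ?addr_ge0 ?consistency_ge0// ler_wsqrtr// ler_pM2l//.
exact: compound_le growth_ge0 nT.
Qed.

End error_estimate.

(** * Convergence *)

Section conclusion.
Context (R : realType) (K : spatial_domain R) (hK : regular_domain K).

Lemma dW_ge0 (nu1 nu2 : prob K) : (0 <= dW nu1 nu2)%E.
Proof.
apply: ereal_sup_ubound; exists (cst 0).
  split; first exact: bounded_continuous_cst.
  by move=> x y; rewrite subrr normr0 dom_dist_ge0.
by rewrite !pairing_cst subrr.
Qed.

Lemma pr_le_dW (nu1 nu2 : prob K) (F : R -> R) (d : R) : periodic K F ->
  (exists M, forall x, `|F x| <= M) -> (forall x y, `|F x - F y| <= `|x - y|) ->
  (dW nu1 nu2 <= d%:E)%E -> pr nu2 F - pr nu1 F <= d.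
Proof.
move=> pF [M FM] FL; rewrite -lee_fin; apply: le_trans.
have FL1 x y : `|F x - F y| <= 1 * `|x - y| by rewrite mul1r.
apply: ereal_sup_ubound; exists (F \o @lift_of R K) => //; split.
  exact: (lipschitz_bounded_continuous hK pF FL1 FM).
(* The slack [e] provides the strict inequality in [dom_dist_attained]. *)
move=> x y; apply/ler_addgt0Pr => e e0.
have : dom_dist x y < dom_dist x y + e by rewrite ltrDl.
rewrite -{1}(covering_lift hK x) => /(dom_dist_attained hK)[a <- le_a].
rewrite /= (periodic_lift hK _ pF).
exact: le_trans le_a.
Qed.

Lemma cvg_sqrt_bound (P : set R) (u v k : R) :
  (u * Num.sqrt (dx * k) + v * dx)%:E @[dx --> within P (0 : R)^'+] --> 0%E.
Proof.
have cE : (u * Num.sqrt (dx * k) + v * dx) @[dx --> (0 : R)] --> u * Num.sqrt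
  (0 * k) + v * 0.
  have cS : (fun dx => Num.sqrt (dx * k)) @ (0 : R) --> Num.sqrt (0 * k).
    apply: continuous_cvg; first exact: sqrt_continuous.
    by apply: cvgMl; exact: cvg_id.
  by apply: cvgD; apply: cvgM => //; [exact: cvg_cst|exact: cvg_cst].
rewrite mul0r sqrtr0 !mulr0 addr0 in cE.
apply: cvg_EFin; first exact: nearW.
apply: cvg_trans cE; apply: cvg_app => A nA.
by rewrite /within /at_right /within /=; apply: filterS nA => y Ay _ _.
Qed.

End conclusion.

Theorem theorem7 (R : realType) (K : spatial_domain R)
    (hK : K = real_line R \/ K = torus_domain R)
    (V : prob K -> K -> R) (C1 C2 C3 : R)
    (C1_gt0 : 0 < C1) (C2_gt0 : 0 < C2) (C3_gt0 : 0 < C3)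
    (V_bounded : forall nu : prob K, (sup_norm (V nu) <= C1%:E)%E)
    (V_lipschitz : forall (nu : prob K) (x y : K),
      `|V nu x - V nu y| <= C2 * dom_dist x y)
    (V_dW : forall nu1 nu2 : prob K,
      (sup_norm (fun x : K => V nu1 x - V nu2 x)%R <= C3%:E * dW nu1 nu2)%E)
    (mu0 : prob K) (mu0_compact : compact (msupport mu0))
    (lambda0 : R) (lambda0_gt0 : 0 < lambda0)
    (dt x0 : R -> R)
    (CFL : forall dx : R, mesh_size K dx -> lambda0 <= dt dx / dx <= C1^-1)
    (mu : R -> prob K) (mu_solution : measure_valued_solution V mu0 mu)
    (T : R) (T_gt0 : 0 < T) :
  ereal_sup [set dW (lf V mu0 dx (dt dx) (x0 dx) t) (mu t) | t in `[0, T]]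
    @[dx --> within (mesh_size K) (0 : R)^'+] --> 0%E.
Proof.
have {}hK : regular_domain K.
  by case: hK => ->; [exact: regular_real_line|exact: regular_torus].
have V_le nu x : `|V nu x| <= C1.
  rewrite -lee_fin; apply: le_trans (V_bounded nu).
  by apply: ereal_sup_ubound; exists x.
have V_close nu1 nu2 x d : (dW nu1 nu2 <= d%:E)%E -> `|V nu1 x - V nu2 x| <= C3
  * d.
  move=> h; rewrite -lee_fin EFinM.
  apply: (@le_trans _ _ (C3%:E * dW nu1 nu2)%E); last by rewrite lee_pmul2l.
  apply: le_trans (V_dW nu1 nu2).
  by apply: ereal_sup_ubound; exists x.
have [B [B' [b [[B1 B2 B3 b0 B4] [B5 B6 B7]]]]] := smooth_step R.
pose C1_ge0 := ltW C1_gt0; pose C2_ge0 := ltW C2_gt0; pose C3_ge0 := ltW C3_gt0.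
have mu_lip := pr_time_lip hK V_le V_lipschitz C1_ge0 C2_ge0 mu_solution B1 B2
  B4 B5 B6 B7.
have mu_euler := euler_step hK V_le V_lipschitz V_close C1_ge0 C2_ge0 C3_ge0
  mu_solution B1 B2 b0 B4 B5 B6 B7.
set rate := euler_rate C1 C2 C3 b in mu_euler.
have rate_ge0 : 0 <= rate.
  by rewrite /rate /euler_rate mulr_ge0 ?(ltW b0)// addr_ge0// !mulr_ge0// ltW.
have mu_start F : pr (mu 0) F = pr mu0 F.
  by have [mu00 _ _] := mu_solution; exact: pairing_ext.
(* The interpolation at a time up to [T] uses step [n.+1], which may exceed [T] by at most
   [h <= dx / C1 < C1^-1]. *)
pose T' := T + C1^-1.
have T'_ge0 : 0 <= T' by rewrite addr_ge0// ?invr_ge0 ltW.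
pose cons := consistency C1 C2 rate T'.
pose kappa := growth C1 C2 C3 rate lambda0 T'.
(* The error at the time steps, plus the motion of the solution between [t] and a neighbouring step,
   at most [b * C1 * h <= b * dx]. *)
pose bound dx := (1 + cons) * Num.sqrt (dx * expR (kappa * T')) + b * dx.
have lf_le dx t : mesh_size K dx -> dx < 1 -> 0 <= t <= T ->
    (dW (lf V mu0 dx (dt dx) (x0 dx) t) (mu t) <= (bound dx)%:E)%E.
  move=> dx_mesh dx1 /andP[t0 tT]; have dx0 := mesh_size_gt0 hK dx_mesh.
  have /andP[lam_le cfl] := CFL dx dx_mesh; set h := dt dx in lam_le cfl *.
  have lam_h : lambda0 * dx <= h by rewrite -ler_pdivlMr.
  have h0 : 0 < h by rewrite (lt_le_trans _ lam_h)// mulr_gt0.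
  have C1h : C1 * h <= dx.
    by move: cfl; rewrite ler_pdivrMr// ler_pdivlMl.
  have h_le : h <= C1^-1.
    by rewrite -[leRHS]mulr1 ler_pdivlMl// (le_trans C1h)// ltW.
  set n := Num.truncn (t / h).
  have /andP[n_le n_gt] := truncn_itv (divr_ge0 t0 (ltW h0)).
  rewrite -/n ler_pdivlMr// in n_le; rewrite -/n ltr_pdivrMr// in n_gt.
  have n1E : n.+1%:R * h = n%:R * h + h by rewrite -natr1 mulrDl mul1r.
  have nT : n%:R * h <= T' by rewrite (le_trans n_le)// (le_trans tT)// lerDl
    invr_ge0.
  have n1T : n.+1%:R * h <= T' by rewrite n1E lerD// (le_trans n_le).
  have err := @lf_step_error_sqrt R K hK V C1 C2 C3 V_le V_lipschitz V_close
    C1_gt0 C2_ge0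
    mu0 mu mu_start rate rate_ge0 mu_euler dx h (x0 dx) dx_mesh dx1 h0 C1h
      lambda0 T' lambda0_gt0 lam_h T'_ge0.
  apply: dW_le => // F pF [M FM] FL.
  have FL1 x y : `|F x - F y| <= 1 * `|x - y| by rewrite mul1r.
  have bF := lipschitz_bounded_continuous hK pF FL1 FM.
  have step_le m : `|m%:R * h - t| <= h -> m%:R * h <= T' ->
      pr (mu t) F - pr (lf_step V mu0 dx h (x0 dx) m) F <= bound dx.
    move=> mt mT.
    have e1 := pr_le_dW hK pF (ex_intro _ M FM) FL (err m mT).
    have e2 : pr (mu t) F - pr (mu (m%:R * h)) F <= b * dx.
      rewrite (le_trans (ler_norm _))//.
      apply: (@le_trans _ _ (b * 1 * C1 * `|m%:R * h - t|)).
        have mh0 : 0 <= m%:R * h by rewrite mulr_ge0// ltW.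
        have [mt'|/ltW mt'] := leP (m%:R * h) t.
          have d0 : 0 <= t - m%:R * h by rewrite subr_ge0.
          have := mu_lip F M 1 (m%:R * h) (t - m%:R * h) pF FM FL1 mh0 d0.
          have -> : m%:R * h + (t - m%:R * h) = t by ring.
          by rewrite (distrC (m%:R * h)) (ger0_norm d0).
        have d0 : 0 <= m%:R * h - t by rewrite subr_ge0.
        have := mu_lip F M 1 t (m%:R * h - t) pF FM FL1 t0 d0.
        have -> : t + (m%:R * h - t) = m%:R * h by ring.
        by rewrite distrC (ger0_norm d0).
      rewrite mulr1 -mulrA ler_pM2l// (le_trans _ C1h)// ler_pM2l//.
    by move: e1; rewrite /bound -/cons -/kappa; lra.
  (* The approximation at time [t] is a convex combination of two steps within [h] of [t], so it
     inherits their common bound. *)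
  pose a := (n.+1%:R * h - t) / h; pose c := (t - n%:R * h) / h.
  have a0 : 0 <= a by rewrite divr_ge0 ?(ltW h0)// subr_ge0 ltW.
  have c0 : 0 <= c by rewrite divr_ge0 ?(ltW h0)// subr_ge0.
  have ac1 : a + c = 1 by rewrite /a /c n1E; field; rewrite gt_eqF.
  have -> : pr (lf V mu0 dx h (x0 dx) t) F =
      a * pr (lf_step V mu0 dx h (x0 dx) n) F + c * pr (lf_step V mu0 dx h (x0
        dx) n.+1) F.
    exact: mixture_pairing.
  have e1 := step_le n _ nT; have e2 := step_le n.+1 _ n1T.
  have {}e1 : pr (mu t) F - pr (lf_step V mu0 dx h (x0 dx) n) F <= bound dx.
    by apply: e1; rewrite ler_norml; lra.
  have {}e2 : pr (mu t) F - pr (lf_step V mu0 dx h (x0 dx) n.+1) F <= bound dx.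
    by apply: e2; rewrite ler_norml; lra.
  have := ler_wpM2l a0 e1; have := ler_wpM2l c0 e2.
  have aE : a = 1 - c by lra.
  by rewrite aE; lra.
apply: (@squeeze_cvge _ _ _ _ (cst 0%E) _ (fun dx => (bound dx)%:E)).
- rewrite near_withinE; near=> dx => dx_mesh.
  have dx1 : dx < 1 by near: dx; exact: nbhs_right_lt.
  (* The supremum is nonnegative because time 0 belongs to [[0, T]]. *)
  apply/andP; split.
    apply: (@le_trans _ _ (dW (lf V mu0 dx (dt dx) (x0 dx) 0) (mu 0)));
      first exact: dW_ge0.
    by apply: ereal_sup_ubound; exists 0 => //; rewrite /= in_itv /= lexx ltW.
  apply: ge_ereal_sup => _ [t /= tT <-]; exact: lf_le.
- exact: cvg_cst.
- exact: cvg_sqrt_bound.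
Unshelve. all: by end_near. Qed.
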